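(* For each $\varepsilon>0$ there is a constant $C_\varepsilon>0$ such that the following holds. Let $p\in[0,1]$ satisfy $p\ge C_\varepsilon\, n^{-2/3}\log^{2/3} n$. Let $G\sim G(n,p)$ be a random graph on a set $V$ of $n$ vertices, and let the initial coloring $V=R_0\sqcup B_0$ be the random $1/2$ coloring, independent of $G$. Then, with probability at least $1-\varepsilon$, the initially larger side wins the majority dynamics on $G$ with initial sides $(R_0,B_0)$ within $O(\log_{pn} n)$ days.
   Context: $G(n,p)$ is the Erdős–Rényi random graph on $n$ vertices: each pair of vertices is joined by an edge independently with probability $p$. The random $1/2$ coloring colors each vertex Red or Blue with probability $1/2$ each, independently over all vertices (equivalently, the ordered partition $(R_0,B_0)$ of $V$ is uniform among all $2^n$ possibilities). Majority dynamics on a simple undirected graph $G=(V,E)$ with initial sides $(R_0,B_0)$: on day $0$ the vertices of $R_0$ are colored Red and those of $B_0$ are colored Blue. For each $t\ge 0$, on day $t+1$ every vertex simultaneously adopts the color held on day $t$ by the majority of its neighbors, and keeps its own day-$t$ color in case of a tie. A side (color) wins within $T$ days if for some $t\le T$ all vertices have that color on day $t$. The initially larger side is Red if $|R_0|>|B_0|$ and Blue if $|B_0|>|R_0|$. The probability is over both $G$ and the initial coloring. The implied constant in $O(\cdot)$ is absolute, and $\log$ is the natural logarithm. *)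

(* Defs.v *)
From HB Require Import structures.
From mathcomp Require Import all_boot all_order all_algebra.
From mathcomp Require Import reals exp.
Set Implicit Arguments.
Unset Strict Implicit.
Unset Printing Implicit Defensive.
Import Order.TTheory GRing.Theory Num.Theory.
Local Open Scope ring_scope.

Definition vpairs (V : finType) : {set {set V}} := [set e : {set V} | #|e| == 2%N].

(* A simple undirected graph on V, given by its set of edges. *)
Definition sgraph (V : finType) : finType :=
  {E : {set {set V}} | E \subset vpairs V}.

Definition adj (V : finType) (G : sgraph V) : rel V :=
  fun u v => [set u; v] \in val G.

Lemma adj_sym (V : finType) (G : sgraph V) : symmetric (adj G).
Proof. by move=> u v; rewrite /adj setUC. Qed.

Lemma adj_irrefl (V : finType) (G : sgraph V) : irreflexive (adj G).
Proof.
move=> u; apply/negP => /(subsetP (valP G)).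
by rewrite inE setUid cards1.
Qed.

Definition nbrs (V : finType) (G : sgraph V) (v : V) : {set V} :=
  [set u | adj G v u].

(* A coloring is encoded by its set of Red vertices; the Blue vertices are
   those of the complement. *)
Definition majority_step (V : finType) (G : sgraph V) (R : {set V}) : {set V} :=
  [set v | let r := #|nbrs G v :&: R| in
           let b := #|nbrs G v :&: ~: R| in
           (b < r)%N || ((b == r) && (v \in R))].

Definition red_on_day (V : finType) (G : sgraph V) (R0 : {set V}) (t : nat) :
    {set V} :=
  iter t (majority_step G) R0.

Definition red_wins_within (V : finType) (G : sgraph V) (R0 : {set V})
    (T : nat) : bool :=
  [exists t : 'I_T.+1, red_on_day G R0 t == [set: V]].

Definition blue_wins_within (V : finType) (G : sgraph V) (R0 : {set V})
    (T : nat) : bool :=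
  [exists t : 'I_T.+1, ~: red_on_day G R0 t == [set: V]].

(* There is no initially larger side, hence no win, when |R0| = |B0|. *)
Definition larger_side_wins_within (V : finType) (G : sgraph V) (R0 : {set V})
    (T : nat) : bool :=
  ((#|~: R0| < #|R0|)%N && red_wins_within G R0 T) ||
  ((#|R0| < #|~: R0|)%N && blue_wins_within G R0 T).

Definition gnp_mass (R : realType) (V : finType) (p : R) (G : sgraph V) : R :=
  \prod_(e in vpairs V) (if e \in val G then p else 1 - p).

Definition half_coloring_mass (R : realType) (V : finType) (R0 : {set V}) : R :=
  \prod_(v : V) 2^-1.

(* The product law on pairs (G, R0): the coloring is independent of G. *)
Definition Pr_gnp_half (R : realType) (V : finType) (p : R)
    (event : sgraph V -> {set V} -> bool) : R :=
  \sum_(w : sgraph V * {set V} | event w.1 w.2)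
    gnp_mass p w.1 * half_coloring_mass R w.2.

Definition log_base (R : realType) (b x : R) : R := ln x / ln b.

(* Main.v *)
Require Import Defs.
From HB Require Import structures.
From mathcomp Require Import all_boot all_order all_algebra.
From mathcomp Require Import reals sequences exp.
From mathcomp Require Import ring lra zify.
Set Implicit Arguments.
Unset Strict Implicit.
Unset Printing Implicit Defensive.
Import Order.TTheory GRing.Theory Num.Theory.
Local Open Scope ring_scope.

(** Write [n] for the number of vertices, [s] and [q] for the square roots of
    [n] and of the mean degree [d = p n]. The base [d] of the logarithm is at
    most [n], so [log_{d} n >= 1] and it is enough that the larger side wins
    within nine days. After cubing, the density hypothesis reads
    [d ^ 3 >= C ^ 3 n (ln n) ^ 2]. A random coloring has an initial surplus
    (the larger side minus the smaller one) of order [s] with probability close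
    to one ([surplus_small], [surplus_large]), and exchanging the colors
    commutes with the dynamics ([day_compl]). So fix a coloring with a red
    surplus of order [s]; red must be shown to win ([red_wins]). This happens in
    three stages.

    Growth. On the first day a vertex compares binomials with [r] and [b]
    trials, where [r - b] is of order [s]. Pairing trials of opposite signs
    exhibits their difference as an independent binomial plus a symmetric
    lazy walk, whose atoms are unimodal; this gives a bias of order
    [p s / q = q / s] towards red ([tail_gap], [gap_lower]), hence a mean surplus
    of order [n q / s = q s]. Two vertices depend on each other only through the
    edge joining them, so the variance is at most [3 n] and Chebyshev's inequality
    applies ([day_one]).

    Expansion. Let a coloring have surplus [S], and let [T] be a set of vertices.
    By Bernstein's inequality the probability that no vertex of [T] sees a strict
    red majority is at most [exp (- p |T| (S - 1) ^ 2 / (16 n))]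
    ([blocked_bound]). If [p S ^ 2] is a large multiple of [n], a union bound over
    all the [4 ^ n] pairs of a coloring and a set shows that on the next day
    at most [n / 8] vertices are blue ([big_step]). From then on a finer union
    bound makes the blue set shrink every day by a factor of order [ln n / d]
    ([small_step]), and six such days leave it empty ([contraction]). These
    bounds hold for all colorings at once, so it does not matter that the
    coloring of the day depends on the graph. With [S] of order [q s] the
    condition on [S] says that [d ^ 2] is a large multiple of [n], so that one
    day of growth suffices when [p] is at least of the order of [n ^ (-1/2)].

    Second day of growth. Below that density the edges at a vertex [v] are
    drawn last. Given the other edges, it is determined which vertices [u]
    would be red on the first day if they were joined to [v]; let [k] of the
    [N = n - 1] possible neighbors be such ([forced]). On the second day [v]
    compares binomials with [k] and [N - k] trials ([Ex_red2]). Now [v] has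
    itself voted on the first day, which displaces the mean of [k] from [N / 2]
    by an order of [n / q] in favor of the color of [v]; this is more than the
    effect of the surplus. But it has opposite signs for red and for blue
    vertices, and in the sum over a red and a blue vertex only the surplus
    remains ([forced_sum]). As the chance [maj] of a red majority satisfies
    [maj N k + maj N (N - k) = 1] up to ties, such a pair gains the number, of
    order [q s], of extra red neighbor candidates, times [p], times the
    chance of a near tie, which is at least of order [1 / q] by the local lower
    bound [pmf_signs0_ge]. Thus the mean surplus is of order [n p s = q ^ 2 s]
    ([day_two_mean]). Two vertices [v] and [w] become independent given the edges
    away from both, once each ignores the edge to the other and the votes of the
    other ([Ex_red2M], [red2_ignore]); the variance is therefore of order
    [n q ^ 3], and Chebyshev's inequality applies since [q] is large ([day_two]).
    With [S] of order [q ^ 2 s] the condition for expansion says that [d ^ 3] is a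
    large multiple of [n], which is the source of the exponent [2 / 3]. *)

(** * Random subsets: independence, variance and deviation bounds *)

Section RandomSubset.
Context (R : realFieldType) (I : finType) (P : I -> R).
Implicit Types (E F J K : {set I}) (f g : {set I} -> R).

(** The product measure under which every [i] belongs to the random set
    independently with probability [P i]; [Ex] and [Pr] are its mean and its
    probability. *)
Definition mass E : R := \prod_i (if i \in E then P i else 1 - P i).
Definition Ex f : R := \sum_E mass E * f E.
Definition Pr (b : {set I} -> bool) : R := Ex (fun E => (b E)%:R).
Definition splice J E F : {set I} := (E :&: J) :|: (F :\: J).
Definition depends_on (T : Type) J (f : {set I} -> T) :=
  forall E F, E :&: J = F :&: J -> f E = f F.

Lemma eq_Ex f g : f =1 g -> Ex f = Ex g.
Proof. by move=> fg; apply: eq_bigr => E _; rewrite fg. Qed.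

Lemma ExD f g : Ex (fun E => f E + g E) = Ex f + Ex g.
Proof. by rewrite -big_split; apply: eq_bigr => E _; rewrite mulrDr. Qed.

Lemma ExZ c f : Ex (fun E => c * f E) = c * Ex f.
Proof. by rewrite big_distrr; apply: eq_bigr => E _; rewrite mulrCA. Qed.

Lemma ExZr c f : Ex (fun E => f E * c) = Ex f * c.
Proof. by rewrite mulrC -ExZ; apply: eq_Ex => E; rewrite mulrC. Qed.

Lemma ExN f : Ex (fun E => - f E) = - Ex f.
Proof. by rewrite -sumrN; apply: eq_bigr => E _; rewrite mulrN. Qed.

Lemma ExB f g : Ex (fun E => f E - g E) = Ex f - Ex g.
Proof. by rewrite ExD ExN. Qed.

Lemma Ex_sum (K : Type) (r : seq K) (Q : pred K) (F : K -> {set I} -> R) :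
  Ex (fun E => \sum_(k <- r | Q k) F k E) = \sum_(k <- r | Q k) Ex (F k).
Proof.
rewrite /Ex exchange_big /=; apply: eq_bigr => E _.
by rewrite big_distrr.
Qed.

Lemma Ex_prod (a b : I -> R) :
  Ex (fun E => \prod_i (if i \in E then a i else b i)) =
  \prod_i (P i * a i + (1 - P i) * b i).
Proof.
rewrite bigA_distr; apply: eq_bigr => E _.
rewrite /mass -big_split /=; apply: eq_bigr => i _.
by case: ifP.
Qed.

Lemma Ex_cst c : Ex (fun _ => c) = c.
Proof.
have -> : Ex (fun=> c) = c * Ex (fun E => \prod_i (if i \in E then 1 else 1)).
  rewrite -ExZ; apply: eq_Ex => E.
  by rewrite big1 ?mulr1 // => i _; case: ifP.
rewrite Ex_prod big1 ?mulr1 // => i _; ring.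
Qed.

(** Exchanging the parts of [E] and [F] outside [J] is an involution of the
    pairs [(E, F)] that preserves the product of their masses. *)
Lemma Ex_resample J f :
  Ex f = Ex (fun E => Ex (fun F => f (splice J E F))).
Proof.
have mK E F : splice J (splice J E F) (splice J F E) = E.
  by apply/setP => i; rewrite !inE; case: (i \in J); rewrite ?andbF ?andbT ?orbF.
have mM E F : mass (splice J E F) * mass (splice J F E) = mass E * mass F.
  rewrite /mass -!big_split /=; apply: eq_bigr => i _; rewrite !inE.
  by case: (i \in J); rewrite ?andbF ?andbT ?orbF //= mulrC.
transitivity (\sum_E \sum_F mass E * mass F * f E).
  apply: eq_bigr => E _; rewrite -big_distrl /= -big_distrr /=; congr (_ * _).
  rewrite -[LHS]mulr1 -(Ex_cst 1); congr (_ * _).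
  by apply: eq_bigr => F _; rewrite mulr1.
transitivity (\sum_E \sum_F mass E * mass F * f (splice J E F)); last first.
  apply: eq_bigr => E _; rewrite /Ex big_distrr /=; apply: eq_bigr => F _.
  by rewrite mulrA.
rewrite !pair_big /=.
rewrite (reindex (fun u : {set I} * {set I} =>
  (splice J u.1 u.2, splice J u.2 u.1))) /=.
  by apply: eq_bigr => -[E F] _ /=; rewrite mM.
by exists (fun u => (splice J u.1 u.2, splice J u.2 u.1)) => -[E F] _ /=;
  rewrite !mK.
Qed.

Lemma splice_onl (J K : {set I}) E F : K \subset J -> splice J E F :&: K = E :&: K.
Proof.
move=> /subsetP sKJ; apply/setP => i; rewrite !inE.
by have [/sKJ ->|] := boolP (i \in K); rewrite ?andbF // ?andbT ?orbF.
Qed.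

Lemma splice_onr (J K : {set I}) E F : [disjoint K & J] -> splice J E F :&: K = F :&: K.
Proof.
move=> /disjointFr dKJ; apply/setP => i; rewrite !inE.
by have [/dKJ ->|] := boolP (i \in K); rewrite ?andbF // ?andbT ?orbF.
Qed.

(** Drawing the coordinates outside [J] afresh does not change [f], and makes
    [g] independent of it. *)
Lemma Ex_indep J K f g : [disjoint J & K] -> depends_on J f ->
  depends_on K g -> Ex (fun E => f E * g E) = Ex f * Ex g.
Proof.
move=> dJK fJ gK; rewrite (Ex_resample J) -ExZr; apply: eq_Ex => E.
rewrite -ExZ; apply: eq_Ex => F.
rewrite (fJ _ E) ?splice_onl //; rewrite (gK _ F) //.
by rewrite splice_onr // disjoint_sym.
Qed.

Lemma Ex_mem i : Ex (fun E => (i \in E)%:R) = P i.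
Proof.
pose a (j : I) : R := 1; pose b (j : I) : R := if j == i then 0 else 1.
rewrite (@eq_Ex _ (fun E => \prod_j (if j \in E then a j else b j))).
  rewrite Ex_prod (bigD1 i) //= big1 => [|j /negbTE ji].
    by rewrite /a /b eqxx !mulr1 mulr0 addr0.
  by rewrite /a /b ji; ring.
move=> E; have [iE|iE] := boolP (i \in E).
  rewrite big1 // => j _; rewrite /a /b; case: ifP => // jE.
  by case: eqP => // ji; rewrite ji iE in jE.
by rewrite (bigD1 i) //= (negbTE iE) /b eqxx mul0r.
Qed.

Lemma Ex_coord i f :
  Ex f = P i * Ex (fun E => f (i |: E)) + (1 - P i) * Ex (fun E => f (E :\ i)).
Proof.
have -> : Ex f = Ex (fun E => Ex (fun F =>
   (i \in F)%:R * f (i |: E) + (1 - (i \in F)%:R) * f (E :\ i))).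
  rewrite (Ex_resample (~: [set i])); apply: eq_Ex => E; apply: eq_Ex => F.
  rewrite /splice; have [iF|iF] := boolP (i \in F).
    rewrite subrr mul0r addr0 mul1r; congr f; apply/setP => j; rewrite !inE negbK.
    by have [->|] := eqVneq j i; rewrite ?iF ?andbF ?andbT ?orbF.
  rewrite subr0 mul0r add0r mul1r; congr f; apply/setP => j; rewrite !inE negbK.
  by have [->|] := eqVneq j i; rewrite ?(negbTE iF) ?andbF ?andbT ?orbF.
rewrite -!ExZ -ExD; apply: eq_Ex => E.
by rewrite ExD !ExZr ExB Ex_cst Ex_mem.
Qed.

Hypothesis P01 : forall i, 0 <= P i <= 1.

Lemma mass_ge0 E : 0 <= mass E.
Proof.
apply: prodr_ge0 => i _; have /andP[P0 P1] := P01 i.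
by case: ifP; rewrite ?subr_ge0.
Qed.

Lemma le_Ex f g : (forall E, f E <= g E) -> Ex f <= Ex g.
Proof. by move=> fg; apply: ler_sum => E _; rewrite ler_wpM2l ?mass_ge0. Qed.

Lemma Ex_ge0 f : (forall E, 0 <= f E) -> 0 <= Ex f.
Proof. by move=> f0; apply: sumr_ge0 => E _; rewrite mulr_ge0 ?mass_ge0. Qed.

Lemma Ex_ge f c : (forall E, c <= f E) -> c <= Ex f.
Proof. by move=> cf; rewrite -(Ex_cst c); apply: le_Ex. Qed.

Lemma Ex_le f c : (forall E, f E <= c) -> Ex f <= c.
Proof. by move=> cf; rewrite -(Ex_cst c); apply: le_Ex. Qed.

Lemma ler_norm_Ex f : `|Ex f| <= Ex (fun E => `|f E|).
Proof.
rewrite ler_norml -ExN; apply/andP; split; apply: le_Ex => E; last exact: ler_norm.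
by rewrite lerNl -normrN ler_norm.
Qed.

Lemma le_Pr (b c : {set I} -> bool) : (forall E, b E -> c E) -> Pr b <= Pr c.
Proof.
by move=> bc; apply: le_Ex => E; rewrite ler_nat; case: (b E) (bc E) => // ->.
Qed.

Lemma Pr_ge0 b : 0 <= Pr b.
Proof. by apply: Ex_ge0 => E; case: (b E). Qed.

Lemma Pr_le1 b : Pr b <= 1.
Proof. by apply: Ex_le => E; case: (b E). Qed.

Lemma Pr_not b : Pr (fun E => ~~ b E) = 1 - Pr b.
Proof.
rewrite /Pr -[X in X - _](Ex_cst 1) -ExB; apply: eq_Ex => E.
by case: (b E) => /=; ring.
Qed.

Lemma Pr_or b c : Pr (fun E => b E || c E) <= Pr b + Pr c.
Proof.
rewrite /Pr -ExD; apply: le_Ex => E.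
by case: (b E); case: (c E) => /=; lra.
Qed.

Lemma Pr_exists (K : finType) (Q : pred K) (b : K -> {set I} -> bool) :
  Pr (fun E => [exists k, Q k && b k E]) <= \sum_(k | Q k) Pr (b k).
Proof.
rewrite /Pr -Ex_sum; apply: le_Ex => E.
have [/existsP[k /andP[Qk bk]]|_] := boolP [exists k, Q k && b k E].
  by rewrite (bigD1 k) //= bk lerDl sumr_ge0.
by rewrite sumr_ge0.
Qed.

Definition variance f : R := Ex (fun E => (f E - Ex f) ^+ 2).

Lemma eq_variance f g : f =1 g -> variance f = variance g.
Proof.
by move=> fg; rewrite /variance (eq_Ex fg); apply: eq_Ex => E; rewrite fg.
Qed.

Lemma Ex_sqrB f c :
  Ex (fun E => (f E - c) ^+ 2) = variance f + (Ex f - c) ^+ 2.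
Proof.
have -> : Ex (fun E => (f E - c) ^+ 2) = Ex (fun E => (f E - Ex f) ^+ 2
    + (2 * (Ex f - c) * (f E - Ex f) + (Ex f - c) ^+ 2)).
  by apply: eq_Ex => E; ring.
by rewrite !ExD ExZ ExB !Ex_cst -/(variance f); ring.
Qed.

Lemma variance_le f c : variance f <= Ex (fun E => (f E - c) ^+ 2).
Proof. by rewrite Ex_sqrB lerDl sqr_ge0. Qed.

(** Apply [2 x y <= x ^ 2 + y ^ 2] to the two deviations from the mean. *)
Lemma covariance_le f g : Ex (fun E => f E * g E) - Ex f * Ex g <=
  (variance f + variance g) / 2.
Proof.
have -> : Ex (fun E => f E * g E) - Ex f * Ex g =
    Ex (fun E => (f E - Ex f) * (g E - Ex g)).
  have -> : Ex (fun E => (f E - Ex f) * (g E - Ex g)) = Ex (fun E => f E * g E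
     - (Ex f * g E + Ex g * f E - Ex f * Ex g)) by apply: eq_Ex => E; ring.
  by rewrite !(ExB, ExD, ExZ, Ex_cst); ring.
rewrite -ExD -ExZr; apply: le_Ex => E.
have := sqr_ge0 ((f E - Ex f) - (g E - Ex g)); nra.
Qed.

Lemma chebyshev_lower f (c t : R) : 0 < t -> c + t <= Ex f ->
  Pr (fun E => f E <= c) * t ^+ 2 <= variance f.
Proof.
move=> t0 cf; rewrite /Pr -ExZr; apply: le_Ex => E.
have [fc|fc] := leP (f E) c; last by rewrite mul0r sqr_ge0.
by rewrite mul1r; nra.
Qed.

(** The mean absolute deviation is at most the standard deviation, by the
    pointwise bound [2 y <= y ^ 2 / s + s]. *)
Lemma Ex_norm_le f c (s : R) : 0 < s -> Ex (fun E => (f E - c) ^+ 2) <= s ^+ 2 ->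
  Ex (fun E => `|f E - c|) <= s.
Proof.
move=> s0 h; have : Ex (fun E => `|f E - c|) <=
    Ex (fun E => ((f E - c) ^+ 2 / s + s) / 2).
  apply: le_Ex => E; rewrite -[(f E - c) ^+ 2]real_normK ?num_real //.
  set y := `|_|; rewrite ler_pdivlMr // -subr_ge0.
  have -> : y ^+ 2 / s + s - y * 2 = (y - s) ^+ 2 / s by field; rewrite gt_eqF.
  by rewrite divr_ge0 ?sqr_ge0 // ltW.
move=> /le_trans; apply.
rewrite ExZr ExD ExZr Ex_cst ler_pdivrMr // mulr_natr mulr2n lerD2r.
by rewrite ler_pdivrMr // -expr2.
Qed.

(** Expanding the square, every diagonal term is at most [1] and every other
    one is a covariance. *)
Lemma variance_sum (K : finType) (A : {set K}) (f : K -> {set I} -> R) (c : R) :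
  0 <= c -> (forall k E, k \in A -> 0 <= f k E <= 1) ->
  (forall k l, k \in A -> l \in A -> k != l ->
     Ex (fun E => f k E * f l E) - Ex (f k) * Ex (f l) <= c) ->
  variance (fun E => \sum_(k in A) f k E) <= #|A|%:R + #|A|%:R ^+ 2 * c.
Proof.
move=> c0 f01 cov.
have -> : variance (fun E => \sum_(k in A) f k E) = \sum_(k in A) \sum_(l in A)
    (Ex (fun E => f k E * f l E) - Ex (f k) * Ex (f l)).
  rewrite /variance Ex_sum /=; set m := \sum_(k in A) _.
  have -> : Ex (fun E => (\sum_(k in A) f k E - m) ^+ 2) =
      Ex (fun E => (\sum_(k in A) \sum_(l in A) f k E * f l E) -
         (2 * m * (\sum_(k in A) f k E) - m ^+ 2)).
    apply: eq_Ex => E; rewrite sqrrB.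
    under [in RHS]eq_bigr do rewrite -mulr_sumr.
    by rewrite -mulr_suml; ring.
  rewrite !(ExB, ExZ) Ex_cst !Ex_sum /= -/m.
  under eq_bigr => k _ do rewrite Ex_sum.
  under [in RHS]eq_bigr => k _ do rewrite sumrB -mulr_sumr -/m.
  by rewrite sumrB -mulr_suml -/m; ring.
have le1 k l : k \in A -> l \in A ->
    Ex (fun E => f k E * f l E) - Ex (f k) * Ex (f l) <= (k == l)%:R + c.
  move=> kA lA; have [->|kl] := eqVneq; last by rewrite add0r cov.
  have : Ex (fun E => f l E * f l E) <= 1.
    by apply: Ex_le => E; have /andP[] := f01 l E lA; nra.
  have : 0 <= Ex (f l) by apply: Ex_ge0 => E; have /andP[] := f01 l E lA.
  by rewrite /=; nra.
apply: (@le_trans _ _ (\sum_(k in A) \sum_(l in A) ((k == l)%:R + c))).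
  by apply: ler_sum => k kA; apply: ler_sum => l lA; exact: le1.
have row k : k \in A -> \sum_(l in A) ((k == l)%:R + c) = 1 + #|A|%:R * c.
  move=> kA; rewrite big_split /= sumr_const mulr_natl (bigD1 k) //= eqxx.
  by rewrite big1 ?addr0 // => l /andP[_ /negbTE lk]; rewrite eq_sym lk.
rewrite (eq_bigr (fun=> 1 + #|A|%:R * c)) // sumr_const -[X in X <= _]mulr_natl.
by rewrite mulrDr mulr1 mulrA expr2.
Qed.

End RandomSubset.

(** * Sums of weighted Bernoulli variables and the lazy walk *)

Section Law.
Context (R : realFieldType) (p : R).
Implicit Types (s t : seq int) (g : int -> R) (m : nat) (k : int).

(** The mean of [g] at the sum of the entries of [s], each entry being kept
    independently with probability [p]. *)
Fixpoint law s g : R :=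
  if s is c :: s' then p * law s' (fun k => g (c + k)) + (1 - p) * law s' g
  else g 0.

Definition pmf s k : R := law s (fun j => (j == k)%:R).

Lemma eq_law s g g' : g =1 g' -> law s g = law s g'.
Proof.
elim: s g g' => [|c s IH] g g' gg' /=; first exact: gg'.
by congr (_ * _ + _ * _); apply: IH.
Qed.

Lemma lawD s g g' : law s (fun k => g k + g' k) = law s g + law s g'.
Proof. by elim: s g g' => [|c s IH] g g' //=; rewrite !IH; ring. Qed.

Lemma lawZ s x g : law s (fun k => x * g k) = x * law s g.
Proof. by elim: s g => [|c s IH] g //=; rewrite !IH; ring. Qed.

Lemma lawN s g : law s (fun k => - g k) = - law s g.
Proof. by elim: s g => [|c s IH] g //=; rewrite !IH; ring. Qed.

Lemma lawB s g g' : law s (fun k => g k - g' k) = law s g - law s g'.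
Proof. by rewrite lawD lawN. Qed.

Lemma law_cst s x : law s (fun=> x) = x.
Proof. by elim: s => [|c s IH] //=; rewrite !IH; ring. Qed.

Lemma law_sum (K : Type) (r : seq K) s (G : K -> int -> R) :
  law s (fun k => \sum_(i <- r) G i k) = \sum_(i <- r) law s (G i).
Proof.
elim: r => [|i r IH].
  by rewrite big_nil -[RHS](law_cst s); apply: eq_law => k; rewrite big_nil.
by rewrite big_cons -IH -lawD; apply: eq_law => k; rewrite big_cons.
Qed.

Lemma law_cat s t g : law (s ++ t) g = law s (fun i => law t (fun j => g (i + j))).
Proof.
elim: s g => [|c s IH] g /=; first by apply: eq_law => k; rewrite add0r.
rewrite !IH; congr (_ * _ + _); apply: eq_law => i; apply: eq_law => j.
by rewrite addrA.
Qed.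

Lemma law_perm s t g : perm_eq s t -> law s g = law t g.
Proof.
elim: s t g => [|c s IH] t g; first by rewrite perm_sym => /perm_nilP ->.
move=> st; have : c \in t by rewrite -(perm_mem st) mem_head.
move: st => /[swap] /splitPr[t1 t2].
rewrite perm_sym -cat1s perm_catCA /= perm_cons perm_sym => st.
rewrite !(IH _ _ st) !law_cat /= lawD !lawZ; congr (_ * _ + _).
by apply: eq_law => i; apply: eq_law => j; rewrite addrCA.
Qed.

Lemma law_opp s g : law (map -%R s) g = law s (fun k => g (- k)).
Proof.
elim: s g => [|c s IH] g /=; first by rewrite oppr0.
by rewrite !IH; congr (_ * _ + _); apply: eq_law => k; rewrite opprD.
Qed.

Lemma eq_law_in s g g' : all (fun c => `|c| <= 1) s ->
  (forall k, `|k| <= (size s)%:Z -> g k = g' k) -> law s g = law s g'.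
Proof.
elim: s g g' => [|c s IH] g g' /=; first by move=> _ -> //.
move=> /andP[c1 s1] gg'; congr (_ * _ + _ * _); apply: IH => // k ks; apply: gg'; lia.
Qed.

Lemma law_mean s : law s (fun k => k%:~R) = p * \sum_(c <- s) c%:~R.
Proof.
elim: s => [|c s IH] /=; first by rewrite big_nil mulr0.
have -> : law s (fun k => (c + k)%:~R) = law s (fun k => c%:~R + k%:~R).
  by apply: eq_law => k; rewrite intrD.
by rewrite lawD law_cst IH big_cons; ring.
Qed.

Lemma law_sqr s : law s (fun k => k%:~R ^+ 2) =
  (p * \sum_(c <- s) c%:~R) ^+ 2 + p * (1 - p) * \sum_(c <- s) c%:~R ^+ 2.
Proof.
elim: s => [|c s IH] /=; first by rewrite !big_nil; ring.
have -> : law s (fun k => (c + k)%:~R ^+ 2) =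
    law s (fun k => (c%:~R ^+ 2 + (2 * c%:~R) * k%:~R) + k%:~R ^+ 2).
  by apply: eq_law => k; rewrite intrD; ring.
by rewrite !lawD law_cst lawZ IH law_mean !big_cons; ring.
Qed.

(** The symmetric lazy walk of [m] steps: each pair of opposite weights moves
    it by [1] or by [-1] with probability [p * (1 - p)] each. *)
Definition pairs m : seq int := flatten (nseq m [:: 1; -1]).

Lemma law_pairsS m g : law (pairs m.+1) g = p * (1 - p) * law (pairs m) (fun k => g (k + 1))
  + (1 - 2 * (p * (1 - p))) * law (pairs m) g
  + p * (1 - p) * law (pairs m) (fun k => g (k - 1)).
Proof.
rewrite /pairs /=.
have -> : law (flatten (nseq m [:: 1; -1])) (fun k => g (1 + (-1 + k))) =
  law (flatten (nseq m [:: 1; -1])) g by apply: eq_law => k; rewrite addNKr.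
have -> : law (flatten (nseq m [:: 1; -1])) (fun k => g (1 + k)) =
  law (flatten (nseq m [:: 1; -1])) (fun k => g (k + 1)) by apply: eq_law => k; rewrite addrC.
have -> : law (flatten (nseq m [:: 1; -1])) (fun k => g (-1 + k)) =
  law (flatten (nseq m [:: 1; -1])) (fun k => g (k - 1)) by apply: eq_law => k; rewrite addrC.
ring.
Qed.

Lemma pairs_perm m : perm_eq (pairs m) (nseq m 1 ++ nseq m (-1)).
Proof.
elim: m => // m IH; rewrite /pairs /= -/(pairs m) perm_cons.
by rewrite perm_sym -[-1 :: nseq m _]cat1s perm_catCA /= perm_cons perm_sym.
Qed.

Lemma law_pairs_sym m g : law (pairs m) (fun k => g (- k)) = law (pairs m) g.
Proof.
rewrite -law_opp; apply: law_perm.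
apply: (perm_trans (perm_map _ (pairs_perm m))).
rewrite map_cat !map_nseq opprK perm_catC perm_sym; exact: pairs_perm.
Qed.

Lemma pmf_pairs_sym m k : pmf (pairs m) (- k) = pmf (pairs m) k.
Proof.
rewrite /pmf -law_pairs_sym; apply: eq_law => j; by rewrite eqr_oppLR opprK.
Qed.

Lemma pmf_pairsS m k : pmf (pairs m.+1) k = p * (1 - p) * pmf (pairs m) (k - 1)
  + (1 - 2 * (p * (1 - p))) * pmf (pairs m) k
  + p * (1 - p) * pmf (pairs m) (k + 1).
Proof.
rewrite /pmf law_pairsS; congr (_ * _ + _ + _ * _).
  by apply: eq_law => j; congr (nat_of_bool _)%:R; lia.
by apply: eq_law => j; congr (nat_of_bool _)%:R; lia.
Qed.

Lemma law_pairs_sqr m : law (pairs m) (fun k => k%:~R ^+ 2) = 2 * (p * (1 - p)) * m%:R.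
Proof.
rewrite (law_perm _ (pairs_perm m)) law_sqr !big_cat /= !big_nseq !iter_addr_0.
by rewrite mulrN1z sqrrN !expr1n mulNrn subrr mulr0 expr0n /= -mulr_natr; ring.
Qed.

Hypothesis p01 : 0 <= p <= 1.
Let a := p * (1 - p).

Lemma bernoulli_var_ge0 : 0 <= a.
Proof. by case/andP: p01 => p0 p1; rewrite mulr_ge0 ?subr_ge0. Qed.

Lemma bernoulli_var_le : a <= 1 / 4.
Proof. by have := sqr_ge0 (p - 1 / 2); rewrite /a; nra. Qed.

Lemma le_law s g g' : (forall k, g k <= g' k) -> law s g <= law s g'.
Proof.
move: p01 => /andP[p0 p1].
elim: s g g' => [|c s IH] g g' gg' //=.
by rewrite lerD // ler_wpM2l ?subr_ge0 // IH.
Qed.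

Lemma law_ge0 s g : (forall k, 0 <= g k) -> 0 <= law s g.
Proof. by move=> g0; rewrite -(law_cst s 0); apply: le_law. Qed.

Lemma law_le s g x : (forall k, g k <= x) -> law s g <= x.
Proof. by move=> gx; rewrite -(law_cst s x); apply: le_law. Qed.

(** A binomial takes nonnegative values only. *)
Lemma le_law_nat n g g' : (forall k : nat, g k%:Z <= g' k%:Z) ->
  law (nseq n 1) g <= law (nseq n 1) g'.
Proof.
move: p01 => /andP[p0 p1].
elim: n g g' => [|n IH] g g' gg' /=; first exact: gg' 0%N.
rewrite lerD // ler_wpM2l ?subr_ge0 // IH // => k.
by rewrite (_ : 1 + k%:Z = k.+1%:Z).
Qed.

Lemma pmf_ge0 s k : 0 <= pmf s k.
Proof. exact: law_ge0. Qed.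

(** Steps of the lazy walk are at least as likely to be [0] as to be [1],
    because [p * (1 - p) <= 1 / 4]; such a convolution preserves unimodality. *)
Lemma pmf_pairs_unimodal m (k : nat) : pmf (pairs m) k.+1%:Z <= pmf (pairs m) k%:Z.
Proof.
elim: m k => [|m IH] k; first by rewrite /pmf /= ler_nat; case: k.
rewrite !pmf_pairsS -/a.
have := bernoulli_var_ge0; have := bernoulli_var_le => a4 a0.
have -> : k.+1%:Z - 1 = k%:Z by lia.
have -> : k.+1%:Z + 1 = k.+2%:Z by lia.
have -> : k%:Z + 1 = k.+1%:Z by lia.
have h1 := IH k; have h2 := IH k.+1.
case: k h1 h2 => [|k] h1 h2.
  rewrite sub0r pmf_pairs_sym; nra.
have -> : k.+1%:Z - 1 = k%:Z by lia.
have h0 := IH k; nra.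
Qed.

Lemma pmf_pairs_le m (k l : nat) : (k <= l)%N -> pmf (pairs m) l%:Z <= pmf (pairs m) k%:Z.
Proof.
elim: l => [|l IH]; first by rewrite leqn0 => /eqP ->.
rewrite leq_eqVlt => /orP[/eqP-> //|kl].
exact: le_trans (pmf_pairs_unimodal m l) (IH kl).
Qed.

Lemma pmf_pairs_max m k : pmf (pairs m) k <= pmf (pairs m) 0.
Proof.
case: (intP k) => [//|n|n]; last rewrite pmf_pairs_sym; exact: (@pmf_pairs_le m 0).
Qed.

Lemma law_jensen s g : law s g ^+ 2 <= law s (fun k => g k ^+ 2).
Proof.
have : 0 <= law s (fun k => (g k - law s g) ^+ 2) by apply: law_ge0 => k; exact: sqr_ge0.
have -> : law s (fun k => (g k - law s g) ^+ 2) =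
   law s (fun k => g k ^+ 2 - (2 * law s g * g k - law s g ^+ 2)).
  by apply: eq_law => k; ring.
rewrite !(lawB, lawZ, law_cst); nra.
Qed.

(** The mean absolute value of the walk grows at step [m + 1] by exactly
    [2 * a * P(W_m = 0)], and these return probabilities decrease in [m]; so
    [2 * a * m * P(W_m = 0)] is at most the mean of [|W_m|], which is at most
    the standard deviation, the square root of [2 * a * m]. *)
Lemma pmf_pairs0_le m : pmf (pairs m) 0 ^+ 2 * (2 * a * m%:R) <= 1.
Proof.
have a0 := bernoulli_var_ge0.
have al0 l : 0 <= 2 * a * l%:R by rewrite mulr_ge0 // mulr_ge0.
have step l : law (pairs l.+1) (fun k => `|k|%:~R) =
    law (pairs l) (fun k => `|k|%:~R) + 2 * a * pmf (pairs l) 0.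
  rewrite law_pairsS /pmf -!lawZ -!lawD; apply: eq_law => k.
  have : (`|k + 1|%:~R + `|k - 1|%:~R : R) = 2 * `|k|%:~R + 2 * (k == 0)%:R.
    have -> : (k == 0)%:R = ((k == 0)%:R : int)%:~R :> R by case: eqP.
    rewrite -intrD -[2]/(2%:~R) -!intrM -intrD; congr (_%:~R).
    by case: eqVneq => [-> //|]; lia.
  rewrite -/a; set x := `|k + 1|%:~R; set y := `|k - 1|%:~R => h.
  have -> : x = 2 * `|k|%:~R + 2 * (k == 0)%:R - y by rewrite -h addrK.
  ring.
have decr l : pmf (pairs l.+1) 0 <= pmf (pairs l) 0.
  rewrite pmf_pairsS sub0r pmf_pairs_sym add0r -/a.
  by have := pmf_pairs_max l 1; nra.
have grow l : 2 * a * l%:R * pmf (pairs l) 0 <= law (pairs l) (fun k => `|k|%:~R).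
  elim: l => [|l IH]; first by rewrite mulr0 mul0r law_ge0 // => k; rewrite ler0z.
  rewrite step; have -> : l.+1%:R = l%:R + 1 :> R by rewrite -addn1 natrD.
  have := decr l; have := pmf_ge0 (pairs l.+1) 0; set x := pmf _ _; set y := pmf _ _ => x0 xy.
  have : 2 * a * l%:R * x <= 2 * a * l%:R * y by rewrite ler_wpM2l.
  have : 2 * a * x <= 2 * a * y by rewrite ler_wpM2l // mulr_ge0.
  move: IH; rewrite -/y; lra.
have := law_jensen (pairs m) (fun k => `|k|%:~R).
have -> : law (pairs m) (fun k => `|k|%:~R ^+ 2) = 2 * a * m%:R.
  rewrite -law_pairs_sqr; apply: eq_law => k.
  by rewrite intr_norm real_normK ?num_real.
move: (grow m); set x := pmf _ _; set v := 2 * a * m%:R; set e := law _ _ => ge ev.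
have v0 : 0 <= v by exact: al0.
have x0 : 0 <= x by exact: pmf_ge0.
have [->|vn0] := eqVneq v 0; first by rewrite mulr0.
have vp : 0 < v by rewrite lt_def vn0.
have vx0 : 0 <= v * x by rewrite mulr_ge0.
have : (v * x) ^+ 2 <= v.
  by apply: le_trans ev; rewrite lerXn2r ?nnegrE // (le_trans vx0).
by nra.
Qed.

End Law.

(** * Atoms of signed binomial sums *)

Section Concentration.
Context (R : realFieldType) (p : R).
Implicit Types (s t : seq int) (g : int -> R) (m n : nat) (k : int).
Local Notation law := (law p).
Local Notation pmf := (pmf p).

Lemma law_pmf s g (r : seq int) : all (fun c => `|c| <= 1) s -> uniq r ->
  (forall k, `|k| <= (size s)%:Z -> k \in r) ->
  law s g = \sum_(k <- r) pmf s k * g k.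
Proof.
move=> s1 ur rs; transitivity (law s (fun j => \sum_(k <- r) g k * (j == k)%:R)).
  apply: eq_law_in => // j /rs jr; rewrite (bigD1_seq j) //= eqxx mulr1 big1 ?addr0 //.
  by move=> k /negbTE kj; rewrite eq_sym kj mulr0.
by rewrite law_sum; apply: eq_bigr => k _; rewrite lawZ mulrC.
Qed.

Definition is_sign c := (c == 1 :> int) || (c == -1).

Lemma sign_norm s : all is_sign s -> all (fun c => `|c| <= 1) s.
Proof. by apply: sub_all => c; rewrite /is_sign; lia. Qed.

(** Whatever the signs, every entry is matched by its negative from the
    independent copy, so that the entries of both form pairs. *)
Lemma law_symmetrize s g : all is_sign s ->
  law s (fun i => law s (fun j => g (i - j))) = law (pairs (size s)) g.
Proof.
move=> ss; transitivity (law (s ++ map -%R s) g).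
  by rewrite law_cat; apply: eq_law => i; rewrite law_opp.
apply: law_perm; elim: s ss => // c s IH /= /andP[c1 ss].
rewrite /pairs /= -/(pairs (size s)).
apply: (@perm_trans _ [:: c, - c & s ++ map -%R s]).
  by rewrite perm_cons -[- c :: map _ _]cat1s perm_catCA.
case/orP: c1 => /eqP ->; rewrite ?opprK; first by rewrite !perm_cons IH.
apply: (@perm_trans _ [:: 1, -1 & s ++ map -%R s]); last by rewrite !perm_cons IH.
exact: (permEl (perm_catCA [:: -1] [:: 1] _)).
Qed.

Hypothesis p01 : 0 <= p <= 1.

(** By the Cauchy-Schwarz inequality an atom of the sum of two independent
    halves is at most the mean of their collision probabilities; a collision of
    a half with its independent copy is a return of the lazy walk to [0]. *)
Lemma pmf_cat_le s t k : all is_sign s -> all is_sign t -> size s = size t ->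
  pmf (s ++ t) k <= pmf (pairs (size s)) 0.
Proof.
move=> ss st sst.
pose n := (size s + `|k|)%N.
pose r := [seq i%:Z - n%:Z | i <- iota 0 n.*2.+1].
have ur : uniq r.
  by rewrite map_inj_uniq ?iota_uniq // => i j; lia.
have inr j : `|j| <= n%:Z -> j \in r.
  move=> jn; apply/mapP; exists (absz (j + n%:Z)%R); last by lia.
  by rewrite mem_iota; lia.
pose f j := pmf s j; pose h j := pmf t (k - j).
have Es g : law s g = \sum_(j <- r) f j * g j.
  by apply: law_pmf ur _ => [|j js]; [exact: sign_norm|apply: inr; lia].
have Et g : law t g = \sum_(j <- r) h j * g (k - j).
  rewrite (@law_pmf _ _ (map (fun j => k - j) r)) ?big_map //.
  - exact: sign_norm.
  - by rewrite map_inj_uniq // => i j; lia.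
  - move=> j js; apply/mapP; exists (k - j); last by lia.
    by apply: inr; lia.
have sq u : all is_sign u -> law u (pmf u) = pmf (pairs (size u)) 0.
  move=> uu; rewrite /pmf -law_symmetrize //; apply: eq_law => i; apply: eq_law => j.
  by rewrite subr_eq0 eq_sym.
have f2 : \sum_(j <- r) f j ^+ 2 = pmf (pairs (size s)) 0.
  by rewrite -sq // Es; apply: eq_bigr => j _; rewrite expr2.
have h2 : \sum_(j <- r) h j ^+ 2 = pmf (pairs (size s)) 0.
  by rewrite sst -sq // Et; apply: eq_bigr => j _; rewrite expr2.
have -> : pmf (s ++ t) k = \sum_(j <- r) f j * h j.
  rewrite /pmf law_cat Es; apply: eq_bigr => j _; congr (_ * _).
  by apply: eq_law => i; congr (nat_of_bool _)%:R; lia.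
have -> : pmf (pairs (size s)) 0 = \sum_(j <- r) (f j ^+ 2 + h j ^+ 2) / 2.
  by rewrite -mulr_suml big_split /= f2 h2; field.
apply: ler_sum => j _; have := sqr_ge0 (f j - h j); nra.
Qed.

(** Split off two halves of equal size and apply [pmf_cat_le] to them; up to a
    constant the bound is the inverse of the standard deviation. *)
Lemma pmf_sqr_le s k : all is_sign s ->
  pmf s k ^+ 2 * (2 * (p * (1 - p)) * (size s)./2%:R) <= 1.
Proof.
move=> ss; set m := (size s)./2.
have le : pmf s k <= pmf (pairs m) 0.
  have -> : s = (take m s ++ take m (drop m s)) ++ drop m (drop m s).
    by rewrite -catA !cat_take_drop.
  rewrite /pmf (law_perm _ _ (permEl (perm_catC _ _))) law_cat; apply: law_le => // i.
  have s1 : size (take m s) = m by rewrite size_take_min; lia.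
  have s2 : size (take m (drop m s)) = m by rewrite size_take_min size_drop; lia.
  have al A : {subset A <= s} -> all is_sign A.
    by move=> As; apply/allP => x /As; exact: (allP ss).
  have := @pmf_cat_le (take m s) (take m (drop m s)) (k - i).
  rewrite s1 s2 => h; apply: le_trans (h _ _ erefl).
  - rewrite le_eqVlt; apply/orP; left; apply/eqP/eq_law => j.
    by congr (nat_of_bool _)%:R; lia.
  - by apply: al => x; exact: mem_take.
  - by apply: al => x /mem_take /mem_drop.
apply: le_trans (pmf_pairs0_le p01 m); rewrite ler_wpM2r //.
  by rewrite mulr_ge0 // mulr_ge0 // (bernoulli_var_ge0 p01).
by rewrite lerXn2r ?nnegrE ?pmf_ge0.
Qed.

End Concentration.

(** * The difference of two binomials *)

Section BinomialDifference.
Context (R : realFieldType) (p : R).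
Implicit Types (s t : seq int) (g : int -> R) (m n r b : nat) (k : int).
Local Notation law := (law p).
Local Notation pmf := (pmf p).

Definition signs r b : seq int := nseq r 1 ++ nseq b (-1).
(** The chance that red leads by at least [k] if each of [r] red and [b] blue
    candidates is present with probability [p]. *)
Definition tail r b k : R := law (signs r b) (fun j => (k <= j)%R%:R).

Lemma all_signs r b : all is_sign (signs r b).
Proof. by rewrite all_cat !all_nseq /is_sign !eqxx !orbT. Qed.

Lemma size_signs r b : size (signs r b) = (r + b)%N.
Proof. by rewrite size_cat !size_nseq. Qed.

Lemma perm_signs s : all is_sign s ->
  perm_eq s (signs (count_mem 1 s) (count_mem (-1) s)).
Proof.
elim: s => // c s IH /= /andP[c1 /IH h].
case/orP: c1 => /eqP -> /=; first by rewrite /signs /= perm_cons.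
rewrite add0n /signs -[nseq (1 + _) _]/([:: -1] ++ _) perm_sym perm_catCA /=.
by rewrite perm_cons perm_sym.
Qed.

Lemma law_signsSl r b g : law (signs r.+1 b) g =
  p * law (signs r b) (fun k => g (1 + k)) + (1 - p) * law (signs r b) g.
Proof. by []. Qed.

Lemma law_signsSr r b g : law (signs r b.+1) g =
  p * law (signs r b) (fun k => g (-1 + k)) + (1 - p) * law (signs r b) g.
Proof.
rewrite (@law_perm _ p _ (-1 :: signs r b)) //.
by rewrite /signs -[nseq b.+1 _]/([:: -1] ++ _) perm_catCA.
Qed.

Lemma law_signs_swap r b g : law (signs b r) g = law (signs r b) (fun k => g (- k)).
Proof.
rewrite -law_opp; apply: law_perm.
by rewrite /signs map_cat !map_nseq opprK perm_catC.
Qed.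

(** Exchanging the colors changes the sign of the difference. *)
Lemma tail_dual r b k : tail b r (1 - k) = 1 - tail r b k.
Proof.
rewrite /tail law_signs_swap.
transitivity (law (signs r b) (fun j => 1 - (k <= j)%R%:R)); last by rewrite lawB law_cst.
apply: eq_law => j.
have -> : (1 - k <= - j) = ~~ (k <= j) by lia.
by case: (k <= j) => /=; ring.
Qed.

Lemma tailSl r b k : tail r.+1 b k = tail r b k + p * pmf (signs r b) (k - 1).
Proof.
rewrite /tail law_signsSl.
have -> : law (signs r b) (fun j => (k <= 1 + j)%R%:R) =
    law (signs r b) (fun j => (k <= j)%R%:R + (j == k - 1)%:R).
  by apply: eq_law => j; rewrite -natrD; congr _%:R; lia.
by rewrite lawD /pmf; ring.
Qed.

Lemma tailSr r b k : tail r b k = tail r b.+1 k + p * pmf (signs r b) k.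
Proof.
rewrite /tail law_signsSr.
have -> : law (signs r b) (fun j => (k <= -1 + j)%R%:R) =
    law (signs r b) (fun j => (k <= j)%R%:R - (j == k)%:R).
  apply: eq_law => j; apply/eqP; rewrite eq_sym subr_eq -natrD; apply/eqP.
  by congr _%:R; lia.
by rewrite lawB /pmf; ring.
Qed.

Lemma tail_succ r b k : tail r b k = tail r b (k + 1) + pmf (signs r b) k.
Proof.
rewrite /tail /pmf -lawD; apply: eq_law => j; rewrite -natrD; congr _%:R; lia.
Qed.

Hypothesis p01 : 0 <= p <= 1.

Lemma tail_ge0 r b k : 0 <= tail r b k.
Proof. exact: law_ge0. Qed.

Lemma tail_monol r r' b k : (r <= r')%N -> tail r b k <= tail r' b k.
Proof.
case/andP: p01 => p0 _; move=> /subnK <-; elim: (r' - r)%N => // d IH.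
by rewrite addSn tailSl (le_trans IH) // lerDl mulr_ge0 // pmf_ge0.
Qed.

Lemma tail_monor r b b' k : (b <= b')%N -> tail r b' k <= tail r b k.
Proof.
case/andP: p01 => p0 _; move=> /subnK <-; elim: (b' - b)%N => // d IH.
by rewrite addSn (le_trans _ IH) // [leRHS]tailSr lerDl mulr_ge0 // pmf_ge0.
Qed.

Lemma tail_mono r r' b b' k : (r <= r')%N -> (b' <= b)%N -> tail r b k <= tail r' b' k.
Proof. by move=> rr bb; apply: le_trans (tail_monol b k rr) (tail_monor _ _ bb). Qed.

Lemma tail_ge_half r b : (b <= r)%N -> 1 / 2 <= tail r b 0.
Proof.
move=> br; have := tail_dual r b 1; rewrite subrr => dual.
have := tail_succ r b 0; rewrite add0r => succ.
have := pmf_ge0 p01 (signs r b) 0.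
have := tail_mono 0 br br; lra.
Qed.

(** Exchanging [r] and [b] replaces the tail at [k] by the complement of the
    tail at [1 - k]. If no atom exceeds [Q], passing from one to the other in
    single steps changes the tail by at most [p Q] for each candidate and by at
    most [Q] for each unit of the threshold. *)
Lemma tail_near_half m r b k (Q : R) : (m <= r)%N -> (m <= b)%N ->
  (forall r' b' j, (m.*2 <= r' + b')%N -> pmf (signs r' b') j <= Q) ->
  `|2 * tail r b k - 1| <= (2 * p * `|r%:R - b%:R| + `|2 * k - 1|%:~R) * Q.
Proof.
case/andP: (p01) => p0 _.
move=> + + hQ; wlog br : r b k / (b <= r)%N => [hw mr mb|mr mb].
  case: (leqP b r) => [|/ltnW rb]; first by move=> br; apply: hw.
  have := hw b r (1 - k) rb mb mr; rewrite tail_dual (distrC b%:R).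
  have -> : `|2 * (1 - tail r b k) - 1| = `|2 * tail r b k - 1|.
    by rewrite -normrN; congr `|_|; ring.
  by have -> : `|2 * (1 - k) - 1| = `|2 * k - 1| :> int by lia.
have incl d j : tail b b j <= tail (b + d) b j <= tail b b j + p * d%:R * Q.
  elim: d => [|d /andP[h1 h2]]; first by rewrite addn0 mulr0 mul0r addr0 !lexx.
  have := hQ (b + d)%N b (j - 1); rewrite addnS tailSl -[d.+1]addn1 natrD => hh.
  have {hh}: p * pmf (signs (b + d) b) (j - 1) <= p * Q by rewrite ler_wpM2l // hh //; lia.
  have := mulr_ge0 p0 (pmf_ge0 p01 (signs (b + d) b) (j - 1)); lra.
have inck (d : nat) j : tail b b j - d%:R * Q <= tail b b (j + d%:Z) <= tail b b j.
  elim: d => [|d /andP[h1 h2]]; first by rewrite mul0r subr0 addr0 !lexx.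
  have := tail_succ b b (j + d%:Z); rewrite -addrA -[d.+1]addn1 natrD PoszD.
  have := hQ b b (j + d%:Z); rewrite -addnn leq_add // => /(_ isT).
  have := pmf_ge0 p01 (signs b b) (j + d%:Z); lra.
have mid : `|2 * tail b b k - 1| <= `|2 * k - 1|%:~R * Q.
  have := tail_dual b b k => dual.
  case: (leP k (1 - k)) => k1.
    have := inck (absz (1 - k - k)%R) k.
    have -> : k + absz (1 - k - k)%R = 1 - k by lia.
    have -> : (absz (1 - k - k)%R)%:R = `|2 * k - 1|%:~R :> R.
      by rewrite pmulrn; congr _%:~R; lia.
    by rewrite dual => /andP[h1 h2]; rewrite ler_norml; lra.
  have := inck (absz (k - (1 - k))%R) (1 - k).
  have -> : 1 - k + absz (k - (1 - k))%R = k by lia.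
  have -> : (absz (k - (1 - k))%R)%:R = `|2 * k - 1|%:~R :> R.
    by rewrite pmulrn; congr _%:~R; lia.
  by rewrite dual => /andP[h1 h2]; rewrite ler_norml; lra.
have := incl (r - b)%N k; rewrite subnKC // natrB // => /andP[h1 h2].
have rb : 0 <= (r%:R - b%:R : R) by rewrite subr_ge0 ler_nat.
rewrite (ger0_norm rb); move: mid; rewrite !ler_norml => /andP[h3 h4].
have : 0 <= Q by apply: le_trans (hQ b b 0 _); rewrite ?pmf_ge0 // -addnn leq_add.
move=> Q0; have : 0 <= p * (r%:R - b%:R) * Q by rewrite !mulr_ge0.
rewrite mulrDl -!mulrA; move: h2; rewrite -!mulrA => h2; lra.
Qed.

(** With [Z] an independent sum of [d] steps and [W] the lazy walk, the right
    side is the mean of [P (1 - Z <= W <= Z)]. By unimodality this probability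
    is a concave function of [Z], and at [Z = M] it is at least [3 / 4] by
    Chebyshev's inequality; hence it is at least [3 / 4 * Z / (M + Z)]. *)
Lemma tail_gap d b (M : nat) : (0 < M)%N ->
  4 * (2 * (p * (1 - p)) * b%:R) <= M%:R ^+ 2 ->
  3 / 4 * (p * d%:R) / (M%:R + p * d%:R + 1) <= tail (d + b) b 1 + tail (d + b) b 0 - 1.
Proof.
case/andP: (p01) => p0 p1 M0 hM.
have MR0 : 0 < M%:R :> R by rewrite ltr0n.
pose e i := pmf (pairs b) i%:Z + pmf (pairs b) i.+1%:Z.
pose G (z : nat) : R := \sum_(i < z) e i.
have e0 i : 0 <= e i by rewrite addr_ge0 ?pmf_ge0.
have e_le i j : (i <= j)%N -> e j <= e i.
  by move=> ij; rewrite lerD // pmf_pairs_le.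
have GE z : G z = law (pairs b) (fun w => (1 - z%:Z <= w <= z%:Z)%R%:R).
  rewrite /G; elim: z => [|z IH].
    rewrite big_ord0 -[LHS](law_cst p (pairs b)); apply: eq_law => j.
    by have -> : (1 - 0%:Z <= j <= 0%:Z) = false by lia.
  rewrite big_ord_recr /= IH /e -[pmf _ z%:Z]pmf_pairs_sym /pmf -!lawD.
  by apply: eq_law => j; rewrite -!natrD; congr _%:R; lia.
have Gtail z : law (pairs b) (fun w => (1 - z%:Z <= w)%R%:R + (- z%:Z <= w)%R%:R - 1) = G z.
  rewrite lawB lawD law_cst.
  have -> : law (pairs b) (fun w => (- z%:Z <= w)%R%:R) = law (pairs b) (fun w => (w <= z%:Z)%R%:R).
    by rewrite -law_pairs_sym; apply: eq_law => j; congr (nat_of_bool _)%:R; lia.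
  transitivity (law (pairs b) (fun w => (1 - z%:Z <= w)%R%:R + (w <= z%:Z)%R%:R - 1)).
    by rewrite lawB lawD law_cst.
  rewrite GE; apply: eq_law => j.
  by apply/eqP; rewrite subr_eq -natrD natr1; apply/eqP; congr _%:R; lia.
have GM : 3 / 4 <= G M.
  have : law (pairs b) (fun w => w%:~R ^+ 2 / M%:R ^+ 2) <= 1 / 4.
    rewrite (@eq_law _ _ _ _ (fun w => (M%:R ^+ 2)^-1 * w%:~R ^+ 2)); last by move=> w; rewrite mulrC.
    by rewrite lawZ law_pairs_sqr mulrC ler_pdivrMr ?exprn_gt0 //; lra.
  have : law (pairs b) (fun w => 1 - w%:~R ^+ 2 / M%:R ^+ 2) <= G M.
    rewrite GE; apply: le_law => // w.
    have [wM|wM] := boolP (1 - M%:Z <= w <= M%:Z).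
      by rewrite gerBl divr_ge0 ?sqr_ge0.
    rewrite subr_le0 ler_pdivlMr ?exprn_gt0 // mul1r pmulrn -!rmorphXn /= ler_int; nia.
  rewrite lawB law_cst; lra.
have Gz z : 3 / 4 * z%:R <= (M%:R + z%:R) * G z.
  have z0 : 0 <= z%:R :> R by [].
  have le i : i%:R * e i <= G i.
    rewrite /G mulr_natl -[X in _ *+ X]card_ord -sumr_const; apply: ler_sum => j _.
    by apply: e_le; exact: ltnW.
  case: (leqP z M) => [zM|/ltnW zM].
    have split i : (z <= i)%N -> G i <= G z + (i%:R - z%:R) * e z.
      move=> /subnK <-; elim: (i - z)%N => [|j IH]; first by rewrite subrr mul0r addr0.
      rewrite addSn /G big_ord_recr /= -/(G _) -/(G z) -natr1; move: IH; rewrite natrD.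
      have := @e_le z (j + z)%N; rewrite leq_addl => /(_ isT); lra.
    have := split M zM; have := le z; have G0 : 0 <= G z by apply: sumr_ge0.
    have : 0 <= M%:R - z%:R :> R by rewrite subr_ge0 ler_nat.
    nra.
  have : G M <= G z.
    rewrite -(subnK zM); elim: (z - M)%N => // j IH.
    by rewrite addSn (le_trans IH) // /G big_ord_recr /= lerDl.
  nra.
pose mu := p * d%:R.
have mu0 : 0 <= mu by rewrite mulr_ge0.
pose t := (M%:R + mu + 1)^-1.
have y0 : 0 < M%:R + mu + 1 by lra.
have -> : tail (d + b) b 1 + tail (d + b) b 0 - 1 = law (nseq d 1) (fun z =>
    law (pairs b) (fun w => (1 - z <= w)%R%:R + (- z <= w)%R%:R - 1)).
  have E g : law (signs (d + b) b) g = law (nseq d 1) (fun z => law (pairs b) (fun w => g (z + w))).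
    rewrite -law_cat; apply: law_perm; rewrite /signs nseqD -catA perm_cat2l.
    by rewrite perm_sym pairs_perm.
  transitivity (law (nseq d 1) (fun z => law (pairs b) (fun w => (1 <= z + w)%R%:R)
      + law (pairs b) (fun w => (0 <= z + w)%R%:R) - 1)).
    by rewrite /tail !E lawB lawD law_cst.
  apply: eq_law => z; rewrite lawB lawD law_cst.
  by congr (_ + _ - _); apply: eq_law => w; congr (nat_of_bool _)%:R; lia.
(* Z / (M + Z) is averaged through the tangent-line bound
   1 / y >= 2 t - t ^ 2 y at y = M + z, where t = 1 / (M + mu + 1) *)
have : law (nseq d 1) (fun z => 3 / 4 * (2 * t * z%:~R - t ^+ 2 * (M%:R * z%:~R + z%:~R ^+ 2)))
   <= law (nseq d 1) (fun z => law (pairs b) (fun w => (1 - z <= w)%R%:R + (- z <= w)%R%:R - 1)).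
  apply: le_law_nat => // z; rewrite Gtail -pmulrn.
  have z0 : 0 <= z%:R :> R by [].
  have y1 : 0 < M%:R + z%:R :> R by lra.
  rewrite -(ler_pM2l y1); apply: le_trans (Gz z).
  rewrite -subr_ge0.
  have -> : 3 / 4 * z%:R - (M%:R + z%:R) * (3 / 4 * (2 * t * z%:R - t ^+ 2 * (M%:R * z%:R + z%:R ^+ 2)))
    = 3 / 4 * z%:R * (1 - t * (M%:R + z%:R)) ^+ 2 by ring.
  by rewrite mulr_ge0 ?sqr_ge0 // mulr_ge0 // divr_ge0.
apply: le_trans.
rewrite lawZ lawB !lawZ lawD lawZ law_sqr law_mean !big_nseq !iter_addr_0 mulr1z expr1n -/mu.
rewrite -mulrA ler_wpM2l ?divr_ge0 //.
have tE : t * (M%:R + mu + 1) = 1 by rewrite /t mulVf // gt_eqF.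
have t0 : 0 <= t by rewrite invr_ge0 ltW.
have le : p * (1 - p) * (1 *+ d) <= mu.
  rewrite mulrAC -/mu -subr_ge0 (_ : _ - _ = mu * p); last by ring.
  exact: mulr_ge0.
rewrite -/t.
have -> : mu * t = 2 * t * mu - t ^+ 2 * (M%:R * mu + (mu ^+ 2 + mu)).
  have -> : 2 * t * mu - t ^+ 2 * (M%:R * mu + (mu ^+ 2 + mu)) =
    2 * t * mu - t * mu * (t * (M%:R + mu + 1)) by ring.
  by rewrite tE; ring.
by rewrite lerD2l lerN2 ler_wpM2l ?sqr_ge0 // lerD2l lerD2l.
Qed.

End BinomialDifference.

(** * A local lower bound for the lazy walk *)

Section Blocks.
Context (R : realFieldType) (p : R).
Hypothesis p01 : 0 <= p <= 1.
Implicit Types (m : nat) (k : int).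
Local Notation law := (law p).
Local Notation pmf := (pmf p).

Lemma law_pairs_window m (A L : nat) (x : R) : 0 <= x ->
  (forall i, (A <= i <= L)%N -> pmf (pairs m) i%:Z <= x) ->
  law (pairs m) (fun w => (A%:Z <= w <= L%:Z)%R%:R) <= L.+1%:R * x.
Proof.
move=> x0 hx; apply: (@le_trans _ _ (law (pairs m) (fun w =>
    \sum_(i < L.+1) ((A <= i)%N%:R * (w == i%:Z)%:R)))).
  apply: le_law => // w.
  have [/andP[Aw wL]|_] := boolP (A%:Z <= w <= L%:Z); last first.
    by apply: sumr_ge0 => i _; rewrite mulr_ge0.
  have wi : (absz w < L.+1)%N by lia.
  rewrite (bigD1 (Ordinal wi)) //=.
  have -> : (A <= absz w)%N by lia.
  have -> : w == (absz w)%:Z by lia.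
  by rewrite mulr1 lerDl; apply: sumr_ge0 => i _; rewrite mulr_ge0.
rewrite law_sum mulr_natl -[X in _ *+ X]card_ord -sumr_const.
apply: ler_sum => i _; rewrite lawZ -/(pmf _ _).
have [Ai|_] := boolP (A <= i)%N; last by rewrite mul0r.
by rewrite mul1r hx // Ai -ltnS /=.
Qed.

Lemma law_pairs_ge0 m : 1 / 2 <= law (pairs m) (fun w => (0 <= w)%R%:R).
Proof.
have : law (pairs m) (fun w => (0 <= w)%R%:R + (0 <= - w)%R%:R) >= 1.
  rewrite -[leLHS](law_cst p (pairs m)); apply: le_law => // w.
  by rewrite -natrD ler1n; lia.
rewrite lawD (@law_pairs_sym _ p m (fun w => (0 <= w)%R%:R)); lra.
Qed.

(** As no atom exceeds the one at [0], the walk lies strictly between [-j] and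
    [j] with probability at most one half; symmetry splits the rest evenly. *)
Lemma law_pairs_quarter m (j : nat) : 2 * j%:R * pmf (pairs m) 0 <= 1 / 2 ->
  1 / 4 <= law (pairs m) (fun w => (j%:Z <= w)%R%:R).
Proof.
case: j => [_|j hj]; first by apply: le_trans (law_pairs_ge0 m); lra.
have win : law (pairs m) (fun w => (0%:Z <= w <= j%:Z)%R%:R) <= j.+1%:R * pmf (pairs m) 0.
  by apply: law_pairs_window => [|i _]; [exact: pmf_ge0|exact: pmf_pairs_max].
have : law (pairs m) (fun w => ((j.+1%:Z <= w)%R%:R + (j.+1%:Z <= - w)%R%:R)
    + ((0%:Z <= w <= j%:Z)%R%:R + (0%:Z <= - w <= j%:Z)%R%:R)) >= 1.
  rewrite -[leLHS](law_cst p (pairs m)); apply: le_law => // w.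
  by rewrite -!natrD ler1n; lia.
rewrite !lawD (@law_pairs_sym _ p m (fun w => (j.+1%:Z <= w)%R%:R)).
rewrite (@law_pairs_sym _ p m (fun w => (0%:Z <= w <= j%:Z)%R%:R)).
lra.
Qed.

Lemma law_pairs_add m m' k k' :
  law (pairs m) (fun w => (k <= w)%R%:R) * law (pairs m') (fun w => (k' <= w)%R%:R) <=
  law (pairs (m + m')) (fun w => (k + k' <= w)%R%:R).
Proof.
rewrite /pairs nseqD flatten_cat -/(pairs m) -/(pairs m') law_cat mulrC -lawZ.
apply: le_law => // i; rewrite mulrC -lawZ; apply: le_law => // j.
by rewrite -natrM ler_nat; lia.
Qed.

Lemma law_pairs_blocks m (B j : nat) : 2 * j%:R * pmf (pairs m) 0 <= 1 / 2 ->
  (1 / 4) ^+ B <= law (pairs (B * m)) (fun w => ((B * j)%N%:Z <= w)%R%:R).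
Proof.
move=> hj; elim: B => [|B IH]; first by rewrite expr0 /= lexx.
rewrite !mulSn exprS PoszD; apply: le_trans (law_pairs_add _ _ _ _).
by rewrite ler_pM ?exprn_ge0 ?divr_ge0 // law_pairs_quarter.
Qed.

End Blocks.

Lemma leq_block_size (n m B : nat) : (0 < B)%N -> (4 * B <= n)%N -> (n <= 4 * m)%N ->
  (n <= 8 * B * (m %/ B))%N.
Proof.
move=> B0 Bn nm; have h1 := ltn_ceil m B0.
have : (B <= m %/ B * B)%N by rewrite leq_pmull // divn_gt0 //; lia.
move: h1; rewrite mulSn -mulnA (mulnC B); set x := (_ * B)%N; lia.
Qed.

Section LocalLowerBound.
Context (R : realType).

(** Within a fixed number [C] of standard deviations the lazy walk keeps atoms
    of the order of the inverse standard deviation. Cut the walk into [B]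
    blocks: each of them reaches a fixed fraction of its standard deviation
    with probability at least [1 / 4], so the walk exceeds [C] standard
    deviations with probability at least [4 ^ - B / 2]. At least half of this
    mass lies in a window of length of the order of the standard deviation, and
    by unimodality the atoms on the near side of the window are not smaller
    than the mean atom inside it. *)
Lemma pmf_pairs_ge (C : R) : 0 < C -> exists c d0 : R, [/\ 0 < c, 1 <= d0 &
  forall (n m k : nat) (p : R), 0 <= p <= 1 / 2 -> d0 <= p * n%:R ->
    (n <= 4 * m)%N -> (m <= n)%N -> k%:R <= C * Num.sqrt (p * n%:R) ->
    c <= Num.sqrt (p * n%:R) * pmf p (pairs m) k%:Z].
Proof.
move=> C0; pose b := (Num.truncn (16 * C)).+1; pose B := (2 * b ^ 2)%N.
have bC : 16 * C <= b%:R by apply/ltW/truncnS_gt.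
have b0 : 0 < b%:R :> R by rewrite ltr0n.
have b1 : 1 <= b%:R :> R by rewrite ler1n.
pose t : R := (1 / 4) ^+ B / 2; pose s := 4 / t.
have t0 : 0 < t by rewrite divr_gt0 // exprn_gt0 // divr_gt0.
have t1 : t <= 1.
  have : (1 / 4 : R) ^+ B <= 1 by apply: exprn_ile1; lra.
  by rewrite /t; lra.
have s0 : 0 < s by rewrite divr_gt0.
exists (t / (2 * (s + 2))), ((32 * b%:R) ^+ 2 + 4 * B%:R).
split=> [||n m k p p12 dn nm mn kC].
- by rewrite divr_gt0 // mulr_gt0 //; lra.
- have : 1 <= b%:R * b%:R :> R by nra.
  have : 0 <= B%:R :> R by []. nra.
have p01 : 0 <= p <= 1 by lra.
set d := p * n%:R in dn kC *; set q := Num.sqrt d in kC *.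
have d0 : 0 < d by apply: lt_le_trans dn; rewrite ltr_wpDr ?exprn_gt0 ?mulr_gt0 ?mulr_ge0.
have q2 : q ^+ 2 = d by rewrite sqr_sqrtr // ltW.
have q0 : 0 < q by rewrite sqrtr_gt0.
have [q0' s0' d0'] := And3 (ltW q0) (ltW s0) (ltW d0).
have B0 : 0 <= B%:R :> R by [].
have qb : 32 * b%:R <= q.
  rewrite -(ler_pXn2r (_ : 0 < 2)%N) ?nnegrE ?mulr_ge0 // q2.
  by lra.
have BE : B%:R = 2 * b%:R ^+ 2 :> R by rewrite /B natrM natrX.
have nB : (4 * B <= n)%N.
  rewrite -(ler_nat R) natrM; have : d <= n%:R.
    by rewrite /d ler_piMl //; lra.
  have := sqr_ge0 (32 * b%:R : R); lra.
have Bp : (0 < B)%N by rewrite /B muln_gt0 expn_gt0.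
pose m' := (m %/ B)%N; have mE := divn_eq m B.
have mB : (n <= 8 * B * m')%N by exact: leq_block_size.
have am : d <= 8 * B%:R * (2 * (p * (1 - p)) * m'%:R).
  have : n%:R <= 8 * B%:R * m'%:R :> R by rewrite -!natrM ler_nat.
  have m0 : 0 <= m'%:R :> R by [].
  case/andP: p12 => p0 p2 h.
  have h1 : d <= p * (8 * B%:R * m'%:R) by rewrite ler_wpM2l.
  have h2 : 0 <= p * (8 * B%:R * m'%:R) * (1 - 2 * p) by rewrite !mulr_ge0 //; lra.
  nra.
have h0 : pmf p (pairs m') 0 * q <= 4 * b%:R.
  have hx := pmf_ge0 p01 (pairs m') 0.
  rewrite -(ler_pXn2r (_ : 0 < 2)%N) ?nnegrE ?mulr_ge0 //.
  rewrite exprMn q2; apply: le_trans (_ : 8 * B%:R <= _); last by rewrite BE; lra.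
  have h1 := pmf_pairs0_le p01 m'.
  apply: le_trans (_ : pmf p (pairs m') 0 ^+ 2 * (8 * B%:R * (2 * (p * (1 - p)) * m'%:R)) <= _).
    by rewrite ler_wpM2l ?sqr_ge0.
  by rewrite mulrCA ger_pMr // mulr_gt0 // ltr0n.
pose j := Num.truncn (q / (16 * b%:R)).
have jq : j%:R * (16 * b%:R) <= q.
  by rewrite -ler_pdivlMr ?mulr_gt0 // truncn_le // divr_ge0 // mulr_ge0.
have qj : q < (j%:R + 1) * (16 * b%:R).
  by rewrite -ltr_pdivrMr ?mulr_gt0 // natr1 truncnS_gt.
have hj : 2 * j%:R * pmf p (pairs m') 0 <= 1 / 2.
  rewrite -(ler_pM2r (mulr_gt0 q0 b0)).
  have : j%:R * (pmf p (pairs m') 0 * q) * b%:R <= j%:R * (4 * b%:R) * b%:R.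
    by rewrite ler_wpM2r // ler_wpM2l.
  have : j%:R * (16 * b%:R) * b%:R <= q * b%:R by rewrite ler_wpM2r.
  lra.
have kBj : (k <= B * j)%N.
  rewrite -(ler_nat R) (le_trans kC) // natrM BE.
  have : q <= 32 * j%:R * b%:R by lra.
  have : 16 * C * q <= b%:R * q by rewrite ler_wpM2r.
  nra.
have big : 2 * t <= 2 * law p (pairs m) (fun w => ((B * j)%N%:Z <= w)%R%:R).
  have -> : m = (B * m' + m %% B)%N by rewrite mulnC -mE.
  rewrite ler_pM2l // -[(B * j)%N%:Z]addr0.
  apply: le_trans (law_pairs_add p01 _ _ _ _); rewrite /t; apply: ler_pM => //.
  - by rewrite exprn_ge0 // divr_ge0.
  - by rewrite invr_ge0.
  - exact: law_pairs_blocks.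
  - by apply: le_trans (law_pairs_ge0 p01 _); lra.
pose L := (Num.truncn (s * q)).+1.
have Ls : s * q <= L%:R by apply/ltW/truncnS_gt.
have Ls1 : L%:R <= s * q + 1.
  by rewrite -natr1 lerD2r truncn_le // mulr_ge0.
have L0 : 0 < L%:R :> R by rewrite ltr0n.
have far : law p (pairs m) (fun w => (L%:Z < w)%R%:R) <= t / 2.
  apply: (@le_trans _ _ (law p (pairs m) (fun w => (L%:R ^+ 2)^-1 * w%:~R ^+ 2))).
    apply: le_law => // w; have [Lw|_] := boolP (L%:Z < w); last first.
      by rewrite mulr_ge0 ?invr_ge0 ?sqr_ge0.
    have Lw' : L%:R <= w%:~R :> R by rewrite pmulrn ler_int ltW.
    rewrite mulrC ler_pdivlMr ?exprn_gt0 // mul1r lerXn2r ?nnegrE //.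
    exact: le_trans Lw'.
  rewrite lawZ law_pairs_sqr mulrC ler_pdivrMr ?exprn_gt0 //.
  have h1 : 2 * (p * (1 - p)) * m%:R <= 2 * d.
    case/andP: p12 => p0 p2.
    have h1 : p * m%:R <= d by rewrite ler_wpM2l // ler_nat.
    have h2 : 0 <= p * m%:R * p by rewrite !mulr_ge0.
    lra.
  apply: (le_trans h1); apply: le_trans (_ : t / 2 * (s * q) ^+ 2 <= _).
    have -> : t / 2 * (s * q) ^+ 2 = 8 / t * d.
      by rewrite exprMn q2 /s; field; rewrite gt_eqF.
    rewrite ler_wpM2r // ler_pdivlMr //; lra.
  rewrite ler_wpM2l //; first by rewrite divr_ge0 // ltW.
  have sq0 : 0 <= s * q by exact: mulr_ge0.
  by apply: lerXn2r => //; rewrite nnegrE ltW.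
have win : law p (pairs m) (fun w => ((B * j)%N%:Z <= w <= L%:Z)%R%:R) <=
    L.+1%:R * pmf p (pairs m) k%:Z.
  apply: law_pairs_window => // [|i /andP[ji _]]; first exact: pmf_ge0.
  by apply: pmf_pairs_le => //; exact: leq_trans ji.
have split : law p (pairs m) (fun w => ((B * j)%N%:Z <= w)%R%:R) <=
  law p (pairs m) (fun w => ((B * j)%N%:Z <= w <= L%:Z)%R%:R + (L%:Z < w)%R%:R).
  apply: le_law => // w; have [wL|wL] := leP w L%:Z.
    by rewrite andbT addr0.
  by rewrite andbF add0r lern1 leq_b1.
rewrite lawD in split; rewrite -natr1 in win.
rewrite ler_pdivrMr; last by lra.
have hx := pmf_ge0 p01 (pairs m) k%:Z; set x := pmf _ _ _ in win hx *.
have : (L%:R + 1) * x <= (s + 2) * q * x by rewrite ler_wpM2r //; nra.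
lra.
Qed.

(** The excess of one sign is an independent binomial [Z] of mean at most [C]
    standard deviations, and a tie means that the lazy walk takes the value
    [Z]. Its atoms are bounded below by [c (1 - Z / (2 C q))], which is
    negative where [pmf_pairs_ge] does not apply; this is linear in [Z]. *)
Lemma pmf_signs0_ge (C : R) : 0 < C -> exists c d0 : R, [/\ 0 < c, 1 <= d0 &
  forall (n r b : nat) (p : R), 0 <= p <= 1 / 2 -> d0 <= p * n%:R ->
    (n <= 4 * r)%N -> (n <= 4 * b)%N -> (r + b <= n)%N ->
    p * `|r%:R - b%:R| <= C * Num.sqrt (p * n%:R) ->
    c <= Num.sqrt (p * n%:R) * pmf p (signs r b) 0].
Proof.
move=> C0; have C20 : 0 < 2 * C by rewrite mulr_gt0.
have [c [d0 [c0 d1 H]]] := pmf_pairs_ge C20.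
exists (c / 2), d0; split=> // [|n r b p p12 dn]; first by rewrite divr_gt0.
wlog br : r b / (b <= r)%N => [hw|] nr nb rbn rbC.
  case: (leqP b r) => [br|/ltnW rb]; first exact: hw.
  have -> : pmf p (signs r b) 0 = pmf p (signs b r) 0.
    by rewrite /pmf law_signs_swap; apply: eq_law => j; rewrite oppr_eq0.
  by apply: hw => //; [rewrite addnC|rewrite distrC].
have p01 : 0 <= p <= 1 by lra.
set q := Num.sqrt _ in rbC *.
have q0 : 0 < q by rewrite sqrtr_gt0 (lt_le_trans _ dn) // (lt_le_trans _ d1).
have [q0' c0' C0'] := And3 (ltW q0) (ltW c0) (ltW C0).
have -> : pmf p (signs r b) 0 = law p (nseq (r - b) 1) (fun z => pmf p (pairs b) z).
  rewrite /pmf (@law_perm _ p _ (nseq (r - b) 1 ++ pairs b)); last first.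
    rewrite /signs -{1}(subnK br) nseqD -catA perm_cat2l perm_sym.
    exact: pairs_perm.
  rewrite law_cat; apply: eq_law => z; rewrite -(law_pairs_sym p b); apply: eq_law => w.
  by rewrite subr_eq0 eq_sym.
have : law p (nseq (r - b) 1) (fun z => c - c / (2 * C * q) * z%:~R) <=
   law p (nseq (r - b) 1) (fun z => q * pmf p (pairs b) z).
  apply: le_law_nat => // z; rewrite -pmulrn.
  have [zq|zq] := leP z%:R (2 * C * q).
    apply: le_trans (_ : c <= _).
      by rewrite gerBl mulr_ge0 // divr_ge0 // !mulr_ge0.
    by apply: H => //; exact: leq_trans (leq_addl r b) rbn.
  apply: le_trans (_ : 0 <= _); last by rewrite mulr_ge0 ?pmf_ge0.
  by rewrite subr_le0 mulrAC ler_pdivlMr ?mulr_gt0 // ler_wpM2l // ltW.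
rewrite lawZ lawB law_cst lawZ law_mean big_nseq iter_addr_0 mulr1z.
apply: le_trans.
have -> : c / 2 = c - c / (2 * C * q) * (C * q) by field; rewrite !gt_eqF.
rewrite lerD2l lerN2 ler_wpM2l //; first by rewrite divr_ge0 // !mulr_ge0.
by move: rbC; rewrite -natrB // ger0_norm.
Qed.

End LocalLowerBound.

(** * Edges at a vertex of the random graph *)

(** Distinct edges are independent, so a weighted count of edges is a sum of
    weighted Bernoulli variables. *)
Lemma Ex_law (R : realFieldType) (I : finType) (P : I -> R) (p : R) (K : eqType)
    (s : seq K) (h : K -> I) (c : K -> int) (g : int -> R) :
  uniq (map h s) -> (forall k, k \in s -> P (h k) = p) ->
  Ex P (fun E => g (\sum_(k <- s) c k *+ (h k \in E))) = law p (map c s) g.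
Proof.
elim: s g => [|k s IH] g /=.
  by move=> _ _; rewrite -(Ex_cst P (g 0)); apply: eq_Ex => E; rewrite big_nil.
move=> /andP[ks us] hp; rewrite (Ex_coord P (h k)) hp ?mem_head //.
have hne l : l \in s -> h l != h k.
  by move=> ls; apply: contra ks => /eqP <-; exact: map_f.
have hps l : l \in s -> P (h l) = p by move=> ls; apply: hp; rewrite inE ls orbT.
rewrite -!IH //; congr (_ * _ + _ * _); apply: eq_Ex => E; rewrite big_cons !inE eqxx /=.
  rewrite mulr1n; congr (g (_ + _)); apply: eq_big_seq => l ls.
  by rewrite !inE (negbTE (hne l ls)).
rewrite mulr0n add0r; congr g; apply: eq_big_seq => l ls.
by rewrite !inE hne.
Qed.

(** One vote more or less decides a threshold event only on a single atom. *)
Lemma shift_atom (R : realFieldType) (p : R) (s : seq int) (k c : int) :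
  is_sign c -> exists l, (law p s (fun j => (k <= c + j)%R%:R) -
    law p s (fun j => (k <= 0 + j)%R%:R)) ^+ 2 = pmf p s l ^+ 2.
Proof.
rewrite -lawB => /orP[] /eqP ->.
  exists (k - 1); congr (_ ^+ 2); apply: eq_law => j.
  by apply/eqP; rewrite subr_eq -natrD; apply/eqP; congr _%:R; lia.
exists k; rewrite -[LHS]sqrrN /pmf -lawN; congr (_ ^+ 2); apply: eq_law => j.
by apply/eqP; rewrite opprB subr_eq -natrD; apply/eqP; congr _%:R; lia.
Qed.

Section Star.
Context (V : finType).
Implicit Types (A U W : {set V}) (u w t : V) (E F : {set {set V}}).

Definition sg A t : int := if t \in A then 1 else -1.

(** Red minus blue among the neighbors of [u] in [U], for the coloring whose
    red set is [A]. *)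
Definition star A U u E : int := \sum_(t in U) sg A t *+ ([set u; t] \in E).

Definition cut u U : {set {set V}} := [set [set u; t] | t in U].

Lemma is_sign_sg A t : is_sign (sg A t).
Proof. by rewrite /sg /is_sign; case: ifP; rewrite ?eqxx ?orbT. Qed.

Lemma star_split A U u w E : w \in U ->
  star A U u E = sg A w *+ ([set u; w] \in E) + star A (U :\ w) u E.
Proof.
move=> wU; rewrite /star (bigD1 w) //=; congr (_ + _).
by apply: eq_bigl => t; rewrite !inE andbC.
Qed.

Lemma star_depends A U u : depends_on (cut u U) (star A U u).
Proof.
move=> E F EF; apply: eq_bigr => t tU; congr (_ *+ nat_of_bool _).
move/setP/(_ [set u; t]): EF; rewrite !inE.
have -> : [set u; t] \in cut u U by exact: imset_f.
by rewrite !andbT.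
Qed.

Lemma set2_injr u t t' : u != t -> u != t' -> [set u; t] = [set u; t'] -> t = t'.
Proof.
move=> ut _ /setP/(_ t); rewrite !inE eqxx orbT eq_sym (negbTE ut) /=.
by move=> /esym/eqP.
Qed.

Lemma cut_disjoint u w U W : u != w -> u \notin W -> [disjoint cut u U & cut w W].
Proof.
move=> uw uW; apply/pred0P => e /=; apply/negP => /andP[/imsetP[t tU ->] /imsetP[t' t'W]].
move=> /setP/(_ u); rewrite !inE eqxx /= (negbTE uw) /= => /esym/eqP ut.
by rewrite ut t'W in uW.
Qed.

Lemma edge_notin_cut u w U : u != w -> w \notin U -> [set u; w] \notin cut u U.
Proof.
move=> uw wU; apply/imsetP => -[t tU ut].
have /eqP : w = t.
  by move/setP/(_ w): ut; rewrite !inE eqxx orbT eq_sym (negbTE uw) /= => /esym/eqP.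
by case: eqP wU => // ->; rewrite tU.
Qed.

Lemma count_sg A U : (count_mem 1%R (map (sg A) (enum U)) = #|U :&: A|) *
  (count_mem (-1)%R (map (sg A) (enum U)) = #|U :\: A|).
Proof.
split; rewrite count_map -size_filter cardE; apply: perm_size; apply: uniq_perm.
- exact/filter_uniq/enum_uniq.
- exact: enum_uniq.
- move=> t; rewrite mem_filter !mem_enum !inE /sg /=.
  by case: (t \in A); rewrite ?andbT ?andbF.
- exact/filter_uniq/enum_uniq.
- exact: enum_uniq.
- move=> t; rewrite mem_filter !mem_enum !inE /sg /=.
  by case: (t \in A); rewrite ?andbT ?andbF.
Qed.

Context (R : realType) (p : R).
Hypothesis p01 : 0 <= p <= 1.

(** Sets that are not pairs are drawn with probability [0], so that the edges
    of the random graph form a random subset of the whole power set. *)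
Definition edge_pr (e : {set V}) : R := if e \in vpairs V then p else 0.

Lemma edge_pr01 e : 0 <= edge_pr e <= 1.
Proof. by rewrite /edge_pr; case: ifP => _ //; rewrite lexx ler01. Qed.

Lemma edge_prE u w : u != w -> edge_pr [set u; w] = p.
Proof. by move=> uw; rewrite /edge_pr inE cards2 uw. Qed.

Local Notation Ex := (Ex edge_pr).

Lemma Ex_star A U u (g : int -> R) : u \notin U ->
  Ex (fun E => g (star A U u E)) = law p (signs #|U :&: A| #|U :\: A|) g.
Proof.
move=> uU; have ne t : t \in enum U -> u != t.
  by rewrite mem_enum => tU; apply: contra uU => /eqP ->.
rewrite (@eq_Ex _ _ _ _ (fun E => g (\sum_(t <- enum U) sg A t *+ ([set u; t] \in E)))).
  rewrite (@Ex_law _ _ _ p).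
  - by rewrite (law_perm _ _ (perm_signs _)) ?count_sg // all_map; apply/allP => t _; exact: is_sign_sg.
  - rewrite map_inj_in_uniq ?enum_uniq // => t t' /ne ut /ne ut'; exact: set2_injr.
  - by move=> t /ne ut; exact: edge_prE.
by move=> E; rewrite /star big_enum.
Qed.

Definition exceeds A U (i : int) u E : R := (i <= star A (U :\ u) u E)%R%:R.

(** Two vertices share only the edge [uw]; given that edge the events are
    independent, and it can matter for [u] only if [star] sits at one
    particular value. *)
Lemma covariance_threshold A U u w (i j : int) (m : nat) :
  u \in U -> w \in U -> u != w -> (m.*2 <= #|U| - 2)%N -> (0 < m)%N ->
  Ex (fun E => exceeds A U i u E * exceeds A U j w E) -
    Ex (exceeds A U i u) * Ex (exceeds A U j w) <= (2 * m%:R)^-1.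
Proof.
move=> uU wU uw mU m0.
pose f := exceeds A U i u; pose g := exceeds A U j w; rewrite -/f -/g.
have wu : w != u by rewrite eq_sym.
pose N := U :\ u :\ w.
have NE : U :\ w :\ u = N by apply/setP => t; rewrite !inE andbCA.
have [uN wN] : u \notin N /\ w \notin N by rewrite !inE !eqxx andbF.
have NU : (m <= #|N|./2)%N.
  have := cardsD1 w (U :\ u); have := cardsD1 u U.
  by rewrite !inE wu wU uU /= -/N => h1 h2; move: mU; rewrite h1 h2; clear; lia.
pose e := [set u; w].
pose F v k c E : R := (k <= c + star A N v E)%R%:R.
have depF v k c : depends_on (cut v N) (F v k c).
  by move=> E E' EE; rewrite /F (star_depends A EE).
have fE E : f E = F u i (sg A w *+ (e \in E)) E.
  by rewrite /f /exceeds /F (@star_split A (U :\ u) u w) // !inE wu.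
have gE E : g E = F w j (sg A u *+ (e \in E)) E.
  by rewrite /g /exceeds /F (@star_split A (U :\ w) w u) ?inE ?uw // NE setUC.
have addF v k c E : e \notin cut v N -> F v k c (e |: E) = F v k c E.
  move=> eN; apply: depF; apply/setP => x; rewrite !inE.
  by have [->|] := eqVneq x e; rewrite ?(negbTE eN) ?andbF.
have remF v k c E : e \notin cut v N -> F v k c (E :\ e) = F v k c E.
  move=> eN; apply: depF; apply/setP => x; rewrite !inE.
  by have [->|] := eqVneq x e; rewrite ?(negbTE eN) ?andbF.
have eu : e \notin cut u N by exact: edge_notin_cut.
have ew : e \notin cut w N by rewrite /e setUC; exact: edge_notin_cut.
pose al := Ex (F u i (sg A w)); pose al0 := Ex (F u i 0).
pose be := Ex (F w j (sg A u)); pose be0 := Ex (F w j 0).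
have Ef : Ex f = p * al + (1 - p) * al0.
  rewrite (Ex_coord _ e) edge_prE //; congr (_ * _ + _ * _); apply: eq_Ex => E;
  by rewrite fE !inE eqxx /= ?addF ?remF.
have Eg : Ex g = p * be + (1 - p) * be0.
  rewrite (Ex_coord _ e) edge_prE //; congr (_ * _ + _ * _); apply: eq_Ex => E;
  by rewrite gE !inE eqxx /= ?addF ?remF.
have Efg : Ex (fun E => f E * g E) = p * (al * be) + (1 - p) * (al0 * be0).
  rewrite (Ex_coord _ e) edge_prE // /al /al0 /be /be0.
  rewrite -!(Ex_indep _ (J := cut u N) (K := cut w N)) //; try exact: cut_disjoint.
  by congr (_ * _ + _ * _); apply: eq_Ex => E;
     rewrite fE gE !inE eqxx /= ?addF ?remF.
have infl v k t : v \notin N -> (Ex (F v k (sg A t)) - Ex (F v k 0)) ^+ 2 *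
    (2 * (p * (1 - p)) * m%:R) <= 1.
  move=> vN; rewrite !(Ex_star A (fun s => (k <= _ + s)%R%:R)) //.
  have [l ->] := shift_atom p (signs #|N :&: A| #|N :\: A|) k (is_sign_sg A t).
  have := @pmf_sqr_le _ p p01 (signs #|N :&: A| #|N :\: A|) l (all_signs _ _).
  have a2 : 0 <= 2 * (p * (1 - p)) by rewrite mulr_ge0 // (bernoulli_var_ge0 p01).
  apply: le_trans; rewrite ler_wpM2l ?sqr_ge0 // ler_wpM2l //.
  by rewrite ler_nat size_signs cardsID.
have hu := infl u i w uN; have hw := infl w j u wN.
rewrite -/al -/al0 -/be -/be0 in hu hw.
rewrite Efg Ef Eg.
have -> : p * (al * be) + (1 - p) * (al0 * be0) - (p * al + (1 - p) * al0) * (p * be + (1 - p) * be0)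
  = p * (1 - p) * (al - al0) * (be - be0) by ring.
have mR : 0 < m%:R :> R by rewrite ltr0n.
rewrite -[leRHS]mul1r ler_pdivlMr ?mulr_gt0 //.
have := bernoulli_var_ge0 p01; set a := p * (1 - p) in hu hw * => a0.
have : 0 <= a * m%:R * (al - al0 - (be - be0)) ^+ 2 by rewrite mulr_ge0 ?sqr_ge0 // mulr_ge0.
move: hu hw; set x := al - al0; set y := be - be0; lra.
Qed.

Lemma variance_threshold A U (i : V -> int) : (8 <= #|U|)%N ->
  variance edge_pr (fun E => \sum_(u in U) exceeds A U (i u) u E) <=
  3 * #|U|%:R.
Proof.
move=> U8; pose m := ((#|U| - 2)./2)%N.
have m0 : (0 < m)%N by rewrite /m; lia.
have mU : (#|U| <= 4 * m)%N by rewrite /m; lia.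
have mR : 0 < m%:R :> R by rewrite ltr0n.
apply: le_trans (@variance_sum _ _ _ edge_pr01 _ U
  (fun u E => exceeds A U (i u) u E) (2 * m%:R)^-1 _ _ _) _.
- by rewrite invr_ge0 mulr_ge0.
- by move=> u E _; rewrite /exceeds ler0n lern1 leq_b1.
- move=> u w uU wU uw.
  by apply: (@covariance_threshold A U u w (i u) (i w) m uU wU uw _ m0); rewrite /m; lia.
- have : #|U|%:R <= 4 * m%:R :> R by rewrite -natrM ler_nat.
  have u0 : 0 <= #|U|%:R :> R by [].
  move=> h; have -> : 3 * #|U|%:R = #|U|%:R + 2 * #|U|%:R :> R by ring.
  by rewrite lerD2l ler_pdivrMr ?mulr_gt0 //; nra.
Qed.

End Star.

(** * The dynamics and the bias of one vertex *)

Section Dynamics.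
Context (V : finType).
Implicit Types (A U : {set V}) (u w t : V) (E F : {set {set V}}) (G : sgraph V).

(** The surplus among its neighbors that makes [u] red on the next day: a red
    vertex keeps its color on a tie, a blue one does not turn red. *)
Definition hold A u : int := if u \in A then 0 else 1.

(** One day of the majority dynamics. It is defined for any family [E] of sets,
    because the random edge set ranges over all of them; on graphs it is
    [majority_step]. *)
Definition day E A : {set V} := [set u | hold A u <= star A ([set: V] :\ u) u E].

Lemma starE G A u :
  star A ([set: V] :\ u) u (val G) = #|nbrs G u :&: A|%:Z - #|nbrs G u :&: ~: A|%:Z.
Proof.
have nu t : (t \in nbrs G u) = ([set u; t] \in val G) by rewrite inE.
have -> : star A ([set: V] :\ u) u (val G) = \sum_(t in nbrs G u) sg A t.
  rewrite /star [RHS]big_mkcond /= [LHS]big_mkcond /=; apply: eq_bigr => t _.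
  rewrite !inE andbT /adj; have [->|tu] := eqVneq t u; last by case: ifP.
  by case: ifP => // h; have := adj_irrefl G u; rewrite /adj h.
rewrite (big_setID A) /= setDE; congr (_ + _).
  rewrite (eq_bigr (fun=> 1)) ?sumr_const ?natz // => t.
  by rewrite !inE /sg => /andP[_ ->].
rewrite (eq_bigr (fun=> -1)) ?sumr_const ?mulNrn ?natz // => t.
by rewrite !inE /sg => /andP[_ /negbTE ->].
Qed.

Lemma majority_stepE G A : majority_step G A = day (val G) A.
Proof.
apply/setP => u; rewrite !inE starE /hold /=.
by case: (u \in A); rewrite ?andbT ?andbF ?orbF; lia.
Qed.

Lemma star_compl A U u E : star (~: A) U u E = - star A U u E.
Proof.
rewrite /star -sumrN; apply: eq_bigr => t _; rewrite -mulNrn; congr (_ *+ _).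
by rewrite /sg inE; case: (t \in A).
Qed.

Lemma day_compl E A : day E (~: A) = ~: day E A.
Proof.
apply/setP => u; rewrite !inE star_compl /hold inE.
by case: (u \in A) => /=; lia.
Qed.

Lemma notin_day E A u : u \notin day E A -> star A ([set: V] :\ u) u E <= 0.
Proof. by rewrite inE /hold; case: (u \in A); lia. Qed.

End Dynamics.

Section DayOne.
Context (R : realType) (p : R).
Hypothesis p01 : 0 <= p <= 1.

(** The bias of a red and of a blue vertex, which see one red, respectively
    one blue, neighbor candidate fewer, combine into a single expression in
    the [r + b] remaining vertices. *)
Lemma tail_diff (r b : nat) :
  tail p r b.+1 0 - tail p b r.+1 0 = tail p r b 1 + tail p r b 0 - 1.
Proof.
have E x y : tail p x y.+1 0 = p * tail p x y 1 + (1 - p) * tail p x y 0.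
  rewrite {1}/tail law_signsSr; congr (_ * _ + _); apply: eq_law => j.
  by congr (nat_of_bool _)%:R; lia.
have := tail_dual p r b 0; have := tail_dual p r b 1; rewrite subrr subr0.
by move=> h1 h0; rewrite !E h1 h0; ring.
Qed.

(** This is [tail_gap] with [M] of the order of the standard deviation [q] of
    the walk: the [r - b] extra red candidates have mean [p (r - b)], at most
    of order [q]. *)
Lemma gap_lower (kappa K : R) (n r b : nat) : 0 < kappa -> 0 < K ->
  1 <= p * n%:R -> (r + b).+2 = n ->
  kappa * Num.sqrt n%:R <= r%:R - b%:R <= K * Num.sqrt n%:R ->
  3 * kappa / (4 * (4 + K)) * (Num.sqrt (p * n%:R) / Num.sqrt n%:R) <=
  tail p r b 1 + tail p r b 0 - 1.
Proof.
case/andP: (p01) => p0 p1 k0 K0 d1 rbn /andP[kD DK].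
set q := Num.sqrt (p * n%:R); set s := Num.sqrt n%:R in kD DK *.
have n0 : 0 < n%:R :> R by rewrite ltr0n -rbn.
have s2 : s ^+ 2 = n%:R by rewrite sqr_sqrtr.
have q2 : q ^+ 2 = p * n%:R by rewrite sqr_sqrtr // mulr_ge0.
have s0 : 0 < s by rewrite sqrtr_gt0.
have q1 : 1 <= q by rewrite -(sqrtr1 R) ler_wsqrtr.
have q0 : 0 < q by lra.
have br : (b <= r)%N.
  by rewrite -(ler_nat R) -subr_ge0 (le_trans _ kD) // mulr_ge0 // ltW.
set D := r%:R - b%:R in kD DK.
have DE : D = (r - b)%N%:R by rewrite natrB.
pose M := (Num.truncn (2 * q)).+1.
have M1 : 2 * q <= M%:R by apply/ltW/truncnS_gt.
have M2 : M%:R <= 2 * q + 1 by rewrite -[leLHS]natr1 lerD2r truncn_le // mulr_ge0 // ltW.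
have hM : 4 * (2 * (p * (1 - p)) * b%:R) <= M%:R ^+ 2.
  apply: (@le_trans _ _ ((2 * q) ^+ 2)); last first.
    by rewrite lerXn2r ?nnegrE //; lra.
  have bn : 2 * b%:R <= n%:R :> R by rewrite -natrM ler_nat; move: br rbn; clear; lia.
  have h1 : p * (2 * b%:R) <= p * n%:R by rewrite ler_wpM2l.
  have h2 : 0 <= p * p * b%:R by rewrite !mulr_ge0.
  rewrite exprMn q2; lra.
have := @tail_gap _ p p01 (r - b)%N b M isT hM; rewrite subnK // -DE.
apply: le_trans.
have pD : p * D <= K * q.
  have D0 : 0 <= D by rewrite DE.
  rewrite -(ler_pXn2r (_ : 0 < 2)%N) ?nnegrE ?mulr_ge0 //; try lra.
  rewrite !exprMn q2.
  have h1 : D ^+ 2 <= K ^+ 2 * n%:R.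
    by rewrite -s2 -exprMn lerXn2r ?nnegrE ?mulr_ge0 //; lra.
  have h2 : p ^+ 2 * D ^+ 2 <= p * (K ^+ 2 * n%:R).
    apply: ler_pM; rewrite ?sqr_ge0 //; nra.
  lra.
have pk : kappa * q ^+ 2 / s <= p * D.
  rewrite ler_pdivrMr // q2 -s2.
  have : p * (kappa * s) * s <= p * D * s by rewrite !ler_wpM2r ?ler_wpM2l //; lra.
  lra.
apply: (@le_trans _ _ (3 / 4 * (kappa * q ^+ 2 / s) / ((4 + K) * q))).
  rewrite le_eqVlt; apply/orP; left; apply/eqP; field.
  by rewrite !gt_eqF //; lra.
have h0 : 0 <= kappa * q ^+ 2 / s by rewrite divr_ge0 ?mulr_ge0 ?sqr_ge0 //; lra.
apply: ler_pM.
- by rewrite mulr_ge0 // divr_ge0.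
- by rewrite invr_ge0 mulr_ge0; lra.
- by rewrite ler_wpM2l // divr_ge0.
rewrite lef_pV2 ?posrE; lra.
Qed.

End DayOne.

(** * Surplus after the first day *)

Section DayOneMean.
Context (V : finType) (R : realType) (p : R).
Hypothesis p01 : 0 <= p <= 1.
Implicit Types (A U : {set V}) (u : V) (E : {set {set V}}).
Local Notation Ex := (Ex (@edge_pr V R p)).

Lemma card_setD1I U A u : #|(U :\ u) :&: A| = (#|U :&: A| - (u \in U :&: A))%N.
Proof. by rewrite setIDAC (cardsD1 u (U :&: A)) addKn. Qed.

Lemma Ex_exceeds A U (i : int) u : Ex (exceeds R A U i u) =
  tail p (#|U :&: A| - (u \in U :&: A)) (#|U :\: A| - (u \in U :\: A)) i.
Proof.
rewrite (Ex_star p A (fun s => (i <= s)%R%:R)) ?setD11 //.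
by rewrite card_setD1I setDE card_setD1I -setDE.
Qed.

Lemma card_day E A :
  #|day E A|%:R = \sum_(u in [set: V]) exceeds R A [set: V] (hold A u) u E.
Proof.
rewrite -sum1_card natr_sum big_mkcond [RHS]big_mkcond /=; apply: eq_bigr => u _.
by rewrite !inE /exceeds; case: (_ <= _).
Qed.

(** By [tail_dual] and [tail_diff] each blue vertex, together with one red
    vertex, contributes one plus the bias; the [r - b] unpaired red vertices
    stay red with probability at least one half. *)
Lemma Ex_card_day A (r b : nat) : #|A| = r.+1 -> #|~: A| = b.+1 -> (b <= r)%N ->
  #|V|%:R / 2 + b.+1%:R * (tail p r b 1 + tail p r b 0 - 1) <=
  Ex (fun E => #|day E A|%:R).
Proof.
move=> Ar Ab br; rewrite (eq_Ex _ (card_day ^~ A)) Ex_sum.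
have -> : \sum_(u in [set: V]) Ex (exceeds R A [set: V] (hold A u) u) =
    r.+1%:R * tail p r b.+1 0 + b.+1%:R * tail p r.+1 b 1.
  rewrite (bigID (mem A)) /=; congr (_ + _).
    rewrite (eq_bigr (fun=> tail p r b.+1 0)) => [|u /andP[_ uA]].
      by rewrite sumr_const -[LHS]mulr_natl -Ar; congr (_%:R * _); apply: eq_card => u; rewrite unfold_in !inE.
    by rewrite Ex_exceeds /hold setTI setTD !inE uA Ar Ab subSS !subn0.
  rewrite (eq_bigr (fun=> tail p r.+1 b 1)) => [|u /andP[_ uA]].
    by rewrite sumr_const -[LHS]mulr_natl -Ab; congr (_%:R * _); apply: eq_card => u; rewrite unfold_in !inE.
  by rewrite Ex_exceeds /hold setTI setTD !inE (negbTE uA) Ar Ab subSS !subn0.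
have := tail_dual p b r.+1 0; rewrite subr0 => ->; rewrite -(tail_diff p01).
have -> : #|V|%:R = r.+1%:R + b.+1%:R :> R by rewrite -(cardsC A) Ar Ab natrD.
have br' : (b.+1%:R <= r.+1%:R :> R) by rewrite ler_nat.
have half : r.+1%:R * (1 / 2) - b.+1%:R * (1 / 2) <=
    (r.+1%:R - b.+1%:R) * tail p r b.+1 0.
  case: (ltnP b r) => [br2|rb].
    rewrite -mulrBl ler_wpM2l ?subr_ge0 //; exact: tail_ge_half.
  have -> : r = b by apply/eqP; rewrite eqn_leq rb br.
  by rewrite !subrr mul0r.
lra.
Qed.

End DayOneMean.

Section DayOneSurplus.
Context (R : realType).

(** The mean number of red vertices on the first day exceeds half of [n] by
    the order of [n * sqrt p], while their variance is at most [3 n]. *)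
Lemma day_one (kappa K eps : R) : 0 < kappa -> 0 < K -> 0 < eps ->
  exists c d0 : R, [/\ 0 < c, 1 <= d0 &
  forall (V : finType) (p : R) (A : {set V}), 0 <= p <= 1 -> d0 <= p * #|V|%:R ->
    kappa * Num.sqrt #|V|%:R <= #|A|%:R - #|~: A|%:R <= K * Num.sqrt #|V|%:R ->
    Pr (edge_pr p) (fun E => #|day E A|%:R <=
      #|V|%:R / 2 + c * (Num.sqrt (p * #|V|%:R) * Num.sqrt #|V|%:R)) <= eps].
Proof.
move=> k0 K0 e0; pose c1 := 3 * kappa / (4 * (4 + K)).
have c10 : 0 < c1 by rewrite divr_gt0 ?mulr_gt0 //; lra.
exists (c1 / 8), (8 + 16 * K ^+ 2 + 192 / (c1 ^+ 2 * eps)).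
have c2e : 0 < c1 ^+ 2 * eps by rewrite mulr_gt0 ?exprn_gt0.
have X0 : 0 <= 192 / (c1 ^+ 2 * eps) by rewrite divr_ge0 // ltW.
have K20 := sqr_ge0 K.
split=> [||V p A p01 dn /andP[kD DK]]; [by rewrite divr_gt0|lra|].
case/andP: (p01) => p0 p1.
set n := #|V| in kD DK dn *; set q := Num.sqrt (p * n%:R); set s := Num.sqrt n%:R in kD DK *.
have d8 : 8 <= p * n%:R by lra.
have dn' : p * n%:R <= n%:R by rewrite ler_piMl.
have n8 : (8 <= n)%N by rewrite -(ler_nat R); lra.
have n0 : 0 < n%:R :> R by lra.
have s2 : s ^+ 2 = n%:R by rewrite sqr_sqrtr // ltW.
have q2 : q ^+ 2 = p * n%:R by rewrite sqr_sqrtr //; lra.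
have s0 : 0 < s by rewrite sqrtr_gt0.
have q0 : 0 < q by rewrite sqrtr_gt0; lra.
have Ks : 4 * K <= s.
  rewrite -(ler_pXn2r (_ : 0 < 2)%N) ?nnegrE ?mulr_ge0 ?(ltW s0) ?(ltW K0) // s2; lra.
have AV : #|A|%:R + #|~: A|%:R = n%:R :> R by rewrite -natrD cardsC.
have b4 : n%:R / 4 <= #|~: A|%:R :> R.
  have : K * s * 4 <= s * s by rewrite mulrC mulrA ler_wpM2r // ltW.
  rewrite -expr2 s2; lra.
have br : (#|~: A| <= #|A|)%N.
  rewrite -(ler_nat R) -subr_ge0 (le_trans _ kD) // mulr_ge0 // ltW //.
have [b Ab] : exists b, #|~: A| = b.+1.
  by case: #|~: A| b4 => [|b]; [lra|exists b].
have [r Ar] : exists r, #|A| = r.+1 by case: #|A| br; rewrite ?Ab // => r; exists r.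
have gap : c1 * (q / s) <= tail p r b 1 + tail p r b 0 - 1.
  apply: (@gap_lower _ _ p01 kappa K n r b) => //; first by lra.
    by rewrite /n -(cardsC A) Ar Ab addnS addSn.
  by move: kD DK; rewrite Ar Ab -!natr1 => kD DK; rewrite -/s; lra.
have mean : n%:R / 2 + c1 / 4 * (q * s) <= Ex (edge_pr p) (fun E => #|day E A|%:R).
  apply: le_trans (Ex_card_day p01 Ar Ab _); last by rewrite Ar Ab in br.
  rewrite -/n lerD2l.
  have -> : c1 / 4 * (q * s) = n%:R / 4 * (c1 * (q / s)).
    by rewrite -s2; field; rewrite gt_eqF.
  apply: ler_pM => //; first by lra.
    by rewrite mulr_ge0 ?(ltW c10) // divr_ge0 ?sqrtr_ge0.
  by rewrite -Ab.
have var : variance (edge_pr p) (fun E => #|day E A|%:R) <= 3 * n%:R.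
  have := @variance_threshold V R p p01 A [set: V] (hold A); rewrite cardsT => /(_ n8).
  by apply: le_trans; rewrite (eq_variance _ (card_day R ^~ A)).
have qs0 : 0 < c1 / 8 * (q * s) by apply: mulr_gt0; [exact: divr_gt0|exact: mulr_gt0].
have cond : n%:R / 2 + c1 / 8 * (q * s) + c1 / 8 * (q * s) <=
    Ex (edge_pr p) (fun E => #|day E A|%:R) by lra.
have h := chebyshev_lower (@edge_pr01 V R p p01) qs0 cond.
have := le_trans h var.
rewrite -ler_pdivlMr ?exprn_gt0 // => /le_trans; apply.
have c8 : (c1 / 8) ^+ 2 = c1 ^+ 2 / 64 by field.
have qs2 : (q * s) ^+ 2 = p * n%:R * n%:R by rewrite exprMn q2 s2.
have c8qs : (c1 / 8 * (q * s)) ^+ 2 = c1 ^+ 2 / 64 * (p * n%:R * n%:R).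
  by rewrite exprMn c8 qs2.
rewrite ler_pdivrMr ?exprn_gt0 // c8qs.
have : 192 / (c1 ^+ 2 * eps) <= p * n%:R by lra.
rewrite ler_pdivrMr // => h1.
have : 192 * n%:R <= p * n%:R * (c1 ^+ 2 * eps) * n%:R by rewrite ler_pM2r.
lra.
Qed.

End DayOneSurplus.

(** * The second day: forced vertices and nearly independent votes *)

Section DayTwo.
Context (V : finType) (R : realType) (p : R).
Hypothesis p01 : 0 <= p <= 1.
Implicit Types (A U W : {set V}) (u v w : V) (E F : {set {set V}}).
Local Notation Ex := (Ex (@edge_pr V R p)).
Local Notation Pr := (Pr (@edge_pr V R p)).

(** The vertices of [U] other than [v] that would be red on the first day if
    they were joined to [v], for the subgraph induced on [U]. *)
Definition forced A U v E : {set V} :=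
  [set u in U :\ v | hold A u - sg A v <= star A (U :\ v :\ u) u E].

(** A majority of the neighbors of [v] in [U] is red on the first day. Since
    [forced] does not look at the edges at [v], this is a fresh binomial
    experiment given the other edges. *)
Definition red2 A U v E : bool := 0 < star (forced A U v E) (U :\ v) v E.

(** A tie counts against red in [red2], whatever the color of [v] on the first
    day; so only this implication holds. *)
Lemma red2_day A v E : red2 A [set: V] v E -> v \in day E (day E A).
Proof.
have -> : red2 A [set: V] v E = (0 < star (day E A) ([set: V] :\ v) v E).
  congr (_ < _); apply: eq_bigr => u; rewrite !inE andbT => uv.
  have [vuE|_] := boolP (_ \in E); last by rewrite !mulr0n.
  rewrite !mulr1n /sg !inE uv /=.
  rewrite (@star_split _ A ([set: V] :\ u) u v) ?inE 1?eq_sym ?uv // [[set u; v]]setUC vuE.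
  have -> : [set: V] :\ v :\ u = [set: V] :\ u :\ v by apply/setP => t; rewrite !inE andbCA.
  by rewrite mulr1n lerBlDl.
rewrite [in X in _ -> X]inE /hold; move: (star _ _ _ _) => x.
by case: (v \in _); clear; lia.
Qed.

Lemma cut_sub_powerset U u W : u \in W -> U \subset W -> cut u U \subset powerset W.
Proof.
move=> uW UW; apply/subsetP => e /imsetP[t tU ->].
by rewrite powersetE subUset !sub1set uW (subsetP UW).
Qed.

Lemma depends_onW (T : Type) (J K : {set {set V}}) (f : {set {set V}} -> T) :
  J \subset K -> depends_on J f -> depends_on K f.
Proof.
move=> JK fJ E F EF; apply: fJ.
by rewrite -(setIidPr JK) !setIA EF.
Qed.

Lemma forced_depends A U v : depends_on (powerset (U :\ v)) (forced A U v).
Proof.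
move=> E F EF; apply/setP => u; rewrite [LHS]inE [RHS]inE.
have [uU|] //= := boolP (u \in U :\ v); congr (_ <= _).
apply: (depends_onW _ (@star_depends _ A (U :\ v :\ u) u) EF).
exact: cut_sub_powerset (subD1set _ _).
Qed.

Lemma cut_powerset_disjoint v W W' : v \notin W -> [disjoint cut v W' & powerset W].
Proof.
move=> vW; apply/pred0P => e /=; apply/negP => /andP[/imsetP[t tW ->]].
by rewrite powersetE subUset sub1set (negbTE vW).
Qed.

Lemma forced_sub A U v E : forced A U v E \subset U :\ v.
Proof. by apply/subsetP => u; rewrite inE => /andP[]. Qed.

(** The probability that a majority of the neighbors of a vertex is red, if
    [k] of the [N] possible neighbors are. *)
Definition maj (N k : nat) : R := tail p k (N - k) 1.

Lemma Ex_star_forced A U v E : Ex (fun F => (0 < star (forced A U v E) (U :\ v) v F)%R%:R) =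
  maj #|U :\ v| #|forced A U v E|.
Proof.
rewrite (Ex_star p _ (fun s => (0 < s)%R%:R)) ?setD11 // (setIidPr (forced_sub A U v E)).
rewrite /maj /tail cardsD (setIidPr (forced_sub A U v E)); apply: eq_law => j.
by congr (nat_of_bool _)%:R; lia.
Qed.

Lemma red2_splice A U v E F :
  red2 A U v (splice (powerset (U :\ v)) E F) = (0 < star (forced A U v E) (U :\ v) v F).
Proof.
have -> : red2 A U v (splice (powerset (U :\ v)) E F) =
    (0 < star (forced A U v E) (U :\ v) v (splice (powerset (U :\ v)) E F)).
  congr (0 < star _ _ _ _); apply: forced_depends; exact: splice_onl.
congr (_ < _); apply: star_depends; apply: splice_onr.
by apply: cut_powerset_disjoint; rewrite setD11.
Qed.

Lemma Ex_red2 A U v : Pr (red2 A U v) = Ex (fun E => maj #|U :\ v| #|forced A U v E|).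
Proof.
rewrite /Pr (Ex_resample _ (powerset (U :\ v))); apply: eq_Ex => E.
by rewrite -Ex_star_forced; apply: eq_Ex => F; rewrite red2_splice.
Qed.

(** If [v] and [w] are both ignored by each other, the two events are
    independent given the edges away from both. *)
Lemma Ex_red2M A U1 U2 v w : v != w -> U1 :\ v = U2 :\ w ->
  Ex (fun E => (red2 A U1 v E)%:R * (red2 A U2 w E)%:R) =
  Ex (fun E => maj #|U1 :\ v| #|forced A U1 v E| * maj #|U2 :\ w| #|forced A U2 w E|).
Proof.
move=> vw UU; rewrite (Ex_resample _ (powerset (U1 :\ v))); apply: eq_Ex => E.
rewrite -!Ex_star_forced -(Ex_indep _ (J := cut v (U1 :\ v)) (K := cut w (U2 :\ w))).
- by apply: eq_Ex => F; rewrite red2_splice {2}UU red2_splice.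
- by apply: cut_disjoint => //; rewrite -UU setD11.
- by move=> F F' FF; rewrite (star_depends _ FF).
- by move=> F F' FF; rewrite (star_depends _ FF).
Qed.

Lemma card_forced A U v E : #|forced A U v E|%:R =
  \sum_(u in U :\ v) exceeds R A (U :\ v) (hold A u - sg A v) u E.
Proof.
rewrite -sum1_card natr_sum big_mkcond [RHS]big_mkcond /=; apply: eq_bigr => u _.
by rewrite [in LHS]inE /exceeds; case: (u \in _) => //=; case: (_ <= _).
Qed.

Lemma variance_forced A U v : (8 <= #|U :\ v|)%N ->
  variance (edge_pr p) (fun E => #|forced A U v E|%:R) <= 3 * #|U :\ v|%:R.
Proof.
move=> U8; rewrite (eq_variance _ (card_forced A U v)).
exact: (variance_threshold p01 A (fun u => hold A u - sg A v) U8).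
Qed.

Lemma maj_succ N k : (k < N)%N -> maj N k.+1 =
  maj N k + p * (pmf p (signs k (N - k.+1)) 0 + pmf p (signs k (N - k.+1)) 1).
Proof.
move=> kN; rewrite /maj tailSl subrr -(subnSK kN).
by rewrite [tail p k _.+1 1](_ : _ = tail p k (N - k.+1) 1 - p * pmf p (signs k (N - k.+1)) 1);
  [ring|rewrite (tailSr p k (N - k.+1) 1) addrK].
Qed.

Lemma maj_dual N k : (k <= N)%N -> maj N (N - k) = 1 - maj N k - pmf p (signs k (N - k)) 0.
Proof.
move=> kN; rewrite /maj subKn //.
have := tail_dual p k (N - k) 0; rewrite subr0 => ->.
by rewrite (tail_succ p k (N - k) 0) add0r opprD addrA.
Qed.

(** Each further red candidate changes the outcome on at most two atoms, when
    it is present. *)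
Lemma maj_lipschitz N k l Q : (k <= N)%N -> (l <= N)%N ->
  (forall r b j, (r + b).+1 = N -> pmf p (signs r b) j <= Q) ->
  `|maj N k - maj N l| <= 2 * p * Q * `|k%:R - l%:R|.
Proof.
case/andP: (p01) => p0 _.
wlog lk : k l / (l <= k)%N => [hw|] kN lN hQ.
  by case: (leqP l k) => [|/ltnW]; [|rewrite distrC (distrC k%:R)]; move=> h; apply: hw.
suff H d : (l + d <= N)%N -> 0 <= maj N (l + d) - maj N l <= 2 * p * Q * d%:R.
  have := H (k - l)%N; rewrite subnKC // natrB // => /(_ kN) /andP[h1 h2].
  by rewrite ger0_norm // ger0_norm // subr_ge0 ler_nat.
elim: d => [|d IH] ldN; first by rewrite addn0 subrr mulr0 lexx.
rewrite addnS in ldN *; rewrite maj_succ //.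
have /andP[h1 h2] := IH (ltnW ldN).
set r := (l + d)%N in h1 h2 *; set b := (N - r.+1)%N.
have rb : (r + b).+1 = N by rewrite -addSn subnKC.
have a0 := mulr_ge0 p0 (pmf_ge0 p01 (signs r b) 0).
have a1 := mulr_ge0 p0 (pmf_ge0 p01 (signs r b) 1).
have b0 := ler_wpM2l p0 (hQ r b 0 rb).
have b1 := ler_wpM2l p0 (hQ r b 1 rb).
by rewrite -[d.+1%:R]natr1; apply/andP; split; lra.
Qed.

Lemma maj_ge0 N k : 0 <= maj N k.
Proof. exact: tail_ge0. Qed.

Lemma forced_le A U v E : (#|forced A U v E| <= #|U :\ v|)%N.
Proof. exact/subset_leq_card/forced_sub. Qed.

(** Ignoring the edges at [w] changes the outcome at [v] only if [vw] is an edge,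
    or if [v] and [w] have a common neighbor [u] for which the first day
    is decided by a single vote. *)
Lemma red2_ignore A v w E : v != w ->
  red2 A [set: V] v E != red2 A (~: [set w]) v E ->
  ([set v; w] \in E) || [exists u in ~: [set v; w],
    [&& [set v; u] \in E, [set w; u] \in E &
      star A (~: [set v; w] :\ u) u E ==
        hold A u - sg A v - (if w \in A then 1 else 0)]].
Proof.
move=> vw; apply: contraR; rewrite negb_or negb_exists => /andP[vwE /forallP none].
have wv : w != v by rewrite eq_sym.
have UE : ~: [set w] :\ v = ~: [set v; w].
  by apply/setP => t; rewrite !inE negb_or andbC.
have TE : [set: V] :\ v :\ w = ~: [set v; w].
  by apply/setP => t; rewrite !inE negb_or andbT andbC.
rewrite /red2 (@star_split _ _ ([set: V] :\ v) v w) ?inE ?wv // (negbTE vwE) mulr0n add0r.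
rewrite UE TE; apply/eqP; congr (_ < _); apply: eq_bigr => u uW.
have [vuE|_] := boolP ([set v; u] \in E); last by rewrite !mulr0n.
rewrite !mulr1n /sg; congr (if _ then _ else _).
have [uv uw] : u != v /\ u != w by move: uW; rewrite !inE negb_or => /andP.
rewrite !inE uv uw /= -/(sg A v).
rewrite (@star_split _ A ([set: V] :\ v :\ u) u w) ?inE ?wv 1?eq_sym ?uw //.
have -> : [set: V] :\ v :\ u :\ w = ~: [set v; w] :\ u.
  by apply/setP => t; rewrite !inE negb_or andbT andbCA [(t != w) && _]andbC.
rewrite UE [[set u; w]]setUC.
have := none u; rewrite uW vuE /= negb_and.
have [wuE|_] := boolP ([set w; u] \in E); last by rewrite mulr0n add0r.
rewrite mulr1n /sg /=; move: (star _ _ _ _) (hold A u - _) => S h.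
by case: (w \in A); clear; lia.
Qed.

(** In the second case of [red2_ignore] there are at most [n] choices of [u],
    and each needs two given edges and one given value of an independent sum. *)
Lemma Pr_red2_ignore A v w Q : v != w -> 0 <= Q ->
  (forall r b j, (r + b).+3 = #|V| -> pmf p (signs r b) j <= Q) ->
  Pr (fun E => red2 A [set: V] v E != red2 A (~: [set w]) v E) <=
  p + #|V|%:R * (p ^+ 2 * Q).
Proof.
move=> vw Q0 hQ; case/andP: (p01) => p0 _.
have e01 := @edge_pr01 V R p p01.
pose W := ~: [set v; w].
pose c u := hold A u - sg A v - (if w \in A then 1 else 0).
apply: le_trans (le_Pr e01 (fun E => @red2_ignore A v w E vw)) _.
apply: le_trans (Pr_or e01 _ _) _; apply: lerD.
  by rewrite /Pr Ex_mem edge_prE.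
apply: le_trans (Pr_exists e01 _ _) _.
rewrite -/W; apply: (@le_trans _ _ (\sum_(u in W) p ^+ 2 * Q)); last first.
  rewrite sumr_const -[leLHS]mulr_natl ler_wpM2r ?ler_nat ?max_card //.
  by rewrite mulr_ge0 ?sqr_ge0.
apply: ler_sum => u uW.
have [uv uw] : u != v /\ u != w by move: uW; rewrite !inE negb_or => /andP.
have [vu wu] : v != u /\ w != u by rewrite ![_ == u]eq_sym.
have uvw : [set v; u] != [set w; u].
  by apply: contra vw => /eqP; rewrite setUC [RHS]setUC => /(set2_injr uv uw) ->.
have cardW : (#|W :\ u|.+3 = #|V|)%N.
  have := cardsC [set v; w]; rewrite cards2 vw -/W (cardsD1 u W) uW; clear; lia.
have dep1 x : depends_on [set x] (fun E : {set {set V}} => (x \in E)%:R : R).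
  move=> E F /setP/(_ x); rewrite !inE eqxx !andbT => -> //.
have two : Ex (fun E => ([set v; u] \in E)%:R * ([set w; u] \in E)%:R) = p ^+ 2.
  rewrite (Ex_indep _ (J := [set [set v; u]]) (K := [set [set w; u]])) //.
    by rewrite !Ex_mem !edge_prE.
  by rewrite disjoints1 inE.
pose g s : R := (s == c u)%:R.
have -> : Pr (fun E => [&& [set v; u] \in E, [set w; u] \in E & star A (W :\ u) u E == c u])
  = p ^+ 2 * Ex (fun E => g (star A (W :\ u) u E)).
  rewrite -two -(Ex_indep _ (J := [set [set v; u]; [set w; u]]) (K := cut u (W :\ u))).
  - by apply: eq_Ex => E; rewrite -!natrM !mulnb andbA.
  - rewrite disjoint_sym; apply/pred0P => e /=; apply/negP => /andP[eW].
    have vW : v \notin W :\ u by rewrite !inE eqxx /= andbF.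
    have wW : w \notin W :\ u by rewrite !inE eqxx orbT andbF.
    rewrite !inE => /orP[] /eqP eE; move: eW; rewrite eE setUC; apply/negP;
      exact: edge_notin_cut.
  - move=> E F /setP EF; have := EF [set v; u]; have := EF [set w; u].
    by rewrite !inE !eqxx orbT !andbT => -> ->.
  - by move=> E F EF; rewrite /g (star_depends A EF).
rewrite ler_wpM2l ?sqr_ge0 // Ex_star ?setD11 //.
by apply: hQ; rewrite cardsID.
Qed.

(** The mean is rounded, as [maj] takes a natural number. *)
Definition mean_forced A U v : nat := Num.truncn (Ex (fun E => #|forced A U v E|%:R)).

Lemma mean_forcedP A U v :
  (mean_forced A U v)%:R <= Ex (fun E => #|forced A U v E|%:R) < (mean_forced A U v)%:R + 1.
Proof.
rewrite truncn_le ?natr1 ?truncnS_gt ?andbT //.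
exact: Ex_ge0 (edge_pr01 p01) _ _.
Qed.

Lemma mean_forced_le A U v : (mean_forced A U v <= #|U :\ v|)%N.
Proof.
rewrite -(ler_nat R); have /andP[h _] := mean_forcedP A U v; apply: le_trans h _.
by apply: Ex_le (edge_pr01 p01) _ _ _ => E; rewrite ler_nat forced_le.
Qed.

Lemma forced_concentrated A U v : (8 <= #|U :\ v|)%N ->
  Ex (fun E => (#|forced A U v E|%:R - (mean_forced A U v)%:R) ^+ 2) <= 3 * #|U :\ v|%:R + 1.
Proof.
move=> U8; rewrite Ex_sqrB lerD ?variance_forced //.
by have /andP[h1 h2] := mean_forcedP A U v; rewrite expr_le1 //; lra.
Qed.

(** The number of forced vertices is concentrated about its mean, and [maj] is
    Lipschitz. *)
Lemma Ex_maj_ge A U v Q t : (8 <= #|U :\ v|)%N -> 0 <= Q -> 0 < t ->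
  3 * #|U :\ v|%:R + 1 <= t ^+ 2 ->
  (forall r b j, (r + b).+1 = #|U :\ v| -> pmf p (signs r b) j <= Q) ->
  maj #|U :\ v| (mean_forced A U v) - 2 * p * Q * t <= Pr (red2 A U v).
Proof.
move=> U8 Q0 t0 ht hQ; case/andP: (p01) => p0 _.
have e01 := @edge_pr01 V R p p01.
have L0 : 0 <= 2 * p * Q by rewrite mulr_ge0 // mulr_ge0.
rewrite Ex_red2; set k := mean_forced A U v; pose f E : R := #|forced A U v E|%:R.
apply: (@le_trans _ _ (Ex (fun E => maj #|U :\ v| k - 2 * p * Q * `|f E - k%:R|))).
  rewrite ExB Ex_cst ExZ lerD2l lerN2 ler_wpM2l //.
  by apply: (Ex_norm_le e01) => //; exact: le_trans (forced_concentrated A U8) ht.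
apply: le_Ex e01 _ _ _ => E.
have := maj_lipschitz (forced_le A U v E) (mean_forced_le A U v) hQ.
by rewrite ler_norml -/k -/(f E); lra.
Qed.

Lemma variance_maj A U v Q : (8 <= #|U :\ v|)%N -> 0 <= Q ->
  (forall r b j, (r + b).+1 = #|U :\ v| -> pmf p (signs r b) j <= Q) ->
  variance (edge_pr p) (fun E => maj #|U :\ v| #|forced A U v E|) <=
  (2 * p * Q) ^+ 2 * (3 * #|U :\ v|%:R + 1).
Proof.
move=> U8 Q0 hQ; case/andP: (p01) => p0 _.
have e01 := @edge_pr01 V R p p01.
have L0 : 0 <= 2 * p * Q by rewrite mulr_ge0 // mulr_ge0.
have h := variance_le (edge_pr p) (fun E => maj #|U :\ v| #|forced A U v E|)
  (maj #|U :\ v| (mean_forced A U v)).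
apply: (le_trans h).
apply: (@le_trans _ _ (Ex (fun E => (2 * p * Q) ^+ 2 *
    (#|forced A U v E|%:R - (mean_forced A U v)%:R) ^+ 2))); last first.
  by rewrite ExZ ler_wpM2l ?sqr_ge0 // forced_concentrated.
apply: le_Ex e01 _ _ _ => E.
rewrite -exprMn -[leLHS]real_normK ?num_real // -[leRHS]real_normK ?num_real //.
rewrite lerXn2r ?nnegrE // normrM (ger0_norm L0).
exact: maj_lipschitz (forced_le A U v E) (mean_forced_le A U v) hQ.
Qed.

Lemma mul_near (a b a' b' e : R) : 0 <= a' <= 1 -> 0 <= b <= 1 -> 0 <= e ->
  a' - e <= a -> b' - e <= b -> a' * b' - 2 * e <= a * b.
Proof.
move=> /andP[a0 a1] /andP[b0 b1] e0 ha hb.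
have h1 : a' * (b' - b) <= a' * e by rewrite ler_wpM2l //; lra.
have h2 : a' * e <= e by rewrite ler_piMl.
have h3 : b * (a' - a) <= b * e by rewrite ler_wpM2l //; lra.
have h4 : b * e <= e by rewrite ler_piMl.
lra.
Qed.

Lemma norm_natrB (B C : bool) : `|B%:R - C%:R| = (B != C)%:R :> R.
Proof.
by case: B; case: C => /=; rewrite ?subrr ?subr0 ?sub0r ?normrN ?normr0 ?normr1.
Qed.

(** By the conditional independence of [Ex_red2M] the covariance of the two
    events is, up to the error of ignoring single edges, that of two Lipschitz
    functions of the numbers of [forced] vertices, which are concentrated. *)
Lemma covariance_red2 A v w Q : v != w -> 0 <= Q -> (10 <= #|V|)%N ->
  (forall r b j, (#|V| <= (r + b).+3)%N -> pmf p (signs r b) j <= Q) ->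
  Ex (fun E => (red2 A [set: V] v E)%:R * (red2 A [set: V] w E)%:R)
    - Pr (red2 A [set: V] v) * Pr (red2 A [set: V] w) <=
  4 * (p + #|V|%:R * (p ^+ 2 * Q)) + (2 * p * Q) ^+ 2 * (3 * #|V|%:R + 1).
Proof.
move=> vw Q0 V10 hQ; have e01 := @edge_pr01 V R p p01.
have wv : w != v by rewrite eq_sym.
pose yv E : R := (red2 A [set: V] v E)%:R; pose yw E : R := (red2 A [set: V] w E)%:R.
pose zv E : R := (red2 A (~: [set w]) v E)%:R; pose zw E : R := (red2 A (~: [set v]) w E)%:R.
have UU : ~: [set w] :\ v = ~: [set v] :\ w by apply/setP => t; rewrite !inE andbC.
have cardU : (#|~: [set w] :\ v|.+2 = #|V|)%N.
  have := cardsC [set w]; rewrite cards1 (cardsD1 v (~: [set w])) !inE vw; clear; lia.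
have U8 : (8 <= #|~: [set w] :\ v|)%N by rewrite -cardU in V10.
have hQU r b j : (r + b).+1 = #|~: [set w] :\ v| -> pmf p (signs r b) j <= Q.
  by move=> rb; apply: hQ; rewrite -cardU -rb.
set eta := p + _ * _.
have dv : Ex (fun E => `|yv E - zv E|) <= eta.
  rewrite (eq_Ex _ (fun E => norm_natrB _ _)).
  by apply: Pr_red2_ignore => // r b j rb; apply: hQ; rewrite rb.
have dw : Ex (fun E => `|yw E - zw E|) <= eta.
  rewrite (eq_Ex _ (fun E => norm_natrB _ _)).
  by apply: Pr_red2_ignore => // r b j rb; apply: hQ; rewrite rb.
have b01 (B : bool) : 0 <= (B%:R : R) <= 1 by case: B; rewrite ?lexx ?ler01.
have prod : Ex (fun E => yv E * yw E) <= Ex (fun E => zv E * zw E) + 2 * eta.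
  apply: (@le_trans _ _ (Ex (fun E => zv E * zw E + (`|yv E - zv E| + `|yw E - zw E|)))).
    apply: le_Ex e01 _ _ _ => E; have := ler_norm (yv E - zv E); have := ler_norm (yw E - zw E).
    have := b01 (red2 A [set: V] w E); have := b01 (red2 A (~: [set w]) v E).
    rewrite -/(yw E) -/(zv E) => /andP[z0 z1] /andP[y0 y1].
    have := normr_ge0 (yv E - zv E); have := normr_ge0 (yw E - zw E); nra.
  by rewrite ExD ExD; lra.
have near f g : Ex (fun E => `|f E - g E|) <= eta -> Ex g - eta <= Ex f.
  move=> h; have := ler_norm_Ex e01 (fun E => f E - g E); rewrite ExB.
  by have := lerNnormlW (lexx `|Ex f - Ex g|); lra.
have hv := near _ _ dv; have hw := near _ _ dw.
have Y v' : 0 <= Pr (red2 A [set: V] v') <= 1 by rewrite Pr_ge0 ?Pr_le1.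
have /andP[yv0 yv1] := Y v; have /andP[yw0 yw1] := Y w.
have zv1 : Ex zv <= 1 by exact: Pr_le1.
have zw1 : Ex zw <= 1 by exact: Pr_le1.
have zv0 : 0 <= Ex zv by exact: Pr_ge0.
have zw0 : 0 <= Ex zw by exact: Pr_ge0.
have eta0 : 0 <= eta by apply: le_trans dv; apply: Ex_ge0 => // E; exact: normr_ge0.
have prod2 : Ex zv * Ex zw - 2 * eta <= Pr (red2 A [set: V] v) * Pr (red2 A [set: V] w).
  by apply: mul_near hv hw => //; rewrite ?zv0 ?yw0.
have cov : Ex (fun E => zv E * zw E) - Ex zv * Ex zw <=
    (2 * p * Q) ^+ 2 * (3 * #|V|%:R + 1).
  rewrite /zv /zw (Ex_red2M A vw UU) -/(Pr (red2 _ _ _)) -/(Pr (red2 _ _ w)) !Ex_red2.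
  apply: le_trans (covariance_le e01 _ _) _.
  have v1 := variance_maj A U8 Q0 hQU.
  have v2 : variance (edge_pr p) (fun E => maj #|~: [set v] :\ w| #|forced A (~: [set v]) w E|) <=
      (2 * p * Q) ^+ 2 * (3 * #|~: [set v] :\ w|%:R + 1).
    by apply: variance_maj; rewrite -?UU.
  rewrite -UU in v2 *.
  have : (2 * p * Q) ^+ 2 * (3 * #|~: [set w] :\ v|%:R + 1) <= (2 * p * Q) ^+ 2 * (3 * #|V|%:R + 1).
    by rewrite ler_wpM2l ?sqr_ge0 // lerD2r ler_wpM2l // ler_nat max_card.
  lra.
have : Ex (fun E => yv E * yw E) - Pr (red2 A [set: V] v) * Pr (red2 A [set: V] w) <=
  4 * eta + (2 * p * Q) ^+ 2 * (3 * #|V|%:R + 1) by lra.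
by [].
Qed.

Lemma variance_red2 A Q : 0 <= Q -> (10 <= #|V|)%N ->
  (forall r b j, (#|V| <= (r + b).+3)%N -> pmf p (signs r b) j <= Q) ->
  variance (edge_pr p) (fun E => \sum_(v in [set: V]) (red2 A [set: V] v E)%:R) <=
  #|V|%:R + #|V|%:R ^+ 2 *
    (4 * (p + #|V|%:R * (p ^+ 2 * Q)) + (2 * p * Q) ^+ 2 * (3 * #|V|%:R + 1)).
Proof.
move=> Q0 V10 hQ; case/andP: (p01) => p0 _; rewrite -cardsT; apply: variance_sum.
- exact: edge_pr01.
- rewrite addr_ge0 ?mulr_ge0 ?sqr_ge0 ?addr_ge0 ?mulr_ge0 ?sqr_ge0 //.
- by move=> v E _; case: (red2 _ _ _ _); rewrite ?lexx ?ler01.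
- move=> v w _ _ vw; rewrite cardsT; exact: covariance_red2.
Qed.

End DayTwo.

(** * The second day: cancellation of the memory effect *)

Section MeanForced.
Context (V : finType) (R : realType) (p : R).
Hypothesis p01 : 0 <= p <= 1.
Implicit Types (A U : {set V}) (u v : V).
Local Notation Ex := (Ex (@edge_pr V R p)).

Lemma sum_two_values U A (f : V -> R) (x y : R) :
  (forall u, u \in U -> f u = if u \in A then x else y) ->
  \sum_(u in U) f u = #|U :&: A|%:R * x + #|U :\: A|%:R * y.
Proof.
move=> fE; rewrite (big_setID A) /=; congr (_ + _).
  rewrite (eq_bigr (fun=> x)) ?sumr_const ?mulr_natl // => u.
  by rewrite inE => /andP[uU uA]; rewrite fE // uA.
rewrite (eq_bigr (fun=> y)) ?sumr_const ?mulr_natl // => u.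
by rewrite inE => /andP[uA uU]; rewrite fE // (negbTE uA).
Qed.

Lemma Ex_forced_red A v (r b : nat) : #|A| = r.+2 -> #|~: A| = b.+2 -> v \in A ->
  Ex (fun E => #|forced A [set: V] v E|%:R) =
  r.+1%:R * tail p r b.+2 (-1) + b.+2%:R * tail p r.+1 b.+1 0.
Proof.
move=> Ar Ab vA; rewrite (eq_Ex _ (card_forced R A [set: V] v)) Ex_sum.
have cA : #|([set: V] :\ v) :&: A| = r.+1 by rewrite card_setD1I setTI vA Ar subSS subn0.
have cB : #|([set: V] :\ v) :\: A| = b.+2.
  by rewrite setDE card_setD1I setTI inE vA Ab subn0.
rewrite -cA -cB; apply: sum_two_values => u uU.
rewrite Ex_exceeds cA cB !inE; rewrite !inE in uU; rewrite uU /hold /sg vA.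
by case: (u \in A); rewrite /= ?subn0 ?subSS ?subn0.
Qed.

Lemma Ex_forced_blue A v (r b : nat) : #|A| = r.+2 -> #|~: A| = b.+2 -> v \notin A ->
  Ex (fun E => #|forced A [set: V] v E|%:R) =
  r.+2%:R * tail p r.+1 b.+1 1 + b.+1%:R * tail p r.+2 b 2.
Proof.
move=> Ar Ab vA; rewrite (eq_Ex _ (card_forced R A [set: V] v)) Ex_sum.
have cA : #|([set: V] :\ v) :&: A| = r.+2.
  by rewrite card_setD1I setTI (negbTE vA) Ar subn0.
have cB : #|([set: V] :\ v) :\: A| = b.+1.
  by rewrite setDE card_setD1I setTI inE vA Ab subSS subn0.
rewrite -cA -cB; apply: sum_two_values => u uU.
rewrite Ex_exceeds cA cB !inE; rewrite !inE in uU; rewrite uU /hold /sg (negbTE vA).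
by case: (u \in A); rewrite /= ?subn0 ?subSS ?subn0.
Qed.

(** The influence of the color of [v] on its own neighbors is much larger than
    the bias of the first day, but it has opposite signs for red and for blue
    vertices; in the sum only the bias remains. *)
Lemma forced_sum (r b : nat) : (b <= r)%N ->
  (r + b).+3%:R + b.+2%:R * (tail p r.+1 b.+1 1 + tail p r.+1 b.+1 0 - 1)
    - (r%:R - b%:R) <=
  (r.+1%:R * tail p r b.+2 (-1) + b.+2%:R * tail p r.+1 b.+1 0) +
  (r.+2%:R * tail p r.+1 b.+1 1 + b.+1%:R * tail p r.+2 b 2).
Proof.
move=> br; have := tail_dual p b r.+2 (-1); rewrite opprK => ->.
have := @tail_mono _ _ p01 b r r.+2 b.+2 (-1) br; rewrite !ltnS => /(_ br).
set a1 := tail p r _ _; set a4 := tail p b _ _; set a2 := tail p r.+1 b.+1 0.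
set a3 := tail p r.+1 b.+1 1 => a14.
have a10 : 0 <= a1 by exact: tail_ge0.
have a30 : 0 <= a3 by exact: tail_ge0.
have rb : 0 <= r%:R - b%:R :> R by rewrite subr_ge0 ler_nat.
have -> : (r + b).+3%:R = r%:R + b%:R + 3 :> R by rewrite -addn3 !natrD.
have S1 m : m.+1%:R = m%:R + 1 :> R by rewrite natr1.
have S2 m : m.+2%:R = m%:R + 2 :> R by rewrite -addn2 natrD.
rewrite (S2 r) (S2 b) (S1 r) (S1 b).
have b0 : 0 <= b%:R :> R by [].
have h1 : 0 <= (b%:R + 1) * (a1 - a4) by rewrite mulr_ge0 ?subr_ge0 // addr_ge0.
have h2 : 0 <= (r%:R - b%:R) * a1 by rewrite mulr_ge0.
have h3 : 0 <= (r%:R - b%:R) * a3 by rewrite mulr_ge0.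
nra.
Qed.

(** By [tail_near_half] the chance of every vertex to be forced is close to one
    half, although its threshold is displaced by the vote of [v]. *)
Lemma forced_near_half (r b : nat) (Q : R) : (b <= r)%N ->
  (forall r' b' j, (b.*2 <= r' + b')%N -> pmf p (signs r' b') j <= Q) ->
  `|2 * (r.+1%:R * tail p r b.+2 (-1) + b.+2%:R * tail p r.+1 b.+1 0) - (r + b).+3%:R| <=
  (r + b).+3%:R * ((2 * p * (r%:R - b%:R + 2) + 3) * Q).
Proof.
move=> br hQ; case/andP: (p01) => p0 _.
have Q0 : 0 <= Q by apply: le_trans (hQ b b 0 _); rewrite ?pmf_ge0 // -addnn.
have h1 := @tail_near_half _ p p01 b r b.+2 (-1) Q br (leqW (leqnSn b)) hQ.
have h2 := @tail_near_half _ p p01 b r.+1 b.+1 0 Q (leqW br) (leqnSn b) hQ.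
have rb : 0 <= r%:R - b%:R :> R by rewrite subr_ge0 ler_nat.
have S1 m : m.+1%:R = m%:R + 1 :> R by rewrite natr1.
have S2 m : m.+2%:R = m%:R + 2 :> R by rewrite -addn2 natrD.
have S3 : (r + b).+3%:R = (r%:R + 1) + (b%:R + 2) :> R by rewrite -addn3 !natrD; ring.
set a1 := tail p r _ _ in h1 *; set a2 := tail p r.+1 _ _ in h2 *.
have e1 : `|2 * a1 - 1| <= (2 * p * (r%:R - b%:R + 2) + 3) * Q.
  apply: le_trans h1 _; rewrite ler_wpM2r // lerD // ?ler_wpM2l ?mulr_ge0 //.
  by rewrite (S2 b) ler_norml; apply/andP; split; lra.
have e2 : `|2 * a2 - 1| <= (2 * p * (r%:R - b%:R + 2) + 3) * Q.
  apply: le_trans h2 _; rewrite ler_wpM2r // lerD //; last by rewrite ler1n.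
  rewrite ler_wpM2l ?mulr_ge0 //.
  by rewrite (S1 r) (S1 b) ler_norml; apply/andP; split; lra.
rewrite S3 (S1 r) (S2 b).
have -> : 2 * ((r%:R + 1) * a1 + (b%:R + 2) * a2) - (r%:R + 1 + (b%:R + 2)) =
    (r%:R + 1) * (2 * a1 - 1) + (b%:R + 2) * (2 * a2 - 1) by ring.
have r0 : 0 <= r%:R + 1 :> R by rewrite addr_ge0.
have b0 : 0 <= b%:R + 2 :> R by rewrite addr_ge0.
rewrite [leRHS]mulrDl; apply: le_trans (ler_normD _ _) _.
by rewrite !normrM (ger0_norm r0) (ger0_norm b0) lerD // ler_wpM2l.
Qed.

Lemma maj_mono N k l : (k <= l)%N -> maj p N k <= maj p N l.
Proof. by move=> kl; apply: tail_mono => //; exact: leq_sub2l. Qed.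

Lemma maj_climb N k B (x : R) : (k + B <= N)%N ->
  (forall j, (k <= j < k + B)%N -> x <= pmf p (signs j (N - j.+1)) 0) ->
  maj p N k + p * x * B%:R <= maj p N (k + B).
Proof.
case/andP: (p01) => p0 _.
elim: B => [|B IH]; first by rewrite addn0 mulr0 addr0.
rewrite addnS => kBN hx; rewrite maj_succ //.
have := IH (ltnW kBN) (fun j h => hx j (introT andP (conj (andP h).1 (leqW (andP h).2)))).
have := ler_wpM2l p0 (hx (k + B)%N (introT andP (conj (leq_addr _ _) (ltnSn _)))).
have := mulr_ge0 p0 (pmf_ge0 p01 (signs (k + B) (N - (k + B).+1)) 1).
rewrite -[B.+1%:R]natr1; lra.
Qed.

(** By [maj_dual] red at [kr] is, up to a tie, the complement of red at
    [N - kr]. From there to [kb] lies a stretch of [B] increments of [maj],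
    each at least [p] times the chance of a near tie. *)
Lemma maj_pair N kr kb B (x Q : R) : (kr <= N)%N -> (kb <= N)%N ->
  (N + B <= kr + kb)%N ->
  (forall j, (N - kr <= j < N - kr + B)%N -> x <= pmf p (signs j (N - j.+1)) 0) ->
  pmf p (signs kr (N - kr)) 0 <= Q ->
  1 - Q + p * x * B%:R <= maj p N kr + maj p N kb.
Proof.
move=> krN kbN NB hx hQ.
have kB : (N - kr + B <= kb)%N by move: NB krN; clear; lia.
have := maj_climb (leq_trans kB kbN) hx.
have := maj_mono N kB; have := @maj_dual R p N kr krN.
lra.
Qed.

End MeanForced.

Lemma pmf_signs_le (R : realType) (p : R) (n r b : nat) (j : int) : 0 <= p <= 1 / 2 ->
  0 < p * n%:R -> (9 <= n)%N -> (n <= 3 * (r + b))%N ->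
  pmf p (signs r b) j <= 3 / Num.sqrt (p * n%:R).
Proof.
move=> p12 d0 n9 nrb; have p01 : 0 <= p <= 1 by lra.
case/andP: (p12) => p0 p2.
have q0 : 0 < Num.sqrt (p * n%:R) by rewrite sqrtr_gt0.
rewrite ler_pdivlMr //; set x := pmf _ _ _.
have x0 : 0 <= x by exact: pmf_ge0.
rewrite -(ler_pXn2r (_ : 0 < 2)%N) ?nnegrE //; last by rewrite mulr_ge0 // ltW.
rewrite exprMn sqr_sqrtr ?(ltW d0) //.
have := pmf_sqr_le p01 j (all_signs r b); rewrite size_signs -/x.
set m := ((r + b)./2)%N => h.
have nm : n%:R <= 9 * m%:R :> R.
  by rewrite -natrM ler_nat /m; move: nrb n9; clear; lia.
have h1 : p * n%:R <= p * (9 * m%:R) by rewrite ler_wpM2l.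
have h2 : 0 <= p * m%:R * (1 - 2 * p) by rewrite !mulr_ge0 //; lra.
have h3 : p * n%:R <= 9 * (2 * (p * (1 - p)) * m%:R) by lra.
have h4 : x ^+ 2 * (p * n%:R) <= x ^+ 2 * (9 * (2 * (p * (1 - p)) * m%:R)).
  by rewrite ler_wpM2l ?sqr_ge0.
lra.
Qed.

(** * The second day: mean number of red vertices *)

Section DayTwoMean.
Context (R : realType).

Lemma sqrt_scales (p : R) (n : nat) : 0 <= p <= 1 -> 1 <= Num.sqrt (p * n%:R) ->
  [/\ 0 < n%:R :> R, Num.sqrt n%:R ^+ 2 = n%:R :> R,
      Num.sqrt (p * n%:R) ^+ 2 = p * n%:R, 0 < Num.sqrt n%:R :> R &
      Num.sqrt (p * n%:R) <= Num.sqrt n%:R].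
Proof.
move=> /andP[p0 p1] q1.
have d0 : 0 < p * n%:R by rewrite -sqrtr_gt0; lra.
have n0 : 0 < n%:R :> R by case: n {q1} d0 => [|n]; rewrite ?mulr0 ?ltxx ?ltr0n.
split=> //.
- by rewrite sqr_sqrtr // ltW.
- by rewrite sqr_sqrtr // ltW.
- by rewrite sqrtr_gt0.
- by rewrite ler_wsqrtr // ler_piMl.
Qed.

(** The near ties that [maj_climb] asks for: [kr] differs from [N / 2] by at
    most the order of the standard deviation over [p], and so does every index on
    the stretch. *)
Lemma near_tie (C x p X : R) (n N kr B j : nat) :
  0 <= p <= 1 / 2 -> 8 * C <= Num.sqrt (p * n%:R) -> 0 < C -> n = N.+1 -> (16 <= n)%N ->
  1 <= Num.sqrt (p * n%:R) ->
  `|2 * kr%:R - N%:R| <= X -> p * (X + 2 * B%:R + 1) <= C * Num.sqrt (p * n%:R) ->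
  (forall r b, (n <= 4 * r)%N -> (n <= 4 * b)%N -> (r + b <= n)%N ->
    p * `|r%:R - b%:R| <= C * Num.sqrt (p * n%:R) -> x <= pmf p (signs r b) 0) ->
  (kr <= N)%N -> (N - kr <= j < N - kr + B)%N -> (j < N)%N ->
  x <= pmf p (signs j (N - j.+1)) 0.
Proof.
move=> p12 qC C0 nN n16 q1 hX hC H krN /andP[j1 j2] jN.
have p01 : 0 <= p <= 1 by lra.
have [n0 _ q2 _ _] := sqrt_scales p01 q1.
set q := Num.sqrt _ in qC q1 hC q2 H *.
case/andP: p12 => p0 _.
have pn0 : 0 < p by rewrite -(pmulr_lgt0 _ n0) -q2 exprn_gt0 //; lra.
have jR : (N%:R - kr%:R <= j%:R :> R) by rewrite -natrB // ler_nat.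
have jR2 : j%:R + 1 <= N%:R - kr%:R + B%:R :> R by rewrite -natrB // natr1 -natrD ler_nat.
have NR : n%:R = N%:R + 1 :> R by rewrite nN natr1.
have bR : (N - j.+1)%N%:R = N%:R - (j%:R + 1) :> R by rewrite natrB // natr1.
have hd : `|j%:R - (N - j.+1)%N%:R| <= X + 2 * B%:R + 1 :> R.
  rewrite bR; have B0 : 0 <= B%:R :> R by [].
  by move: hX; rewrite !ler_norml => /andP[h1 h2]; apply/andP; split; lra.
have hpd : p * `|j%:R - (N - j.+1)%N%:R| <= C * q.
  by apply: le_trans hC; rewrite ler_wpM2l.
have hn : 8 * `|j%:R - (N - j.+1)%N%:R| <= n%:R :> R.
  rewrite -(ler_pM2l pn0) -q2.
  have h1 : 8 * C * q <= q * q by rewrite ler_wpM2r //; lra.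
  rewrite expr2; lra.
have n16R : 16 <= n%:R :> R by rewrite ler_nat.
apply: H => //.
- rewrite -(ler_nat R) natrM; move: hn; rewrite bR.
  have := ler_norm (-(j%:R - (N%:R - (j%:R + 1)) : R)); rewrite normrN; lra.
- rewrite -(ler_nat R) natrM; move: hn; rewrite bR.
  have := ler_norm (j%:R - (N%:R - (j%:R + 1)) : R); lra.
- rewrite -(ler_nat R) natrD bR; lra.
Qed.

(** For [near_tie]: the width of the stretch, times [p], stays within a fixed
    number of standard deviations [q]. Here [p * s] has to be bounded, that is,
    [p] has to be at most of the order of [n ^ (-1/2)]. *)
Lemma tie_budget (C1 K c1 p q s D N B : R) : 0 <= p <= 1 / 2 -> 1 <= q ->
  0 <= K -> 0 <= c1 -> 0 <= D -> D <= K * s -> p * s <= C1 -> p * N <= q ^+ 2 ->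
  B <= c1 / 8 * (q * s) ->
  p * (N * ((2 * p * (D + 2) + 3) * (3 / q)) + 2 + 2 * B + 1) <=
  (6 * K * C1 + 17 + c1 * C1 / 4) * q.
Proof.
move=> /andP[p0 p2] q1 K0 c0 D0 DK ps pN hB.
have q0 : 0 < q by lra.
have pD : p * D <= K * C1.
  have h1 : p * D <= p * (K * s) by rewrite ler_wpM2l.
  have h2 : K * (p * s) <= K * C1 by rewrite ler_wpM2l.
  by clear -h1 h2; lra.
have pB : p * B <= c1 * C1 / 8 * q.
  have h1 : p * B <= p * (c1 / 8 * (q * s)) by rewrite ler_wpM2l.
  have h2 : c1 / 8 * q * (p * s) <= c1 / 8 * q * C1.
    by apply: ler_wpM2l => //; apply: mulr_ge0; [exact: divr_ge0|exact: ltW].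
  by clear -h1 h2; lra.
have w0 : 0 <= (2 * p * (D + 2) + 3) * (3 / q).
  apply: mulr_ge0; last by apply: divr_ge0 => //; exact: ltW.
  by apply: addr_ge0 => //; apply: mulr_ge0; [exact: mulr_ge0|exact: addr_ge0].
have pX : p * (N * ((2 * p * (D + 2) + 3) * (3 / q))) <= (6 * K * C1 + 15) * q.
  rewrite mulrA; apply: (@le_trans _ _ (q ^+ 2 * ((2 * p * (D + 2) + 3) * (3 / q)))).
    exact: ler_wpM2r.
  have -> : q ^+ 2 * ((2 * p * (D + 2) + 3) * (3 / q)) = (6 * (p * D) + 12 * p + 9) * q.
    by field; rewrite gt_eqF.
  by apply: ler_wpM2r; [exact: ltW|clear -pD p2; lra].
by clear -pX pB p2 q1; lra.
Qed.

(** There are at least [n / 4] pairs of a red and a blue vertex, and [maj_pair]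
    with [B] of order [q s] and near ties of probability of order [1 / q] gives
    each of them a gain of order [p s]. The subtracted terms account for the
    unpaired red vertices, for the ties, and for the fluctuations of the number
    of forced vertices. *)
Lemma day_two_mean (kappa K C1 : R) : 0 < kappa -> 0 < K -> 0 < C1 ->
  exists c q0 : R, [/\ 0 < c, 16 <= q0 &
  forall (V : finType) (p : R) (A : {set V}) (q := Num.sqrt (p * #|V|%:R))
      (s := Num.sqrt #|V|%:R), 0 <= p <= 1 / 2 -> q0 <= q -> q ^+ 2 <= C1 * s ->
    kappa * s <= #|A|%:R - #|~: A|%:R <= K * s ->
    s ^+ 2 / 2 + c * (q ^+ 2 * s) - (K * s + 3 * (s ^+ 2 / q) + 12 * (q * s)) <=
    Ex (edge_pr p) (fun E => \sum_(v in [set: V]) (red2 A [set: V] v E)%:R)].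
Proof.
move=> k0 K0 C10.
pose c1 := 3 * kappa / (4 * (4 + K)).
have c10 : 0 < c1 by rewrite divr_gt0 ?mulr_gt0 //; lra.
pose C := 6 * K * C1 + 17 + c1 * C1 / 4.
have KC0 : 0 < K * C1 by rewrite mulr_gt0.
have cC0 : 0 < c1 * C1 by rewrite mulr_gt0.
have C0 : 0 < C by rewrite /C; lra.
have [cL [d0 [cL0 d01 HL]]] := pmf_signs0_ge C0.
(* The sum bounds [q] from below by each of its terms: [8 C] and [d0] for
   [near_tie] and the local lower bound, [4 K C1] to make the blue side at
   least [n / 4], and the last one so that the bias exceeds the corrections
   [r - b] and [2] in [forced_sum]. *)
exists (cL * c1 / 64), (d0 + 16 + 8 * C + 4 * K * C1 + 16 * (K + 2) / c1).
have Kc0 : 0 < 16 * (K + 2) / c1 by rewrite divr_gt0 // mulr_gt0 //; lra.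
split=> [||V p A q s p12 q0q qC1 /andP[kD DK]]; [exact: divr_gt0 (mulr_gt0 cL0 c10) _|lra|].
have p01 : 0 <= p <= 1 by lra.
set n := #|V| in q s q0q qC1 kD DK *.
have q1 : 1 <= q by lra.
have [n0 s2 q2 s0 qs] := sqrt_scales p01 q1.
rewrite -/q -/s in s2 q2 s0 qs.
have s0' := ltW s0.
have q0 : 0 < q by lra.
have q0' := ltW q0.
case/andP: (p12) => p0 p2.
have Ks : 4 * K <= s.
  have h1 : 4 * K * C1 <= q by lra.
  have h2 : q <= q * q by rewrite ler_peMl.
  by rewrite -(ler_pM2r C10); move: qC1; rewrite expr2; lra.
set D := #|A|%:R - #|~: A|%:R in kD DK.
have AV : #|A|%:R + #|~: A|%:R = n%:R :> R by rewrite -natrD cardsC.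
have D0 : 0 <= D by apply: le_trans kD; rewrite mulr_ge0 // ltW.
have DE : D = #|A|%:R - #|~: A|%:R by [].
have Kss : 4 * (K * s) <= n%:R by rewrite -s2 expr2 mulrA ler_wpM2r.
have ns : 16 * s <= n%:R by rewrite -s2 expr2 ler_wpM2r //; lra.
have s16 : 16 <= s by lra.
have n16R : 256 <= n%:R :> R by lra.
have n16 : (16 <= n)%N by rewrite -(ler_nat R); lra.
have b4 : n%:R / 4 <= #|~: A|%:R :> R by lra.
have [b Ab] : exists b, #|~: A| = b.+2.
  by case: #|~: A| b4 => [|[|b]] b4; [exfalso; clear -b4 n16R; lra|exfalso; clear -b4 n16R; lra|exists b].
have [r Ar] : exists r, #|A| = r.+2.
  have : #|~: A|%:R <= #|A|%:R :> R by lra.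
  by rewrite ler_nat Ab; case: #|A| => [|[|r]] // _; exists r.
have DE2 : D = r%:R - b%:R by rewrite DE Ar Ab -addn2 -[b.+2]addn2 !natrD; ring.
have br : (b <= r)%N by rewrite -(ler_nat R) -subr_ge0 -DE2.
pose N := (r + b).+3.
have nN : n = N.+1 by rewrite /n -(cardsC A) Ar Ab /N; clear; lia.
have NR : N%:R = n%:R - 1 :> R by rewrite nN -natr1 addrK.
have cN v : #|[set: V] :\ v| = N.
  by have := cardsD1 v [set: V]; rewrite cardsT in_setT -/n nN => -[].
have d0' : 0 < p * n%:R by rewrite -q2 exprn_gt0.
have atom r' b' j : (n <= 3 * (r' + b'))%N -> pmf p (signs r' b') j <= 3 / q.
  by move=> nrb; apply: pmf_signs_le => //; apply: leq_trans n16.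
have Q0 : 0 <= 3 / q by rewrite divr_ge0.
have bn : (n <= 6 * b)%N.
  rewrite -(ler_nat R) natrM; move: b4; rewrite Ab -[b.+2]addn2 natrD => b4; clear -b4 n16R; lra.
pose g := tail p r.+1 b.+1 1 + tail p r.+1 b.+1 0 - 1.
have gE : c1 * (q / s) <= g.
  apply: (@gap_lower _ _ p01 kappa K n r.+1 b.+1) => //.
  - by rewrite -q2 -[leLHS](expr1n R 2) lerXn2r ?nnegrE.
  - by rewrite nN /N; clear; lia.
  - by rewrite -!natr1 opprD addrACA subrr addr0 -DE2 kD DK.
pose Mr := r.+1%:R * tail p r b.+2 (-1) + b.+2%:R * tail p r.+1 b.+1 0.
pose Mb := r.+2%:R * tail p r.+1 b.+1 1 + b.+1%:R * tail p r.+2 b 2.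
pose kr := Num.truncn Mr; pose kb := Num.truncn Mb.
have Mr0 : 0 <= Mr by rewrite addr_ge0 // mulr_ge0 // tail_ge0.
have Mb0 : 0 <= Mb by rewrite addr_ge0 // mulr_ge0 // tail_ge0.
have /andP[kr1 kr2] : kr%:R <= Mr < kr%:R + 1 by rewrite natr1 truncn_le Mr0 truncnS_gt.
have /andP[kb1 kb2] : kb%:R <= Mb < kb%:R + 1 by rewrite natr1 truncn_le Mb0 truncnS_gt.
have krE v : v \in A -> mean_forced p A [set: V] v = kr.
  by move=> vA; rewrite /mean_forced (Ex_forced_red p Ar Ab vA).
have kbE v : v \notin A -> mean_forced p A [set: V] v = kb.
  by move=> vA; rewrite /mean_forced (Ex_forced_blue p Ar Ab vA).
have krN : (kr <= N)%N.
  have [v vA] : exists v, v \in A by apply/set0Pn; rewrite -card_gt0 Ar.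
  by rewrite -(krE v vA) -(cN v) mean_forced_le.
have kbN : (kb <= N)%N.
  have [v] : exists v, v \in ~: A by apply/set0Pn; rewrite -card_gt0 Ab.
  by rewrite inE => vA; rewrite -(kbE v vA) -(cN v) mean_forced_le.
pose B := Num.truncn (c1 / 8 * (q * s)).
have qs0 : 0 < q * s by rewrite mulr_gt0.
have cqs0 : 0 <= c1 / 8 * (q * s).
  by apply: mulr_ge0; [apply: divr_ge0 => //; exact: ltW|exact: ltW].
have B1 : B%:R <= c1 / 8 * (q * s) by rewrite truncn_le.
have c1q : 16 * (K + 2) <= c1 * q.
  have h : 16 * (K + 2) / c1 <= q by clear -q0q d01 C0 KC0; lra.
  by rewrite ler_pdivrMr // in h; rewrite (mulrC c1).
have c1qs : 16 * (K + 2) * s <= c1 * (q * s).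
  by rewrite mulrA ler_wpM2r.
have B2 : c1 / 16 * (q * s) <= B%:R.
  have : c1 / 8 * (q * s) < B%:R + 1 by rewrite natr1 truncnS_gt.
  have h3 : 0 <= K * s by rewrite mulr_ge0 // ltW.
  by clear -h3 c1qs s16; lra.
have NB : (N + B <= kr + kb)%N.
  have := forced_sum p01 br; rewrite -/N -/g -/Mr -/Mb -DE2 => hs.
  have h1 : n%:R / 4 * (c1 * (q / s)) <= b.+2%:R * g.
    apply: ler_pM => //; rewrite -?Ab //; first by rewrite divr_ge0 // ltW.
    by rewrite mulr_ge0 ?(ltW c10) // divr_ge0.
  have h2 : n%:R / 4 * (c1 * (q / s)) = c1 / 4 * (q * s).
    by rewrite -s2; field; rewrite gt_eqF.
  have h3 : 0 <= K * s by rewrite mulr_ge0 // ltW.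
  have h4 : N%:R + B%:R < kr%:R + kb%:R + 1 :> R.
    by clear -h1 h2 h3 hs kr2 kb2 B1 c1qs s16 DK; lra.
  by move: h4; rewrite -!natrD natr1 ltr_nat ltnS.
have ps : p * s <= C1.
  by rewrite -(ler_pM2r s0) -mulrA -expr2 s2 -q2.
have pN : p * N%:R <= q ^+ 2 by rewrite q2 ler_wpM2l // ler_nat nN.
pose X := N%:R * ((2 * p * (D + 2) + 3) * (3 / q)) + 2.
have hX : `|2 * kr%:R - N%:R| <= X.
  have hQ r' b' j : (b.*2 <= r' + b')%N -> pmf p (signs r' b') j <= 3 / q.
    by move=> h; apply: atom; move: bn h; rewrite -addnn; clear; lia.
  have := forced_near_half p01 br hQ; rewrite -/N -/Mr -DE2 /X.
  by rewrite !ler_norml => /andP[h1 h2]; clear -h1 h2 kr1 kr2; apply/andP; split; lra.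
have hC : p * (X + 2 * B%:R + 1) <= C * q.
  by apply: (@tie_budget C1 K c1 p q s D N%:R B%:R) => //; exact: ltW.
have tie j : (N - kr <= j < N - kr + B)%N -> cL / q <= pmf p (signs j (N - j.+1)) 0.
  move=> hj; apply: (@near_tie C (cL / q) p X n N kr B j) => //.
  - by rewrite -/q; clear -q0q d01 KC0 Kc0; lra.
  - move=> r' b' h1 h2 h3 h4; rewrite ler_pdivrMr // mulrC; apply: (HL n) => //.
    by rewrite -q2 expr2; apply: (@le_trans _ _ q); [clear -q0q C0 KC0 Kc0; lra|rewrite ler_peMl].
  - by case/andP: hj => _ hj; move: hj NB krN kbN; clear; lia.
have pair : 1 - 3 / q + p * (cL / q) * B%:R <= maj p N kr + maj p N kb.
  apply: maj_pair => //; apply: atom; rewrite subnKC //.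
  by move: nN n16; clear; lia.
have Pv v : maj p N (mean_forced p A [set: V] v) - 12 * (q / s) <=
    Pr (edge_pr p) (red2 A [set: V] v).
  have -> : 12 * (q / s) = 2 * p * (3 / q) * (2 * s).
    have -> : p = q ^+ 2 / s ^+ 2 by rewrite q2 s2 mulfK // gt_eqF.
    by field; rewrite !gt_eqF.
  rewrite -(cN v); apply: Ex_maj_ge => //; rewrite ?cN.
  - by move: nN n16; clear; lia.
  - by rewrite mulr_gt0.
  - by rewrite NR exprMn s2; clear -n0; lra.
  - by move=> r' b' j h; apply: atom; move: nN n16; rewrite -h; clear; lia.
rewrite Ex_sum.
have sumv : \sum_(v in [set: V]) (if v \in A then maj p N kr - 12 * (q / s)
    else maj p N kb - 12 * (q / s)) <= \sum_(v in [set: V]) Pr (edge_pr p) (red2 A [set: V] v).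
  apply: ler_sum => v _; apply: le_trans (Pv v).
  by case: ifPn => vA; rewrite ?(krE v vA) ?(kbE v vA).
apply: le_trans sumv.
rewrite (@sum_two_values V R _ A _ (maj p N kr - 12 * (q / s)) (maj p N kb - 12 * (q / s))) //.
rewrite setTI setTD.
set mr := maj p N kr in pair *; set mb := maj p N kb in pair *.
have mr0 : 0 <= mr by exact: maj_ge0.
have Y2 : cL * c1 / 64 * (q ^+ 2 * s) <= n%:R / 4 * (p * (cL / q) * B%:R).
  have -> : cL * c1 / 64 * (q ^+ 2 * s) = n%:R / 4 * (p * (cL / q) * (c1 / 16 * (q * s))).
    by rewrite q2; field; rewrite gt_eqF.
  by rewrite !ler_wpM2l // ?divr_ge0 // mulr_ge0 // divr_ge0 // ltW.
have Y0 : 0 <= p * (cL / q) * B%:R by rewrite mulr_ge0 // mulr_ge0 // divr_ge0 // ltW.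
clear HL Pv atom tie krE kbE hX hC NB cN gE X.
set b2 := #|~: A|%:R in AV b4 DE *; set r2 := #|A|%:R in AV DE *.
have h1 : b2 * (1 - 3 / q + p * (cL / q) * B%:R) <= b2 * (mr + mb) by rewrite ler_wpM2l.
have h2 : n%:R / 4 * (p * (cL / q) * B%:R) <= b2 * (p * (cL / q) * B%:R) by rewrite ler_wpM2r.
have h3 : b2 * (3 / q) <= n%:R * (3 / q) by rewrite ler_wpM2r //; clear -AV D0 DE b4 n0; lra.
have h4 : 0 <= D * mr by rewrite mulr_ge0.
have h5 : n%:R * (q / s) = q * s by rewrite -s2; field; rewrite gt_eqF.
have h6 : s ^+ 2 / q * 3 = n%:R * (3 / q) by rewrite s2; field; rewrite gt_eqF.
have -> : r2 * (mr - 12 * (q / s)) + b2 * (mb - 12 * (q / s)) =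
    b2 * (mr + mb) + D * mr - 12 * (n%:R * (q / s)) by rewrite -AV DE; ring.
rewrite h5 s2 in h6 *.
move: h1; rewrite mulrDr mulrBr mulr1 => h1.
clear -h1 h2 h3 h4 h6 Y2 AV DE DK D0 b4; lra.
Qed.

End DayTwoMean.

(** * Surplus after the second day *)

Section DayTwoSurplus.
Context (R : realType).

Lemma variance_budget (p q s : R) : 1 <= q -> 1 <= s -> p * s ^+ 2 = q ^+ 2 ->
  s ^+ 2 + s ^+ 2 ^+ 2 * (4 * (p + s ^+ 2 * (p ^+ 2 * (3 / q))) +
    (2 * p * (3 / q)) ^+ 2 * (3 * s ^+ 2 + 1)) <= 161 * (s ^+ 2 * q ^+ 3).
Proof.
move=> q1 s1 ps.
have q0 : 0 < q by lra.
have s0 : 0 < s by lra.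
have -> : p = q ^+ 2 / s ^+ 2 by rewrite -ps mulfK // gt_eqF // exprn_gt0.
have -> : s ^+ 2 + s ^+ 2 ^+ 2 * (4 * (q ^+ 2 / s ^+ 2 + s ^+ 2 * ((q ^+ 2 / s ^+ 2) ^+ 2 * (3 / q))) +
    (2 * (q ^+ 2 / s ^+ 2) * (3 / q)) ^+ 2 * (3 * s ^+ 2 + 1)) =
  s ^+ 2 * (1 + 4 * q ^+ 2 + 12 * q ^+ 3 + 108 * q ^+ 2) + 36 * q ^+ 2.
  by field; rewrite !gt_eqF.
have s21 : 1 <= s ^+ 2 by rewrite exprn_ege1.
have q21 : 1 <= q ^+ 2 by rewrite exprn_ege1.
have q23 : q ^+ 2 <= q ^+ 3 by rewrite [leRHS]exprS ler_peMl //; lra.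
have h1 : q ^+ 2 <= s ^+ 2 * q ^+ 3.
  by apply: (le_trans q23); rewrite ler_peMl //; lra.
have h2 : s ^+ 2 * q ^+ 2 <= s ^+ 2 * q ^+ 3 by rewrite ler_wpM2l //; lra.
have h3 : s ^+ 2 <= s ^+ 2 * q ^+ 3 by rewrite ler_peMr //; lra.
lra.
Qed.

(** Chebyshev's inequality for the number of [red2] vertices: its mean exceeds
    [n / 2] by the order of [q ^ 2 s], and its variance is at most
    [161 n q ^ 3], which is smaller than the square of that gain by a factor of
    order [q]. *)
Lemma day_two (kappa K C1 eps : R) : 0 < kappa -> 0 < K -> 0 < C1 -> 0 < eps ->
  exists c q0 C2 : R, [/\ 0 < c, 16 <= q0, 0 < C2 &
  forall (V : finType) (p : R) (A : {set V}), 0 <= p <= 1 ->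
    let q := Num.sqrt (p * #|V|%:R) in let s := Num.sqrt #|V|%:R in
    q0 <= q -> q ^+ 2 <= C1 * s -> C2 * s <= q ^+ 3 ->
    kappa * s <= #|A|%:R - #|~: A|%:R <= K * s ->
    Pr (edge_pr p) (fun E => #|day E (day E A)|%:R <=
      #|V|%:R / 2 + c * (q ^+ 2 * s)) <= eps].
Proof.
move=> k0 K0 C10 e0; have [c [q00 [c0 q016 H]]] := day_two_mean k0 K0 C10.
have ce0 : 0 < c ^+ 2 * eps by rewrite mulr_gt0 ?exprn_gt0.
pose X1 := 6 * K / c; pose X2 := 72 / c; pose X3 := 2576 / (c ^+ 2 * eps).
have X10 : 0 < X1 by rewrite divr_gt0 ?mulr_gt0.
have X20 : 0 < X2 by rewrite divr_gt0.
have X30 : 0 < X3 by rewrite divr_gt0.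
(* Half of the gain [c q ^ 2 s] pays for the three error terms of the mean,
   through [X1], [X2] and [18 / c]; a quarter of it is the distance for
   Chebyshev's inequality, whose cost is made small by [X3]. The term [2 C1]
   forces [p <= 1 / 2]. *)
exists (c / 4), (q00 + 2 * C1 + X1 + X2 + X3), (18 / c); split.
- exact: divr_gt0.
- lra.
- exact: divr_gt0.
move=> V p A p01 q s q0q qC1 qC2 sD.
have q1 : 1 <= q by lra.
have [n0 s2 q2 s0 qs] := sqrt_scales p01 q1.
rewrite -/q -/s in s2 q2 s0 qs.
have q0 : 0 < q by clear -q1; lra.
have s1 : 1 <= s by clear -q1 qs; lra.
have ps : p * s <= C1 by rewrite -(ler_pM2r s0) -mulrA -expr2 s2 -q2.
have p12 : 0 <= p <= 1 / 2.
  case/andP: (p01) => p0 _; rewrite p0 /=.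
  have h1 : p * (2 * C1) <= p * s by rewrite ler_wpM2l //; clear -q0q q016 C10 X10 X20 X30 qs; lra.
  by rewrite -(ler_pM2r C10); clear -h1 ps; lra.
have cq1 : 6 * K <= c * q.
  by rewrite (mulrC c q) -ler_pdivrMr // -/X1; clear -q0q C10 X20 X30 q016; lra.
have cq2 : 72 <= c * q.
  by rewrite (mulrC c q) -ler_pdivrMr // -/X2; clear -q0q C10 X10 X30 q016; lra.
have cq3 : 2576 <= q * (c ^+ 2 * eps).
  by rewrite -ler_pdivrMr // -/X3; clear -q0q C10 X10 X20 q016; lra.
pose S E : R := \sum_(v in [set: V]) (red2 A [set: V] v E)%:R.
have mean : s ^+ 2 / 2 + c / 2 * (q ^+ 2 * s) <= Ex (edge_pr p) S.
  have q00q : q00 <= q by clear -q0q C10 X10 X20 X30; lra.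
  apply: le_trans (H V p A p12 q00q qC1 sD).
  have h1 : 6 * K * s <= c * q * q * s.
    have h : 6 * K <= c * q * q by apply: (le_trans cq1); rewrite ler_peMr //; clear -cq1 K0; lra.
    by rewrite ler_wpM2r // ltW.
  have h2 : 72 * (q * s) <= c * q * (q * s) by rewrite ler_wpM2r //; apply: mulr_ge0; exact: ltW.
  have h3 : 18 * (s ^+ 2 / q) <= c * q ^+ 2 * s.
    rewrite mulrA ler_pdivrMr //.
    have h : 18 * s <= c * q ^+ 3 by move: qC2; rewrite mulrAC ler_pdivrMr // [q ^+ 3 * c]mulrC.
    have : 18 * s * s <= c * q ^+ 3 * s by rewrite ler_wpM2r // ltW.
    by clear; lra.
  by rewrite -/q -/s; clear -h1 h2 h3; lra.
have n256 : 256 <= #|V|%:R :> R.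
  have h : 16 <= s by clear -q0q q016 C10 X10 X20 X30 qs; lra.
  by rewrite -s2 expr2; clear -h; nra.
have var : variance (edge_pr p) S <= 161 * (s ^+ 2 * q ^+ 3).
  apply: le_trans (variance_budget q1 s1 _); last by rewrite s2 q2.
  rewrite s2; apply: variance_red2 => //.
  - by rewrite divr_ge0 // ltW.
  - by rewrite -(ler_nat R); clear -n256; lra.
  - have V16 : (16 <= #|V|)%N by rewrite -(ler_nat R); clear -n256; lra.
    move=> r b j h; apply: pmf_signs_le => //.
    + by rewrite -q2 exprn_gt0.
    + exact: leq_trans V16.
    + by move: h V16; clear; lia.
have qs0 : 0 < c / 4 * (q ^+ 2 * s).
  by apply: mulr_gt0; [exact: divr_gt0|apply: mulr_gt0 => //; exact: exprn_gt0].
have cond : s ^+ 2 / 2 + c / 4 * (q ^+ 2 * s) + c / 4 * (q ^+ 2 * s) <= Ex (edge_pr p) S.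
  by clear -mean; lra.
have h := chebyshev_lower (@edge_pr01 V R p p01) qs0 cond.
have {h}h := le_trans h var.
apply: (@le_trans _ _ (Pr (edge_pr p) (fun E => S E <= s ^+ 2 / 2 + c / 4 * (q ^+ 2 * s)))).
  apply: le_Pr (@edge_pr01 V R p p01) _ _ _ => E; rewrite s2; apply: le_trans.
  rewrite /S -sum1_card natr_sum [leRHS]big_mkcond [leLHS]big_mkcond /=; apply: ler_sum => v _.
  rewrite in_setT; case: ifP => [_|vd]; first by rewrite lern1 leq_b1.
  by case: (boolP (red2 A [set: V] v E)) => [/red2_day|_]; rewrite ?vd ?lexx.
have t2 : (c / 4 * (q ^+ 2 * s)) ^+ 2 = c ^+ 2 * q / 16 * (s ^+ 2 * q ^+ 3) by field.
rewrite t2 in h.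
have sq0 : 0 < s ^+ 2 * q ^+ 3 by apply: mulr_gt0; exact: exprn_gt0.
set P := Pr _ _ in h *.
have {}h : P * (c ^+ 2 * q / 16) <= 161 by rewrite -(ler_pM2r sq0); clear -h; lra.
have cq0 : 0 < c ^+ 2 * q by apply: mulr_gt0 => //; exact: exprn_gt0.
rewrite -(ler_pM2r cq0); clear -h cq3; lra.
Qed.

End DayTwoSurplus.

(** * Large deviations for blocked vertices *)

Lemma expR_le_quad (R : realType) (x : R) : x <= 1 / 2 -> expR x <= 1 + x + 2 * x ^+ 2.
Proof.
move=> x2; have e0 : 0 < 1 - x by lra.
have h : 1 - x <= expR (- x) by have := expR_ge1Dx (- x); lra.
have e1 : expR x * expR (- x) = 1 by exact: expRxMexpNx_1.
have h1 : expR x * (1 - x) <= 1 by rewrite -[leRHS]e1 ler_wpM2l ?expR_ge0.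
rewrite -(ler_pM2r e0); apply: (le_trans h1).
have := sqr_ge0 x; have : 0 <= x ^+ 2 * (1 - 2 * x) by rewrite mulr_ge0 ?sqr_ge0; lra.
nra.
Qed.

Section Blocked.
Context (V : finType) (R : realType) (p : R).
Hypothesis p01 : 0 <= p <= 1.
Implicit Types (A T : {set V}) (u t : V) (e : {set V}) (E : {set {set V}}).
Local Notation n := (#|V|%:R : R).

(** The vertices that do not see a strict red majority. Ties are included, so
    that membership does not depend on the vertex's own color. *)
Definition blocked A E : {set V} :=
  [set u | star A ([set: V] :\ u) u E <= 0].

Lemma day_blocked A E : ~: day E A \subset blocked A E.
Proof. by apply/subsetP => u; rewrite inE => /notin_day; rewrite inE. Qed.

Definition surplus A : R := #|A|%:R - #|~: A|%:R.

(** The coefficient of the edge [e] in the total surplus seen from [T]. *)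
Definition coef A T e : R :=
  \sum_(u in T) \sum_(t in [set: V] :\ u) (sg A t)%:~R * ([set u; t] == e)%:R.

Lemma sum_star A T E :
  (\sum_(u in T) star A ([set: V] :\ u) u E)%:~R = \sum_e coef A T e * (e \in E)%:R.
Proof.
rewrite raddf_sum /= /coef; under [RHS]eq_bigr do rewrite mulr_suml.
rewrite exchange_big /=; apply: eq_bigr => u _.
rewrite /star raddf_sum /=; under [RHS]eq_bigr do rewrite mulr_suml.
rewrite exchange_big /=; apply: eq_bigr => t _.
rewrite (bigD1 [set u; t]) //= eqxx mulr1 big1 ?addr0 => [|e /negbTE ne].
  by case: (_ \in E); rewrite ?mulr1n ?mulr0n ?mulr1 ?mulr0.
by rewrite eq_sym ne mulr0 mul0r.
Qed.

Lemma sum_sg A : \sum_(t in [set: V]) (sg A t)%:~R = surplus A.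
Proof.
rewrite (big_setID A) /= setTI setTD /surplus; congr (_ + _).
  rewrite (eq_bigr (fun=> 1)) ?sumr_const // => t tA.
  by rewrite /sg tA.
rewrite (eq_bigr (fun=> -1)) ?sumr_const ?mulNrn // => t.
by rewrite inE /sg => /negbTE ->.
Qed.

Lemma norm_sg A t : `|(sg A t)%:~R : R| = 1.
Proof. by rewrite /sg; case: ifP; rewrite ?normr1 // mulrN1z normrN normr1. Qed.

Lemma sum_coef A T : #|T|%:R * (surplus A - 1) <= \sum_e coef A T e.
Proof.
rewrite /coef exchange_big /= mulr_natl -sumr_const; apply: ler_sum => u _.
rewrite exchange_big /=.
rewrite (eq_bigr (fun t => (sg A t)%:~R)) => [|t _].
  rewrite -sum_sg (big_setD1 u) ?in_setT //=.
  by have := ler_norm ((sg A u)%:~R : R); rewrite norm_sg; lra.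
rewrite (bigD1 [set u; t]) //= eqxx mulr1 big1 ?addr0 // => e /negbTE ne.
by rewrite eq_sym ne mulr0.
Qed.

Lemma coef_notpair A T e : e \notin vpairs V -> coef A T e = 0.
Proof.
move=> ev; rewrite /coef big1 // => u _; rewrite big1 // => t; rewrite !inE andbT => tu.
case: eqP => [h|_]; last by rewrite mulr0.
by move: ev; rewrite -h inE cards2 (eq_sym u) tu.
Qed.

(** Each edge is seen from at most two vertices. *)
Lemma norm_coef_le A T e : `|coef A T e| <= 2 /\
  `|coef A T e| <= \sum_(u in T) \sum_(t in [set: V] :\ u) ([set u; t] == e)%:R.
Proof.
pose f u : R := \sum_(t in [set: V] :\ u) ([set u; t] == e)%:R.
have le : `|coef A T e| <= \sum_(u in T) f u.
  apply: le_trans (ler_norm_sum _ _ _) _; apply: ler_sum => u _.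
  apply: le_trans (ler_norm_sum _ _ _) _; apply: ler_sum => t _.
  by rewrite normrM norm_sg mul1r ger0_norm.
split=> //.
have [ev|ev] := boolP (e \in vpairs V); last by rewrite coef_notpair // normr0.
have e2 : #|e| = 2 by apply/eqP; move: ev; rewrite inE.
apply: (le_trans le); apply: (@le_trans _ _ (\sum_u (u \in e)%:R)); last first.
  have -> : \sum_u (u \in e)%:R = #|e|%:R :> R.
    by rewrite -sum1_card natr_sum [RHS]big_mkcond /=; apply: eq_bigr => u _; case: (u \in e).
  by rewrite e2.
rewrite big_mkcond /=; apply: ler_sum => u _; case: ifP => // _.
have [ue|ue] := boolP (u \in e); last first.
  rewrite /f big1 // => t _; case: eqP => // h.
  by move: ue; rewrite -h !inE eqxx.
have /cards1P[w ew] : #|e :\ u| == 1%N by have := cardsD1 u e; rewrite e2 ue add1n => -[<-].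
have wu : w != u by have := set11 w; rewrite -ew !inE => /andP[].
rewrite /f (bigD1 w) ?inE ?wu //= big1 ?addr0 ?lern1 ?leq_b1 // => t /andP[].
rewrite !inE andbT => tu tw; case: eqP => // h.
have : t \in e :\ u by rewrite -h !inE tu eqxx orbT.
by rewrite ew inE (negbTE tw).
Qed.

Lemma sum_coef_sqr A T : \sum_e coef A T e ^+ 2 <= 2 * (n * #|T|%:R).
Proof.
apply: (@le_trans _ _ (\sum_e 2 * \sum_(u in T) \sum_(t in [set: V] :\ u) ([set u; t] == e)%:R)).
  apply: ler_sum => e _; have [h1 h2] := norm_coef_le A T e.
  rewrite -real_normK ?num_real // expr2; apply: ler_pM => //.
rewrite -mulr_sumr ler_wpM2l // exchange_big /= mulr_natr -sumr_const; apply: ler_sum => u _.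
rewrite exchange_big /= -[leRHS]mulr1; apply: (@le_trans _ _ (\sum_(t in [set: V] :\ u) 1)).
  apply: ler_sum => t _; rewrite (bigD1 [set u; t]) //= eqxx big1 ?addr0 // => e /negbTE ne.
  by rewrite eq_sym ne.
by rewrite sumr_const mulr1 ler_nat max_card.
Qed.

(** Bernstein's inequality for the total surplus seen from [T], which is not
    positive if all of [T] is blocked; an edge inside [T] is counted twice,
    which only costs a factor in the variance. *)
Lemma blocked_bound A T : 1 <= surplus A ->
  Pr (edge_pr p) (fun E => T \subset blocked A E) <=
  expR (- (p * #|T|%:R * (surplus A - 1) ^+ 2 / (16 * n))).
Proof.
case/andP: (p01) => p0 p1; move=> s1.
have An : surplus A <= n.
  have -> : n = #|A|%:R + #|~: A|%:R by rewrite -natrD cardsC.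
  by rewrite lerD2l lerNl (le_trans _ (ler0n _ _)) // oppr_le0.
have n0 : 0 < n by lra.
pose l := (surplus A - 1) / (8 * n).
have l0 : 0 <= l by rewrite divr_ge0 ?subr_ge0 // mulr_ge0.
have l4 : l <= 1 / 8 by rewrite /l ler_pdivrMr ?mulr_gt0 //; lra.
pose x e := - l * coef A T e.
have step E : (T \subset blocked A E)%:R <= \prod_e (if e \in E then expR (x e) else 1).
  have -> : \prod_e (if e \in E then expR (x e) else 1) =
      expR (- l * (\sum_(u in T) star A ([set: V] :\ u) u E)%:~R).
    rewrite sum_star mulr_sumr expR_sum; apply: eq_bigr => e _.
    by case: (e \in E); rewrite ?mulr1 ?mulr0 ?expR0.
  have [TB|_] := boolP (T \subset _); last exact: expR_ge0.
  apply: le_trans (expR_ge1Dx _); rewrite lerDl mulNr oppr_ge0 mulr_ge0_le0 //.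
  rewrite lerz0; apply: sumr_le0 => u uT.
  by move/subsetP: TB => /(_ u uT); rewrite inE.
apply: le_trans (le_Ex (edge_pr01 p01) step) _.
rewrite (Ex_prod (edge_pr p) (fun e => expR (x e)) (fun=> 1)).
apply: (@le_trans _ _ (\prod_e expR (p * (x e + 2 * x e ^+ 2)))).
  apply: ler_prod => e _; have /andP[e0 e1] := edge_pr01 p01 e.
  apply/andP; split.
    by rewrite addr_ge0 ?mulr_ge0 ?expR_ge0 ?subr_ge0.
  have [ev|ev] := boolP (e \in vpairs V); last first.
    rewrite /edge_pr (negbTE ev) mul0r add0r subr0 mulr1 -[leLHS]expR0 ler_expR.
    by rewrite /x coef_notpair // mulr0 expr0n /= mulr0 addr0 mulr0.
  rewrite /edge_pr ev mulr1; apply: le_trans (expR_ge1Dx _).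
  have x2 : x e <= 1 / 2.
    have [h1 _] := norm_coef_le A T e; apply: (le_trans (ler_norm _)).
    rewrite /x normrM normrN (ger0_norm l0).
    have : l * `|coef A T e| <= 1 / 8 * 2 by rewrite ler_pM.
    lra.
  have := ler_wpM2l p0 (expR_le_quad x2); lra.
rewrite -expR_sum ler_expR -mulr_sumr big_split /=.
have -> : \sum_e x e = - l * \sum_e coef A T e by rewrite mulr_sumr.
have -> : \sum_e 2 * x e ^+ 2 = 2 * l ^+ 2 * \sum_e coef A T e ^+ 2.
  by rewrite mulr_sumr; apply: eq_bigr => e _; rewrite /x; ring.
have h1 := ler_wpM2l l0 (sum_coef A T).
have h2 : 2 * l ^+ 2 * \sum_e coef A T e ^+ 2 <= 2 * l ^+ 2 * (2 * (n * #|T|%:R)).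
  by rewrite ler_wpM2l ?sum_coef_sqr // mulr_ge0 ?sqr_ge0.
have -> : - (p * #|T|%:R * (surplus A - 1) ^+ 2 / (16 * n)) =
    p * (- (l * (#|T|%:R * (surplus A - 1))) + 2 * l ^+ 2 * (2 * (n * #|T|%:R))).
  by rewrite /l; field; rewrite gt_eqF.
rewrite ler_wpM2l //; clear -h1 h2; lra.
Qed.

End Blocked.

(** * Expansion and contraction of the blue set *)

Section Expansion.
Context (V : finType) (R : realType) (p : R).
Hypothesis p01 : 0 <= p <= 1.
Implicit Types (A T : {set V}) (E : {set {set V}}).
Local Notation n := (#|V|%:R : R).

Lemma Pr_blocked_exists (Q : {set V} -> {set V} -> bool) :
  Pr (edge_pr p) (fun E => [exists A, Q A (blocked A E)]) <=
  \sum_(x : {set V} * {set V} | Q x.1 x.2)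
    Pr (edge_pr p) (fun E => x.2 \subset blocked x.1 E).
Proof.
apply: le_trans (Pr_exists (edge_pr01 p01) _ _).
apply: (le_Pr (edge_pr01 p01)) => E /existsP[A QA]; apply/existsP.
by exists (A, blocked A E); rewrite QA /=.
Qed.

(** For a coloring and a set of blocked vertices as described, [blocked_bound]
    is at most [expR (- 3 n)]; this pays for the union bound over the [4 ^ n]
    pairs of a coloring and a set. *)
Lemma big_step (s0 t0 : R) : 0 <= s0 -> 0 <= t0 -> 0 < n ->
  48 * n ^+ 2 <= p * t0 * s0 ^+ 2 ->
  Pr (edge_pr p) (fun E => [exists A, (s0 + 1 <= surplus R A) && (t0 <= #|blocked A E|%:R)])
    <= expR (- n).
Proof.
case/andP: (p01) => p0 _; move=> s00 t00 n0 h.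
apply: le_trans (Pr_blocked_exists (fun A T => (s0 + 1 <= surplus R A) && (t0 <= #|T|%:R))) _.
apply: (@le_trans _ _ (\sum_(x : {set V} * {set V}) expR (- (3 * n)))).
  rewrite big_mkcond /=; apply: ler_sum => -[A T] _ /=.
  case: ifP => [/andP[sA tT]|_]; last exact: expR_ge0.
  apply: le_trans (blocked_bound p01 T _) _; first by lra.
  rewrite ler_expR lerN2 ler_pdivlMr ?mulr_gt0 //.
  have h1 : s0 ^+ 2 <= (surplus R A - 1) ^+ 2 by rewrite lerXn2r ?nnegrE //; lra.
  have h2 : p * t0 * s0 ^+ 2 <= p * #|T|%:R * (surplus R A - 1) ^+ 2.
    by rewrite ler_pM ?mulr_ge0 ?sqr_ge0 // ler_wpM2l.
  apply: le_trans h2; apply: le_trans h; rewrite expr2; lra.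
have two : (2 ^ #|V|)%:R <= expR n.
  have h1 : (2 : R) <= expR 1 by have := expR_ge1Dx (1 : R); lra.
  by rewrite natrX -[n]mulr1 expRM_natl lerXn2r ?nnegrE ?expR_ge0.
have card2 : #|{: {set V}}| = (2 ^ #|V|)%N.
  rewrite -[X in (2 ^ X)%N]cardsT -card_powerset -cardsT; apply: eq_card => A.
  by rewrite !inE subsetT.
rewrite sumr_const card_prod card2 -[leLHS]mulr_natl natrM.
have -> : - n = n + n + - (3 * n) by ring.
by rewrite !expRD ler_wpM2r ?expR_ge0 // ler_pM.
Qed.

Lemma sum_pow_card (y : R) : \sum_(T : {set V}) y ^+ #|T| = (1 + y) ^+ #|V|.
Proof.
rewrite -[in RHS]cardsT -prodr_const addrC (eq_bigl xpredT) => [|i]; last by rewrite in_setT.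
rewrite bigA_distr; apply: eq_bigr => T _.
by rewrite -prodr_const [LHS]big_mkcond.
Qed.

Lemma sum_pow_card_nonempty (y : R) :
  \sum_(T : {set V} | T != set0) y ^+ #|T| = (1 + y) ^+ #|V| - 1.
Proof. by rewrite -sum_pow_card [in RHS](bigD1 set0) //= cards0 expr0 [RHS]addrC addKr. Qed.

(** The union bound charges [n ^ -2] to every blue and to every blocked vertex,
    so that the sum over pairs of nonempty sets is of order [n ^ -2]. By
    [blocked_bound] each blocked vertex costs a factor [expR (- n p / 64)], and
    there are enough of them to pay for the blue ones as well. *)
Lemma small_step : (8 <= #|V|)%N -> 256 * ln n <= p * n ->
  Pr (edge_pr p) (fun E => [exists A, [&& A != [set: V], (8 * #|~: A| <= #|V|)%N &
    256 * ln n * #|~: A|%:R <= p * n * #|blocked A E|%:R]]) <= 9 / n.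
Proof.
move=> V8 lnp; have n8 : 8 <= n by rewrite ler_nat.
have n0 : 0 < n by lra.
have ln0 : 0 < ln n by rewrite ln_gt0 //; lra.
case/andP: (p01) => p0 _.
apply: le_trans (Pr_blocked_exists (fun A T => [&& A != [set: V], (8 * #|~: A| <= #|V|)%N &
  256 * ln n * #|~: A|%:R <= p * n * #|T|%:R])) _.
pose y : R := (n ^+ 2)^-1.
have yE : y = expR (- (2 * ln n)).
  by rewrite /y expRN expRM_natl lnK ?posrE.
have y0 : 0 <= y by rewrite invr_ge0 sqr_ge0.
apply: (@le_trans _ _ (\sum_(x : {set V} * {set V} | (x.1 != [set: V]) && (x.2 != set0))
    y ^+ #|~: x.1| * y ^+ #|x.2|)).
  rewrite big_mkcond [leRHS]big_mkcond /=; apply: ler_sum => -[A T] _ /=.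
  case: ifP => [/and3P[AT A8 hT]|_]; last first.
    by case: ifP => // _; rewrite mulr_ge0 ?exprn_ge0.
  have B0 : (0 < #|~: A|)%N.
    by rewrite card_gt0; apply: contra AT => /eqP hA; rewrite -[A]setCK hA setC0.
  have b1 : 1 <= #|~: A|%:R :> R by rewrite ler1n.
  have T0 : T != set0.
    apply: contraTneq hT => ->; rewrite cards0 mulr0 -ltNge mulr_gt0 ?mulr_gt0 //.
    by rewrite ltr0n.
  rewrite AT T0 /=.
  have b8 : 8 * #|~: A|%:R <= n by rewrite -natrM ler_nat.
  have sE : surplus R A = n - 2 * #|~: A|%:R.
    have : #|A|%:R + #|~: A|%:R = n by rewrite -natrD cardsC.
    by rewrite /surplus; clear; lra.
  apply: le_trans (blocked_bound p01 T _) _; first by rewrite sE; lra.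
  rewrite yE -!expRM_natl -expRD ler_expR !mulrN -opprD lerN2.
  apply: (@le_trans _ _ (p * n * #|T|%:R / 64)).
    have h1 : 256 * ln n * #|T|%:R <= p * n * #|T|%:R by rewrite ler_wpM2r.
    by move: hT h1; clear; lra.
  have hs : (n / 2) ^+ 2 <= (surplus R A - 1) ^+ 2.
    by rewrite lerXn2r ?nnegrE ?sE //; lra.
  have hp : 0 <= p * #|T|%:R by rewrite mulr_ge0.
  rewrite ler_pdivlMr ?mulr_gt0 //.
  have := ler_wpM2l hp hs.
  have -> : p * #|T|%:R * (n / 2) ^+ 2 = p * n * #|T|%:R / 64 * (16 * n) by field.
  by [].
rewrite -(pair_big (fun A => A != [set: V]) (fun T => T != set0)
  (fun A T => y ^+ #|~: A| * y ^+ #|T|)) /=.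
under eq_bigr do rewrite -mulr_sumr sum_pow_card_nonempty.
rewrite -mulr_suml (reindex_inj (@setC_inj V)) /=.
have -> : \sum_(A : {set V} | ~: A != [set: V]) y ^+ #|~: ~: A| = (1 + y) ^+ #|V| - 1.
  rewrite -sum_pow_card_nonempty; apply: eq_big => [A|A _]; last by rewrite setCK.
  by rewrite -setC0 (inj_eq (@setC_inj V)).
have small : 0 <= (1 + y) ^+ #|V| - 1 <= 3 / n.
  have h1 : 1 <= (1 + y) ^+ #|V| by rewrite exprn_ege1 // lerDl.
  have h2 : (1 + y) ^+ #|V| <= expR (n * y).
    by rewrite expRM_natl lerXn2r ?nnegrE ?expR_ge0 ?addr_ge0 // expR_ge1Dx.
  have ny : n * y = n^-1 by rewrite /y; field; rewrite gt_eqF.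
  have n2 : n^-1 <= 1 / 2 by rewrite -[leLHS]mul1r ler_pdivrMr //; lra.
  have h3 := expR_le_quad n2.
  have h4 : n^-1 ^+ 2 <= n^-1 * (1 / 2) by rewrite expr2 ler_wpM2l ?invr_ge0 // ltW.
  apply/andP; split; first by rewrite subr_ge0.
  have h5 : 0 <= n^-1 by rewrite invr_ge0 ltW.
  by move: h2; rewrite ny => h2; clear -h2 h3 h4 h5; lra.
case/andP: small => m0 m3; apply: (le_trans (ler_pM m0 m0 m3 m3)).
have -> : 3 / n * (3 / n) = 9 / n * n^-1 by field; rewrite gt_eqF.
apply: ler_piMr; first by apply: divr_ge0 => //; exact: ltW.
by rewrite invf_le1 //; clear -n8; lra.
Qed.

Lemma day_setT E : day E [set: V] = [set: V].
Proof.
apply/setP => u; rewrite !inE /hold in_setT; apply: sumr_ge0 => t _.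
by rewrite /sg in_setT; case: (_ \in E).
Qed.

(** After [k] days fewer than one blue vertex is left. *)
Lemma contraction (E : {set {set V}}) (rho : R) (k : nat) A : 0 <= rho <= 1 ->
  (forall B, B != [set: V] -> (8 * #|~: B| <= #|V|)%N -> #|~: day E B|%:R <= rho * #|~: B|%:R) ->
  (8 * #|~: A| <= #|V|)%N -> rho ^+ k * n < 1 -> iter k (day E) A = [set: V].
Proof.
move=> /andP[r0 r1] H A8 hk.
have step B : (8 * #|~: B| <= #|V|)%N -> #|~: day E B|%:R <= rho * #|~: B|%:R.
  move=> B8; have [->|BT] := eqVneq B [set: V]; last exact: H.
  by rewrite day_setT setCT cards0 mulr0.
have inv i : #|~: iter i (day E) A|%:R <= rho ^+ i * n /\ (8 * #|~: iter i (day E) A| <= #|V|)%N.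
  elim: i => [|i [IH1 IH2]]; first by rewrite expr0 mul1r ler_nat max_card.
  rewrite iterS; set B := iter i (day E) A in IH1 IH2 *.
  have hB := step B IH2; split.
    by apply: (le_trans hB); rewrite exprS -mulrA ler_wpM2l.
  have : #|~: day E B|%:R <= #|~: B|%:R :> R by apply: (le_trans hB); rewrite ler_piMl.
  by rewrite ler_nat => h; apply: leq_trans IH2; rewrite leq_mul2l h orbT.
have [h _] := inv k; have := le_lt_trans h hk.
rewrite -[1]/(1%:R) ltr_nat ltnS leqn0 cards_eq0 => /eqP h0.
by rewrite -[LHS]setCK h0 setC0.
Qed.

End Expansion.

(** * The density hypothesis and the last seven days *)

Section FixedColoring.
Context (R : realType).

Lemma ln2_ge_half : 1 / 2 <= ln 2 :> R.
Proof.
have h : 1 / 2 <= 1 - expR (- ln 2) :> R.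
  by rewrite expRN lnK ?posrE //; lra.
by have := expR_ge1Dx (- ln 2 : R); lra.
Qed.

Lemma ln_sqr_le (x : R) : 0 < x -> 1 <= x -> ln x ^+ 2 <= 4 * x.
Proof.
move=> x0 x1; set s := Num.sqrt x.
have s0 : 0 < s by rewrite sqrtr_gt0.
have xs : x = s ^+ 2 by rewrite sqr_sqrtr // ltW.
have l0 : 0 <= ln x by exact: ln_ge0.
have ls : ln x <= 2 * s.
  by rewrite xs lnXn // -[leLHS]mulr_natl ler_wpM2l // ltW // ln_sublinear.
have := ler_pM l0 l0 ls ls; rewrite -expr2 => /le_trans; apply.
by rewrite xs; clear; nra.
Qed.

(** The consequences of the density hypothesis [C ^ 3 n (ln n) ^ 2 <= d ^ 3]:
    the scales [q] and [q ^ 3 / s] are as large as required, and six factors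
    [256 ln n / d] together are smaller than [1 / n]. *)
Lemma density_regime (Y d : R) (n : nat) (q := Num.sqrt d) (s := Num.sqrt n%:R) :
  1 <= Y -> (2 <= n)%N -> 0 <= d <= n%:R ->
  (4 * Y ^+ 6 + 512) ^+ 3 * n%:R * ln n%:R ^+ 2 <= d ^+ 3 ->
  [/\ Y <= q, Y * s <= q ^+ 3, Y <= n%:R :> R, 256 * ln n%:R <= d &
      (256 * ln n%:R / d) ^+ 6 * n%:R < 1].
Proof.
move=> Y1 n2 /andP[d0 dn]; set C := 4 * Y ^+ 6 + 512; set L := ln n%:R => h.
have n2R : 2 <= n%:R :> R by rewrite ler_nat.
have n0 : 0 < n%:R :> R by lra.
have L2 : 1 / 2 <= L by apply: le_trans ln2_ge_half _; rewrite ler_ln ?posrE.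
have L0 : 0 < L by lra.
have Y6 : 1 <= Y ^+ 6 by rewrite exprn_ege1.
have C512 : 512 <= C by rewrite /C; lra.
have C0 : 0 < C by lra.
have C3 : C <= C ^+ 3 by rewrite exprS ler_peMr ?exprn_ege1 //; lra.
have s2 : s ^+ 2 = n%:R by rewrite sqr_sqrtr // ltW.
have s0 : 0 < s by rewrite sqrtr_gt0.
have q2 : q ^+ 2 = d by rewrite sqr_sqrtr.
have q0 : 0 <= q by exact: sqrtr_ge0.
have qs : q <= s by rewrite ler_wsqrtr.
have s1 : 1 <= s by rewrite -(sqrtr1 R) ler_wsqrtr //; lra.
have L4 : 1 / 4 <= L ^+ 2.
  by have := ler_pM (divr_ge0 ler01 (ler0n R 2)) (divr_ge0 ler01 (ler0n R 2)) L2 L2; rewrite -expr2; lra.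
have h1 : Y ^+ 6 * n%:R <= d ^+ 3.
  apply: le_trans h; rewrite [leRHS]mulrAC ler_wpM2r //.
  have : 4 * Y ^+ 6 * (1 / 4) <= C ^+ 3 * L ^+ 2.
    apply: ler_pM => //; [by clear -Y6; lra|by clear; lra|].
    by apply: le_trans C3; rewrite /C lerDl.
  by clear; lra.
have Y0 : 0 <= Y by lra.
have Y3 : Y ^+ 3 * s <= q ^+ 3.
  rewrite -(ler_pXn2r (_ : 0 < 2)%N) ?nnegrE ?mulr_ge0 ?exprn_ge0 ?(ltW s0) //.
  by rewrite exprMn -!exprM s2 (mulnC 3 2)%N [q ^+ (2 * 3)]exprM q2.
have YY3 : Y <= Y ^+ 3 by rewrite exprS ler_peMr // exprn_ege1.
have Yq : Y <= q.
  rewrite -(ler_pXn2r (_ : 0 < 3)%N) ?nnegrE //; apply: le_trans Y3.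
  by rewrite ler_peMr // exprn_ge0.
have CL : C * L <= d.
  have Ln : L <= n%:R by rewrite ltW // ln_sublinear.
  rewrite -(ler_pXn2r (_ : 0 < 3)%N) ?nnegrE ?mulr_ge0 ?(ltW C0) ?(ltW L0) //.
  apply: le_trans h; rewrite exprMn -mulrA ler_wpM2l ?exprn_ge0 ?(ltW C0) //.
  by rewrite exprS ler_wpM2r ?sqr_ge0.
have CLp : 0 < C * L by rewrite mulr_gt0.
have dp : 0 < d by lra.
split=> //.
- by apply: le_trans Y3; rewrite ler_wpM2r // ltW.
- by rewrite -s2 (le_trans Yq) // (le_trans qs) // expr2 ler_peMr // ltW.
- by apply: le_trans CL; rewrite ler_wpM2r // ?(ltW L0) //; lra.
have r3 : (256 * L / d) ^+ 3 <= L / (8 * n%:R).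
  rewrite expr_div_n ler_pdivrMr ?exprn_gt0 // mulrAC ler_pdivlMr ?mulr_gt0 //.
  have h2 : L * ((512 : R) ^+ 3 * n%:R * L ^+ 2) <= L * d ^+ 3.
    rewrite ler_wpM2l ?(ltW L0) //; apply: le_trans h.
    by rewrite !ler_wpM2r ?sqr_ge0 ?(ltW n0) // lerXn2r ?nnegrE //; clear -C512; lra.
  by apply: le_trans h2; rewrite exprMn; clear -L0 n0; nra.
have Ln2 : L ^+ 2 <= 4 * n%:R by apply: ln_sqr_le => //; lra.
have r0 : 0 <= (256 * L / d) ^+ 3 by rewrite exprn_ge0 // divr_ge0 ?mulr_ge0 ?(ltW L0).
have h6 : (256 * L / d) ^+ 6 <= (L / (8 * n%:R)) ^+ 2.
  by rewrite [leLHS](exprM _ 3 2) lerXn2r ?nnegrE // (le_trans r0).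
apply: (@le_lt_trans _ _ ((L / (8 * n%:R)) ^+ 2 * n%:R)); first by rewrite ler_wpM2r // ltW.
have -> : (L / (8 * n%:R)) ^+ 2 * n%:R = L ^+ 2 / (64 * n%:R) by field; rewrite gt_eqF.
by rewrite ltr_pdivrMr ?mulr_gt0 //; lra.
Qed.

(** Without the configurations of [small_step], the blue set shrinks on each of
    the last six days by the factor [256 L / d]. *)
Lemma finish (V : finType) (p : R) (E : {set {set V}}) (A : {set V}) (L := ln #|V|%:R)
    (d := p * #|V|%:R) : 0 < d -> 256 * L <= d -> 0 <= L ->
  (256 * L / d) ^+ 6 * #|V|%:R < 1 ->
  ~~ [exists A, [&& A != [set: V], (8 * #|~: A| <= #|V|)%N &
    256 * ln #|V|%:R * #|~: A|%:R <= p * #|V|%:R * #|blocked A E|%:R]] ->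
  (8 * #|~: A| <= #|V|)%N -> iter 6 (day E) A = [set: V].
Proof.
move=> d0 dL L0 r6; rewrite negb_exists => /forallP none A8.
apply: (@contraction V R E (256 * L / d)) => //.
  apply/andP; split; last by rewrite ler_pdivrMr // mul1r.
  by apply: divr_ge0; [exact: mulr_ge0|exact: ltW].
move=> B BT B8; have := none B; rewrite BT B8 /= -ltNge => hB.
apply: (@le_trans _ _ #|blocked B E|%:R).
  by rewrite ler_nat subset_leq_card // day_blocked.
by rewrite mulrAC ler_pdivlMr // mulrC ltW.
Qed.

(** Once the surplus on some day is of order [s0], the next day leaves at most
    [n / 8] blue vertices and the last six days finish. *)
Lemma win_from (V : finType) (p s0 : R) (A : {set V}) (E : {set {set V}}) :
  let n := #|V|%:R : R in let d := p * n in
  0 < d -> 256 * ln n <= d -> 0 <= ln n -> (256 * ln n / d) ^+ 6 * n < 1 ->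
  ~~ [exists A, [&& A != [set: V], (8 * #|~: A| <= #|V|)%N &
    256 * ln n * #|~: A|%:R <= p * n * #|blocked A E|%:R]] ->
  ~~ [exists A, (s0 + 1 <= surplus R A) && (n / 8 <= #|blocked A E|%:R)] ->
  s0 + 1 <= surplus R A -> iter 7 (day E) A = [set: V].
Proof.
move=> n d d0 dL L0 r6 bad2; rewrite negb_exists => /forallP none sA.
rewrite iterSr; apply: (finish d0 dL L0 r6 bad2) => /=.
have := none A; rewrite sA /= -ltNge => h.
have h2 : #|~: day E A|%:R <= #|blocked A E|%:R :> R.
  by rewrite ler_nat subset_leq_card // day_blocked.
by rewrite -(ler_nat R) natrM; clear -h h2; rewrite -/n; lra.
Qed.

Lemma surplusE (V : finType) (A : {set V}) : surplus R A = 2 * #|A|%:R - #|V|%:R.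
Proof.
have : #|A|%:R + #|~: A|%:R = #|V|%:R :> R by rewrite -natrD cardsC.
by rewrite /surplus; clear; lra.
Qed.

End FixedColoring.

(** * A fixed coloring *)

Section RedWins.
Context (R : realType).

(** If [q ^ 2] is at most of the order of [s], that is, if [p] is at most of
    the order of [n ^ (-1/2)], the growth takes two days, otherwise one. In
    both cases it leads to a surplus that is a large multiple of [n / q], which
    is what [big_step] needs. *)
Lemma red_wins (kappa K eps : R) : 0 < kappa -> 0 < K -> 0 < eps ->
  exists C : R, 0 < C /\
  forall (V : finType) (p : R) (A : {set V}), 0 <= p <= 1 -> (2 <= #|V|)%N ->
    C ^+ 3 * #|V|%:R * ln #|V|%:R ^+ 2 <= (p * #|V|%:R) ^+ 3 ->
    kappa * Num.sqrt #|V|%:R <= surplus R A <= K * Num.sqrt #|V|%:R ->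
    Pr (edge_pr p) (fun E => ~~ [exists t : 'I_10, iter t (day E) A == [set: V]]) <= eps.
Proof.
move=> k0 K0 e0; have e40 : 0 < eps / 4 by rewrite divr_gt0.
have [c [d0 [c0 d01 H1]]] := day_one k0 K0 e40.
have C10 : 0 < 20 / c by rewrite divr_gt0.
have [c' [q0 [C2 [c'0 q016 C20 H2]]]] := day_two k0 K0 C10 e40.
have ci0 : 0 < 20 / c' by rewrite divr_gt0.
have ei0 : 0 < 40 / eps by rewrite divr_gt0.
pose Y := 16 + d0 + q0 + C2 + 20 / c + 20 / c' + 40 / eps.
have Y16 : 16 <= Y by rewrite /Y; lra.
exists (4 * Y ^+ 6 + 512); split; first by rewrite ltr_wpDl // mulr_ge0 // exprn_ge0; lra.
move=> V p A p01 V2 hd sA; set n := #|V|%:R in hd sA *.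
pose d := p * n; pose q := Num.sqrt d; pose s := Num.sqrt n.
case/andP: (p01) => p0 p1.
have nR0 : 0 < n by rewrite ltr0n; apply: leq_trans V2.
have dn : 0 <= d <= n by rewrite mulr_ge0 // ler_piMl.
have Y1 : 1 <= Y by clear -Y16; lra.
have [Yq Ysq Yn dL r6] := @density_regime R Y d #|V| Y1 V2 dn hd.
rewrite -/n -/q -/s in Yq Ysq Yn dL r6.
have [Yd Yq0 YC2] : [/\ d0 <= Y, q0 <= Y & C2 <= Y].
  by split; rewrite /Y; clear -d01 q016 C20 C10 ci0 ei0; lra.
have [Yc Yc' Ye] : [/\ 20 / c <= Y, 20 / c' <= Y & 40 / eps <= Y].
  by split; rewrite /Y; clear -d01 q016 C20 C10 ci0 ei0; lra.
clearbody Y.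
have q16 : 16 <= q by clear -Y16 Yq; lra.
have n16 : 16 <= n by clear -Y16 Yn; lra.
have q2 : q ^+ 2 = d by rewrite sqr_sqrtr //; case/andP: dn.
have s2 : s ^+ 2 = n by rewrite sqr_sqrtr // ltW.
have s0 : 0 < s by rewrite sqrtr_gt0.
have s1 : 1 <= s by rewrite -(sqrtr1 R) ler_wsqrtr //; clear -n16; lra.
have qd : q <= d by rewrite -q2 expr2 ler_peMr //; clear -q16; lra.
have dp : 0 < d by clear -q16 qd; lra.
have L0 : 0 <= ln n by rewrite ln_ge0 //; clear -n16; lra.
have n8 : (8 <= #|V|)%N by rewrite -(ler_nat R); clear -n16; rewrite -/n; lra.
have en : 40 <= n * eps by rewrite -ler_pdivrMr //; clear -Ye Yn; lra.
have tail1 : expR (- n) <= eps / 4.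
  rewrite expRN -[leLHS]mul1r ler_pdivrMr ?expR_gt0 //.
  have h1 := expR_ge1Dx n.
  have h2 : eps / 4 * n <= eps / 4 * expR n by rewrite ler_wpM2l ?(ltW e40) //; clear -h1; lra.
  by clear -h2 en; lra.
have tail2 : 9 / n <= eps / 4 by rewrite ler_pdivrMr //; clear -en; lra.
pose bad2 E := [exists A, [&& A != [set: V], (8 * #|~: A| <= #|V|)%N &
    256 * ln n * #|~: A|%:R <= p * n * #|blocked A E|%:R]].
have Pbad2 : Pr (edge_pr p) bad2 <= eps / 4.
  by apply: le_trans tail2; exact: small_step.
pose bad1 (x : R) (E : {set {set V}}) :=
  [exists A, (x + 1 <= surplus R A) && (n / 8 <= #|blocked A E|%:R)].
have Pbad1 x : 0 <= x -> 48 * n ^+ 2 <= p * (n / 8) * x ^+ 2 -> Pr (edge_pr p) (bad1 x) <= eps / 4.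
  move=> x0 hx; apply: le_trans tail1; apply: big_step => //.
  by rewrite divr_ge0 // ltW.
have combine (early : {set {set V}} -> bool) x (j : nat) : (j <= 2)%N ->
    0 <= x -> 48 * n ^+ 2 <= p * (n / 8) * x ^+ 2 -> Pr (edge_pr p) early <= eps / 4 ->
    (forall E, ~~ early E -> x + 1 <= surplus R (iter j (day E) A)) ->
    Pr (edge_pr p) (fun E => ~~ [exists t : 'I_10, iter t (day E) A == [set: V]]) <= eps.
  move=> j2 x0 hx hearly hsur.
  apply: (@le_trans _ _ (Pr (edge_pr p) (fun E => early E || (bad1 x E || bad2 E)))).
    apply: (le_Pr (edge_pr01 p01)) => E; apply: contraR; rewrite !negb_or => /and3P[h1 h2 h3].
    have j10 : (7 + j < 10)%N by rewrite ltnS; move: j2; clear; lia.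
    apply/existsP; exists (Ordinal j10); apply/eqP; rewrite [nat_of_ord _]/= iterD.
    exact: (win_from dp dL L0 r6 h3 h2 (hsur E h1)).
  apply: le_trans (Pr_or (edge_pr01 p01) _ _) _.
  have h4 := Pr_or (edge_pr01 p01) (bad1 x) bad2.
  have h5 := Pbad1 x x0 hx.
  by clear -h4 h5 hearly Pbad2 e0; lra.
have sur E i y : ~~ (#|iter i (day E) A|%:R <= n / 2 + y) -> 1 <= y ->
    y + 1 <= surplus R (iter i (day E) A).
  by rewrite -ltNge surplusE -/n; clear; lra.
have [qs|qs] := leP (q ^+ 2) (20 / c * s).
  pose y := c' * (q ^+ 2 * s).
  have hY : 20 <= c' * q.
    by rewrite (mulrC c') -ler_pdivrMr //; clear -Yc' Yq; lra.
  have qs20 : 20 <= c' * q * (q * s).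
    by rewrite -[leLHS]mulr1; apply: ler_pM => //; rewrite -[leLHS]mulr1; apply: ler_pM => //; clear -q16; lra.
  have y1 : 1 <= y by rewrite /y; clear -qs20; lra.
  apply: (combine (fun E => #|day E (day E A)|%:R <= n / 2 + y) y 2%N) => //.
  - by clear -y1; lra.
  - have h : 20 * s <= c' * q ^+ 3.
      rewrite (mulrC c') -ler_pdivrMr // mulrAC; apply: le_trans Ysq.
      by rewrite ler_wpM2r // ltW.
    have h20 : 0 <= 20 * s by rewrite mulr_ge0 // ltW.
    have h' := ler_pM h20 h20 h h.
    have -> : p * (n / 8) = q ^+ 2 / 8 by rewrite q2 /d mulrA.
    rewrite -s2 /y; clear -h' s0.
    have h1 : 400 * s ^+ 2 * s ^+ 2 <= (c' * q ^+ 3) ^+ 2 * s ^+ 2.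
      by rewrite ler_wpM2r ?sqr_ge0 //; lra.
    have := sqr_ge0 (s ^+ 2); lra.
  - by apply: H2 => //; [clear -Yq0 Yq; rewrite -/n -/d -/q; lra|rewrite -/n -/d -/q -/s; apply: le_trans Ysq; rewrite ler_wpM2r // ltW].
  - by move=> E hE; apply: sur.
pose y := c * (q * s).
have h : 20 * s <= c * q ^+ 2.
  by rewrite (mulrC c) -ler_pdivrMr // mulrAC ltW.
have hY : 20 <= c * q.
  by rewrite (mulrC c) -ler_pdivrMr //; clear -Yc Yq; lra.
have y1 : 1 <= y.
  rewrite /y mulrA; apply: (@le_trans _ _ (20 * 1)); first by clear; lra.
  by apply: ler_pM.
apply: (combine (fun E => #|day E A|%:R <= n / 2 + y) y 1%N) => //.
- by clear -y1; lra.
- have h20 : 0 <= 20 * s by rewrite mulr_ge0 // ltW.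
  have h' := ler_pM h20 h20 h h.
  have -> : p * (n / 8) = q ^+ 2 / 8 by rewrite q2 /d mulrA.
  rewrite -s2 /y; clear -h' s0.
  have h1 : 400 * s ^+ 2 * s ^+ 2 <= (c * q ^+ 2) ^+ 2 * s ^+ 2.
    by rewrite ler_wpM2r ?sqr_ge0 //; lra.
  have := sqr_ge0 (s ^+ 2); lra.
- by apply: H1 => //; rewrite -/n -/d; clear -Yd Yq qd; lra.
- by move=> E hE; apply: sur.
Qed.

End RedWins.

(** * The random coloring and the conclusion *)

Section Coloring.
Context (R : realType) (V : finType).
Implicit Types (A : {set V}).
Local Notation n := (#|V|%:R : R).

Definition coin : V -> R := fun=> 1 / 2.

Lemma coin01 v : 0 <= coin v <= 1.
Proof. by rewrite /coin; apply/andP; split; lra. Qed.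

Lemma law_coin (g : int -> R) : Ex coin (fun A => g #|A|%:Z) = law (1 / 2) (nseq #|V| 1) g.
Proof.
have -> : nseq #|V| (1 : int) = [seq 1 | k <- enum V].
  by rewrite cardE; elim: (enum V) => //= x s ->.
rewrite -(@Ex_law R V coin (1 / 2) V (enum V) id (fun=> 1) g) ?map_id ?enum_uniq //.
apply: eq_Ex => A; congr g; rewrite -sum1_card -natz natr_sum big_mkcond /= -big_enum /=.
by apply: eq_bigr => k _; case: (k \in A).
Qed.

(** The number of red vertices lies in an interval of length of order
    [kappa s], and by [pmf_sqr_le] no value has probability more than [3 / s]. *)
Lemma surplus_small (kappa : R) : 0 <= kappa <= 1 -> 4 <= n ->
  Pr coin (fun A => `|surplus R A| < kappa * Num.sqrt n) <= 3 * kappa + 6 / Num.sqrt n.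
Proof.
move=> /andP[k0 k1] n4; set s := Num.sqrt n.
have n0 : 0 < n by lra.
have s0 : 0 < s by rewrite sqrtr_gt0.
have s2 : s ^+ 2 = n by rewrite sqr_sqrtr // ltW.
have s1 : 1 <= s by rewrite -(sqrtr1 R) ler_wsqrtr //; lra.
pose a := Num.truncn (n / 2 - kappa * s / 2); pose N := (Num.truncn (kappa * s)).+2.
have ks0 : 0 <= kappa * s by rewrite mulr_ge0 // ltW.
have ks : kappa * s <= n.
  rewrite -s2 expr2; apply: ler_wpM2r; [exact: ltW|exact: le_trans s1].
have a1 : a%:R <= n / 2 - kappa * s / 2 by rewrite truncn_le; lra.
have a2 : n / 2 - kappa * s / 2 < a%:R + 1 by rewrite natr1 truncnS_gt.
have N1 : kappa * s + 1 < N%:R by rewrite /N -natr1 ltrD2r truncnS_gt.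
have N2 : N%:R <= kappa * s + 2.
  by rewrite /N -[leLHS]natr1 -[X in X + 1 <= _]natr1 -addrA lerD // truncn_le.
have cover A : `|surplus R A| < kappa * s -> [exists i : 'I_N, #|A|%:Z == (a + i)%N%:Z].
  rewrite surplusE ltr_norml => /andP[h1 h2].
  have aA : (a <= #|A|)%N by rewrite -(ler_nat R); lra.
  have AN : (#|A| - a < N)%N.
    rewrite -(ltr_nat R) natrB //; lra.
  by apply/existsP; exists (Ordinal AN) => /=; rewrite subnKC.
apply: le_trans (le_Pr coin01 cover) _.
apply: le_trans (Pr_exists coin01 (fun _ : 'I_N => true) (fun i A => #|A|%:Z == (a + i)%N%:Z)) _.
have s3 : 0 <= 3 / s by rewrite divr_ge0 // ltW.
apply: (@le_trans _ _ (\sum_(i < N) 3 / s)).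
  apply: ler_sum => i _; rewrite /Pr (law_coin (fun j => (j == (a + i)%N%:Z)%:R)) -/(pmf _ _ _).
  have h01 : 0 <= (1 / 2 : R) <= 1 by apply/andP; split; lra.
  have hs : all is_sign (nseq #|V| 1) by rewrite all_nseq /is_sign eqxx orbT.
  have := pmf_sqr_le h01 (a + i)%N%:Z hs; rewrite size_nseq.
  set x := pmf _ _ _ => hx.
  have x0 : 0 <= x by exact: pmf_ge0.
  rewrite ler_pdivlMr // -(ler_pXn2r (_ : 0 < 2)%N) ?nnegrE ?mulr_ge0 ?(ltW s0) //.
  rewrite exprMn s2.
  have nm : n <= 4 * #|V|./2%:R.
    have : (4 <= #|V|)%N by rewrite -(ler_nat R).
    by rewrite -natrM ler_nat; clear; lia.
  have : x ^+ 2 * n <= x ^+ 2 * (4 * #|V|./2%:R) by rewrite ler_wpM2l ?sqr_ge0.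
  by clear -hx; lra.
rewrite sumr_const card_ord -[leLHS]mulr_natl.
apply: (@le_trans _ _ ((kappa * s + 2) * (3 / s))); first by rewrite ler_wpM2r.
rewrite le_eqVlt; apply/orP; left; apply/eqP; field; by rewrite gt_eqF.
Qed.

(** Chebyshev's inequality: the surplus has mean [0] and variance [n]. *)
Lemma surplus_large (K : R) : 0 < K -> 0 < n ->
  Pr coin (fun A => K * Num.sqrt n < `|surplus R A|) <= (K ^+ 2)^-1.
Proof.
move=> K0 n0; set s := Num.sqrt n.
have s0 : 0 < s by rewrite sqrtr_gt0.
have s2 : s ^+ 2 = n by rewrite sqr_sqrtr // ltW.
have var : Ex coin (fun A => surplus R A ^+ 2) = n.
  rewrite (@eq_Ex _ _ _ _ (fun A => (2 * #|A|%:Z%:~R - n) ^+ 2)); last by move=> A; rewrite surplusE.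
  rewrite (law_coin (fun k => (2 * k%:~R - n) ^+ 2)).
  rewrite (@eq_law _ _ _ _ (fun k => 4 * k%:~R ^+ 2 - 4 * n * k%:~R + n ^+ 2)); last by move=> k; ring.
  rewrite lawD lawB !lawZ law_cst law_sqr law_mean !big_nseq !iter_addr_0 mulr1z expr1n.
  by field.
have h : Pr coin (fun A => K * s < `|surplus R A|) * (K ^+ 2 * n) <= n.
  rewrite -[leRHS]var /Pr -ExZr; apply: (le_Ex coin01) => A.
  have [hA|_] := ltP (K * s) `|surplus R A|; last by rewrite mul0r sqr_ge0.
  rewrite mul1r -s2 -exprMn -[leRHS]real_normK ?num_real //.
  by rewrite lerXn2r ?nnegrE ?mulr_ge0 ?(ltW K0) ?(ltW s0) // ltW.
have Kn : 0 < K ^+ 2 * n by rewrite mulr_gt0 ?exprn_gt0.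
rewrite -(ler_pM2r Kn); apply: (le_trans h).
by rewrite mulrA mulVf ?mul1r // gt_eqF // exprn_gt0.
Qed.

End Coloring.

Section Translation.
Context (R : realType) (V : finType) (p : R).

Lemma gnp_massE (G : sgraph V) : gnp_mass p G = mass (edge_pr p) (val G).
Proof.
rewrite /gnp_mass /mass big_mkcond /=; apply: eq_bigr => e _; rewrite /edge_pr.
case: ifP => // ev; have := subsetP (valP G) e; rewrite ev.
by case: (e \in val G) => [/(_ isT)//|_]; rewrite subr0.
Qed.

(** Edge sets that are not graphs have mass [0]. *)
Lemma sum_gnp (f : {set {set V}} -> R) :
  \sum_(G : sgraph V) gnp_mass p G * f (val G) = Ex (edge_pr p) f.
Proof.
rewrite /Ex (bigID (fun E : {set {set V}} => E \subset vpairs V)) /= [X in _ = _ + X]big1 ?addr0.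
  rewrite (reindex_omap (val : sgraph V -> {set {set V}}) insub) /=.
    by apply: eq_big => [G|G _]; rewrite ?valK ?eqxx ?(valP G) // gnp_massE.
  by move=> E EV; rewrite insubT.
move=> E /subsetPn[e eE ev]; rewrite /mass (bigD1 e) //= eE.
by rewrite {1}/edge_pr (negbTE ev) !mul0r.
Qed.

Lemma half_massE (A : {set V}) : half_coloring_mass R A = mass (@coin R V) A.
Proof. by apply: eq_bigr => v _; rewrite /coin; case: ifP => _; field. Qed.

(** A win of blue is written as a win of red from the complementary coloring,
    by the symmetry of the dynamics. *)
Definition larger_wins (E : {set {set V}}) (A : {set V}) (T : nat) : bool :=
  ((#|~: A| < #|A|)%N && [exists t : 'I_T.+1, iter t (day E) A == [set: V]]) ||
  ((#|A| < #|~: A|)%N && [exists t : 'I_T.+1, iter t (day E) (~: A) == [set: V]]).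

Lemma larger_winsE (G : sgraph V) A T :
  larger_side_wins_within G A T = larger_wins (val G) A T.
Proof.
have E t B : iter t (majority_step G) B = iter t (day (val G)) B.
  by elim: t => // t IH; rewrite !iterS IH majority_stepE.
have C t : ~: iter t (day (val G)) A = iter t (day (val G)) (~: A).
  by elim: t => // t IH; rewrite !iterS -IH day_compl.
rewrite /larger_side_wins_within /larger_wins /red_wins_within /blue_wins_within /red_on_day.
by congr (_ && _ || _ && _); apply: eq_existsb => t; rewrite E ?C.
Qed.

Lemma Pr_gnp_halfE T : Pr_gnp_half p (fun (G : sgraph V) A => larger_side_wins_within G A T) =
  Ex (@coin R V) (fun A => Pr (edge_pr p) (fun E => larger_wins E A T)).
Proof.
rewrite /Pr_gnp_half big_mkcond /=.
rewrite -(pair_bigA _ (fun (G : sgraph V) (A : {set V}) =>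
  if larger_side_wins_within G A T then gnp_mass p G * half_coloring_mass R A else 0)) /=.
rewrite exchange_big /=; apply: eq_bigr => A _.
rewrite /Pr -sum_gnp mulr_sumr; apply: eq_bigr => G _.
by rewrite -larger_winsE half_massE; case: ifP => _; rewrite ?mulr1 ?mulr0 // mulrC.
Qed.

End Translation.

(** Cubing removes the fractional powers. *)
Lemma density (R : realType) (C p : R) (n : nat) : 0 < C -> (2 <= n)%N -> 0 <= p ->
  C * n%:R `^ (- (2%:R / 3%:R)) * ln n%:R `^ (2%:R / 3%:R) <= p ->
  C ^+ 3 * n%:R * ln n%:R ^+ 2 <= (p * n%:R) ^+ 3.
Proof.
move=> C0 n2 p0 h; have n0 : 0 < n%:R :> R by rewrite ltr0n; apply: leq_trans n2.
have L0 : 0 <= ln n%:R :> R by rewrite ln_ge0 // ler1n; apply: leq_trans n2.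
have cube (x r : R) : 0 <= x -> (x `^ r) ^+ 3 = x `^ (r * 3).
  by move=> x0; rewrite powRrM powR_mulrn ?powR_ge0.
have h3 : (C * n%:R `^ (- (2%:R / 3%:R)) * ln n%:R `^ (2%:R / 3%:R)) ^+ 3 <= p ^+ 3.
  by rewrite lerXn2r ?nnegrE // !mulr_ge0 ?powR_ge0 // ltW.
move: h3; rewrite !exprMn !cube ?(ltW n0) //.
have -> : - (2%:R / 3%:R) * 3 = - 2%:R :> R by field.
have -> : 2%:R / 3%:R * 3 = 2%:R :> R by field.
rewrite powRN ?powR_mulrn ?(ltW n0) //.
move=> h3; have n3 : 0 <= n%:R ^+ 3 :> R by rewrite exprn_ge0 // ltW.
apply: le_trans (ler_wpM2r n3 h3).
rewrite le_eqVlt; apply/orP; left; apply/eqP; field.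
by rewrite gt_eqF.
Qed.

Lemma log_base_ge1 (R : realType) (p : R) (n : nat) : 1 < p * n%:R -> p <= 1 ->
  1 <= log_base (p * n%:R) n%:R.
Proof.
move=> d1 p1; have n0 : 0 <= n%:R :> R by [].
rewrite /log_base ler_pdivlMr ?ln_gt0 // mul1r ler_ln ?posrE ?(lt_trans ltr01) //.
  by rewrite ler_piMl.
by apply: (lt_le_trans d1); rewrite ler_piMl.
Qed.

(** For a single vertex the density hypothesis is void, since [ln 1 = 0], but
    then the larger side holds all vertices on day [0]. *)
Lemma larger_wins_single (V : finType) (E : {set {set V}}) (A : {set V}) T :
  #|V| = 1%N -> larger_wins E A T.
Proof.
move=> V1; have := cardsC A; rewrite V1 /larger_wins.
have full (B : {set V}) : #|B| = 1%N -> B = [set: V].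
  by move=> B1; apply/eqP; rewrite eqEcard subsetT cardsT V1 B1.
have win0 (B : {set V}) : #|B| = 1%N -> [exists t : 'I_T.+1, iter t (day E) B == [set: V]].
  by move=> /full ->; apply/existsP; exists ord0.
case: (posnP #|A|) => [-> Ac|A0 Ac].
  by rewrite add0n in Ac; rewrite Ac (win0 _ Ac) orbT.
have [A1 Ac0] : #|A| = 1%N /\ #|~: A| = 0%N by clear -A0 Ac; lia.
by rewrite A1 Ac0 (win0 _ A1).
Qed.

Theorem corollary1p5 (R : realType) :
  exists K : R, 0 < K /\
  forall eps : R, 0 < eps ->
  exists C : R, 0 < C /\
  forall (n : nat) (V : finType) (p : R),
    (0 < n)%N -> #|V| = n ->
    0 <= p <= 1 ->
    C * n%:R `^ (- (2%:R / 3%:R)) * ln n%:R `^ (2%:R / 3%:R) <= p ->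
    1 - eps <=
    Pr_gnp_half p (fun (G : sgraph V) (R0 : {set V}) =>
      larger_side_wins_within G R0 (Num.truncn (K * log_base (p * n%:R) n%:R))).
Proof.
(* Nine days: at most two of growth, one of expansion and six of contraction. *)
exists 9; split=> // eps eps0.
pose e := Num.min eps 1.
have e0 : 0 < e by rewrite lt_min eps0 ltr01.
have ee : e <= eps by rewrite ge_min lexx.
have e1 : e <= 1 by rewrite ge_min lexx orbT.
have k0 : 0 < e / 24 by rewrite divr_gt0.
have e4 : 0 < 4 / e by rewrite divr_gt0.
have K0 : 0 < 1 + 4 / e by rewrite addr_gt0.
have e2 : 0 < e / 2 by rewrite divr_gt0.
have [C0 [C00 H]] := red_wins k0 K0 e2.
pose X := (48 / e) ^+ 2 + 4; have X4 : 4 <= X by rewrite lerDr sqr_ge0.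
have X2 := sqr_ge0 X.
(* With this [C] the number of vertices is at least [X], so that
   [6 / s <= e / 8] below: a surplus below [e / 24 * s] has probability at most
   [e / 8 + e / 8], one above [(1 + 4 / e) * s] at most [e / 8], and the
   dynamics fails for a given coloring with probability at most [e / 2]. *)
exists (C0 + 4 * X ^+ 2 + 1); set C := C0 + _ + _.
have C1 : 1 <= C by rewrite /C; clear -C00 X2; lra.
have Cp : 0 < C by clear -C1; lra.
split=> // n V p n0 Vn p01 hp; case/andP: (p01) => p0 p1.
set T := Num.truncn _; rewrite Pr_gnp_halfE.
have [n1|n2] := leqP n 1.
  have V1 : #|V| = 1%N by rewrite Vn; apply/eqP; rewrite eqn_leq n1 n0.
  apply: (@le_trans _ _ 1); first by clear -eps0; lra.
  apply: (Ex_ge (@coin01 R V)) => A; apply: (Ex_ge (edge_pr01 p01)) => E.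
  by rewrite larger_wins_single.
have hd := density Cp n2 p0 hp.
have nR : 2 <= n%:R :> R by rewrite ler_nat.
have dn : p * n%:R <= n%:R by rewrite ler_piMl.
have d0 : 0 <= p * n%:R by rewrite mulr_ge0.
have L2 : 1 / 2 <= ln n%:R :> R.
  by apply: le_trans (ln2_ge_half R) _; rewrite ler_ln ?posrE //; clear -nR; lra.
have L4 : 1 / 4 <= ln n%:R ^+ 2 :> R by clear -L2; nra.
have C3 : C <= C ^+ 3 by rewrite exprS ler_peMr ?exprn_ege1 //; clear -C1; lra.
have big : X ^+ 2 * n%:R <= (p * n%:R) ^+ 3.
  apply: le_trans hd; rewrite [leRHS]mulrAC ler_wpM2r //.
  have : (4 * X ^+ 2) * (1 / 4) <= C ^+ 3 * ln n%:R ^+ 2.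
    apply: (ler_pM _ _ _ L4); [by rewrite mulr_ge0|by clear; lra|].
    by apply: le_trans C3; rewrite /C; clear -C00; lra.
  by clear; lra.
have d1 : 1 < p * n%:R.
  rewrite -(ltr_pXn2r (_ : 0 < 3)%N) ?nnegrE // expr1n; apply: lt_le_trans big.
  by clear -X4 nR; nra.
have nX : X <= n%:R.
  have n3 : (p * n%:R) ^+ 3 <= n%:R ^+ 3 by rewrite lerXn2r ?nnegrE.
  have : X ^+ 2 * n%:R <= n%:R ^+ 2 * n%:R by apply: (le_trans big); rewrite -exprSr.
  rewrite ler_pM2r; last by clear -nR; lra.
  by rewrite ler_pXn2r ?nnegrE //; clear -X4; lra.
have T9 : (9 <= T)%N.
  have := log_base_ge1 d1 p1 => hl.
  by rewrite /T truncn_ge_nat; clear -hl; lra.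
have hd0 : C0 ^+ 3 * #|V|%:R * ln #|V|%:R ^+ 2 <= (p * #|V|%:R) ^+ 3.
  rewrite Vn; apply: le_trans hd; rewrite !ler_wpM2r ?sqr_ge0 //.
  by rewrite lerXn2r ?nnegrE ?(ltW C00) ?(ltW Cp) // /C; clear -X2; lra.
have V2 : (2 <= #|V|)%N by rewrite Vn.
set s := Num.sqrt (#|V|%:R : R).
have good A : e / 24 * s <= surplus R A <= (1 + 4 / e) * s ->
    1 - e / 2 <= Pr (edge_pr p) (fun E => [exists t : 'I_T.+1, iter t (day E) A == [set: V]]).
  move=> hA; have := H V p A p01 V2 hd0 hA; rewrite Pr_not => h.
  apply: (@le_trans _ _ (Pr (edge_pr p) (fun E => [exists t : 'I_10, iter t (day E) A == [set: V]]))).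
    by clear -h; lra.
  apply: (le_Pr (edge_pr01 p01)) => E /existsP[t ht]; apply/existsP.
  by exists (widen_ord (T9 : 10 <= T.+1)%N t).
have s48 : 48 / e <= s.
  rewrite -(ler_pXn2r (_ : 0 < 2)%N) ?nnegrE ?sqrtr_ge0 ?divr_ge0 ?(ltW e0) //.
  rewrite sqr_sqrtr // Vn; apply: le_trans nX; by rewrite lerDl.
have s0 : 0 < s by apply: lt_le_trans s48; rewrite divr_gt0.
have ks0 : 0 < e / 24 * s by rewrite mulr_gt0.
pose ok (A : {set V}) := ~~ (`|surplus R A| < e / 24 * s) && ~~ ((1 + 4 / e) * s < `|surplus R A|).
have okP A : ok A -> 1 - e / 2 <= Pr (edge_pr p) (fun E => larger_wins E A T).
  rewrite /ok -!leNgt => /andP[lo hi].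
  have [sA|sA] := leP 0 (surplus R A).
    rewrite (ger0_norm sA) in lo hi.
    apply: le_trans (good A _) _; first by rewrite lo hi.
    apply: (le_Pr (edge_pr01 p01)) => E hE; rewrite /larger_wins hE andbT.
    by rewrite -(ltr_nat R) -subr_gt0 -/(surplus R A) (lt_le_trans ks0 lo).
  rewrite (ltr0_norm sA) in lo hi.
  have sC : surplus R (~: A) = - surplus R A by rewrite /surplus setCK opprB.
  apply: le_trans (good (~: A) _) _; first by rewrite sC lo hi.
  apply: (le_Pr (edge_pr01 p01)) => E hE; rewrite /larger_wins hE andbT.
  apply/orP; right; rewrite -(ltr_nat R) -subr_gt0 -opprB -/(surplus R A).
  exact: lt_le_trans ks0 lo.
have n4 : 4 <= #|V|%:R :> R by rewrite Vn; clear -nX X4; lra.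
have k01 : 0 <= e / 24 <= 1 by apply/andP; split; clear -e0 e1; lra.
have Psmall := @surplus_small R V (e / 24) k01 n4.
have n00 : 0 < #|V|%:R :> R by clear -n4; lra.
have Plarge := @surplus_large R V (1 + 4 / e) K0 n00.
have Pok : 1 - e / 2 <= Pr (@coin R V) ok.
  have c01 := @coin01 R V.
  have -> : Pr (@coin R V) ok = 1 - Pr (@coin R V) (fun A =>
     (`|surplus R A| < e / 24 * s) || ((1 + 4 / e) * s < `|surplus R A|)).
    by rewrite -Pr_not; apply: eq_Ex => A; rewrite /ok negb_or.
  have h := Pr_or c01 (fun A : {set V} => `|surplus R A| < e / 24 * s)
     (fun A => (1 + 4 / e) * s < `|surplus R A|).
  have s6 : 6 / s <= e / 8.
    rewrite ler_pdivrMr //; move: s48; rewrite ler_pdivrMr //; clear; lra.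
  have K8 : ((1 + 4 / e) ^+ 2)^-1 <= e / 8.
    rewrite -[leRHS]invrK lef_pV2 ?posrE ?invr_gt0 ?exprn_gt0 ?divr_gt0 // invf_div.
    have -> : 8 / e = 2 * (4 / e) by field; rewrite gt_eqF.
    move: (4 / e) e4; clear => x x0; nra.
  move: h Psmall Plarge; rewrite -/s => h Psmall Plarge.
  have := le_trans h (lerD (le_trans Psmall (lerD (lexx _) s6)) (le_trans Plarge K8)).
  by rewrite lerD2l lerN2 => /le_trans -> //; clear -e0; lra.
apply: (@le_trans _ _ (Ex (@coin R V) (fun A => (ok A)%:R - e / 2))).
  rewrite ExB Ex_cst -/(Pr _ ok); clear -Pok ee e0; lra.
apply: (le_Ex (@coin01 R V)) => A.
case hA: (ok A); first exact: okP.
by apply: le_trans (Pr_ge0 (edge_pr01 p01) _); rewrite /= sub0r oppr_le0 ltW.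
Qed.
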